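(* Let $d\geq 2$ and let $P$ be a polynomial in $d$ variables with complex coefficients, of degree $m$, such that $e_1$ is characteristic for $P$ while $e_d$ is not. Moreover, assume that $$\forall\,x\in\mathbb{R}^d:\quad P(x_1,\ldots,x_d)=\sum_{k=0}^m Q_k(x_1,\ldots,x_{d-1})\,x_d^k,$$ with polynomials $Q_k$ in $d-1$ variables with complex coefficients satisfying $\deg_{x_1}(Q_k)<m-k$ for every $0\leq k\leq m-1$. Let $X_1\subseteq X_2\subseteq\mathbb{R}^d$ be open such that the restriction map $$r_{\mathscr{D}'}:\mathscr{D}'_P(X_2)\to\mathscr{D}'_P(X_1),\quad u\mapsto u_{|X_1}$$ has dense range. Then there is no $c\in\mathbb{R}$ such that, with $H_c=\{x\in\mathbb{R}^d;\,x_1=c\}$ (a characteristic hyperplane of $P(D)$), the set $X_2$ contains a compact connected component of $(\mathbb{R}^d\setminus X_1)\cap H_c$.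
   Context: $e_1,\dots,e_d$ is the standard basis of $\mathbb{R}^d$. For $P(x)=\sum_{|\alpha|\leq m}a_\alpha x^\alpha$ of degree $m$, the principal part is $P_m(x)=\sum_{|\alpha|=m}a_\alpha x^\alpha$, and $P(D)u=\sum_{|\alpha|\leq m}a_\alpha(-i)^{|\alpha|}\partial^\alpha u$. A vector $N\in\mathbb{R}^d\setminus\{0\}$ is characteristic for $P$ if $P_m(N)=0$, and then hyperplanes $\{x;\langle x,N\rangle=c\}$, $c\in\mathbb{R}$, are called characteristic. $\deg_{x_1}Q_k$ denotes the degree of $Q_k$ with respect to the variable $x_1$ (with $\deg_{x_1}0=-\infty$). For $X\subseteq\mathbb{R}^d$ open, $\mathscr{D}'(X)$ is the space of distributions on $X$ with the strong dual topology (as dual of the test function space $\mathscr{D}(X)$), and $\mathscr{D}'_P(X)=\{u\in\mathscr{D}'(X);\,P(D)u=0\text{ in }X\}$ carries the relative topology. *)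

(* Defs.v *)
From HB Require Import structures.
From mathcomp Require Import all_boot all_order all_algebra.
From mathcomp Require Import all_classical all_reals all_analysis.
From mathcomp Require Import complex.
(* The notations of mpoly clash with those of MathComp-Analysis. *)
From mathcomp Require Import -(notations) mpoly.

Set Implicit Arguments.
Unset Strict Implicit.
Unset Printing Implicit Defensive.

Import Order.TTheory GRing.Theory Num.Theory numFieldNormedType.Exports.
Import complex.ComplexField.Normc.

Local Open Scope classical_set_scope.
Local Open Scope ring_scope.
Local Open Scope complex_scope.

Section SmoothFunctions.
Context {R : realType} {d : nat}.
Implicit Types (f : 'rV[R]_d -> R[i]) (g h : 'rV[R]_d -> R) (s : seq 'I_d).

Definition basisv (i : 'I_d) : 'rV[R]_d := delta_mx 0 i.

Definition rpartials s g : 'rV[R]_d -> R :=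
  foldr (fun i h x => 'D_(basisv i) h x) g s.

Definition rsmooth g := forall s,
  continuous (rpartials s g) /\
  forall i x, derivable (rpartials s g) x (basisv i).

(* Complex-valued functions of a real variable are differentiated
   componentwise. *)
Definition partials s f : 'rV[R]_d -> R[i] := fun x =>
  rpartials s (fun y => complex.Re (f y)) x +i* rpartials s (fun y => complex.Im (f y)) x.

Definition smooth f :=
  rsmooth (fun y => complex.Re (f y)) /\ rsmooth (fun y => complex.Im (f y)).

Definition supp f : set 'rV[R]_d := closure [set x | f x != 0].

Definition is_testfun (X : set 'rV[R]_d) f :=
  [/\ smooth f, compact (supp f) & supp f `<=` X].

Lemma rpartials_lin s (c : R) g h : rsmooth g -> rsmooth h ->
  rpartials s (fun x => c * g x + h x) =
  (fun x => c * rpartials s g x + rpartials s h x).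
Proof.
move=> sg sh; elim: s => //= i s ->.
have [[_ dg] [_ dh]] := (sg s, sh s).
apply/funext => x.
have dcg := derivableZ (k := c) (dg i x).
have -> : (fun y => c * rpartials s g y + rpartials s h y) =
  (c \*: rpartials s g) + rpartials s h by [].
by rewrite deriveD // deriveZ.
Qed.

Lemma rsmooth_lin (c : R) g h :
  rsmooth g -> rsmooth h -> rsmooth (fun x => c * g x + h x).
Proof.
move=> sg sh s; rewrite rpartials_lin //.
have [[cg dg] [ch dh]] := (sg s, sh s); split=> [x|i x].
  by apply: (cvgD (cvgM (cvg_cst c) (cg x)) (ch x)).
have -> : (fun y => c * rpartials s g y + rpartials s h y) =
  (c \*: rpartials s g) + rpartials s h by [].
by apply: derivableD => //; apply: derivableZ.
Qed.

Lemma rpartials0 s : rpartials s (fun=> 0) = (fun=> 0).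
Proof.
elim: s => //= i s ->; apply/funext => x; exact: derive_cst.
Qed.

Lemma rsmooth0 : rsmooth (fun=> 0).
Proof.
move=> s; rewrite rpartials0.
by split=> [x|i x]; [exact: cst_continuous|exact: derivable_cst].
Qed.

Lemma rpartials_cat s s' g :
  rpartials s (rpartials s' g) = rpartials (s ++ s') g.
Proof. by rewrite /rpartials foldr_cat. Qed.

Lemma rsmooth_partials s g : rsmooth g -> rsmooth (rpartials s g).
Proof. by move=> sg s'; rewrite rpartials_cat; exact: sg. Qed.

Lemma rpartials_near0 s g (x : 'rV[R]_d) :
  (\forall y \near x, g y = 0) -> \forall y \near x, rpartials s g y = 0.
Proof.
move=> gx; elim: s => //= i s IH.
have {}IH := near_join IH; near=> y.
have gy : \forall z \near y, rpartials s g z = 0 by near: y. rewrite (near_eq_derive (g := fun=> 0)) ?derive_cst //.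
Unshelve. all: by end_near. Qed.

Lemma suppNP f x : ~ supp f x <-> \forall y \near x, f y = 0.
Proof.
rewrite /supp; split=> [|fx /(_ _ fx)[y [/= /eqP]]//].
apply: contra_notP => nfx A Ax; apply: contrapT => /forallNP fA.
apply: nfx; near=> y; apply/eqP/negPn/negP => fy.
by apply: (fA y); split=> //; near: y.
Unshelve. all: by end_near. Qed.

Lemma supp_partials s f : supp (partials s f) `<=` supp f.
Proof.
move=> x; apply: contraPP => /suppNP fx; apply/suppNP.
have re0 : \forall y \near x, complex.Re (f y) = 0.
  by near=> y; have -> : f y = 0 by near: y.
have im0 : \forall y \near x, complex.Im (f y) = 0.
  by near=> y; have -> : f y = 0 by near: y.
near=> y; rewrite /partials.
have -> : rpartials s (fun y => complex.Re (f y)) y = 0.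
  by near: y; exact: rpartials_near0.
have -> // : rpartials s (fun y => complex.Im (f y)) y = 0.
by near: y; exact: rpartials_near0.
Unshelve. all: by end_near. Qed.

Lemma supp_lin (c : R[i]) f f' :
  supp (fun x => c * f x + f' x) `<=` supp f `|` supp f'.
Proof.
move=> x; apply: contraPP => /not_orP[/suppNP fx /suppNP fx'].
apply/suppNP; near=> y.
have -> : f y = 0 by near: y.
have -> : f' y = 0 by near: y.
by rewrite mulr0 addr0.
Unshelve. all: by end_near. Qed.

Lemma is_testfun_partials X s f : is_testfun X f -> is_testfun X (partials s f).
Proof.
move=> [[sre sim] cf fX]; split.
- by split; [exact: (rsmooth_partials s sre)|exact: (rsmooth_partials s sim)].
- by apply: (subclosed_compact _ cf); [exact: closed_closure|exact: supp_partials].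
- exact: subset_trans (@supp_partials s f) fX.
Qed.

Lemma is_testfun0 X : is_testfun X (fun=> 0).
Proof.
have s0 : supp (fun=> 0) = set0.
  by apply/seteqP; split=> // x /=; apply/suppNP; near=> y.
by rewrite /is_testfun s0; split; [split; exact: rsmooth0|exact: compact0|].
Unshelve. all: by end_near. Qed.

Lemma is_testfun_lin X (c : R[i]) f f' : is_testfun X f -> is_testfun X f' ->
  is_testfun X (fun x => c * f x + f' x).
Proof.
move=> [[rf mf] cf fX] [[rf' mf'] cf' fX'].
split; last 2 first.
- apply: (subclosed_compact _ (compactU cf cf')); first exact: closed_closure.
  exact: supp_lin.
- by move=> x /supp_lin[/fX|/fX'].
split.
- have -> : (fun y => complex.Re (c * f y + f' y)) = fun y =>
      complex.Re c * complex.Re (f y) +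
      (- complex.Im c * complex.Im (f y) + complex.Re (f' y)).
    apply/funext => y; case: c (f y) (f' y) => a b [u v] [u' v'] /=.
    by rewrite addrA mulNr.
  by do 2!apply: rsmooth_lin => //.
- have -> : (fun y => complex.Im (c * f y + f' y)) = fun y =>
      complex.Re c * complex.Im (f y) +
      (complex.Im c * complex.Re (f y) + complex.Im (f' y)).
    apply/funext => y; case: c (f y) (f' y) => a b [u v] [u' v'] /=.
    by rewrite addrA.
  by do 2!apply: rsmooth_lin => //.
Qed.

Definition testfun_pred (X : set 'rV[R]_d) : {pred 'rV[R]_d -> R[i]^o} :=
  fun f => `[< is_testfun X f >].

Lemma testfun_pred_submod X : submod_closed (testfun_pred X).
Proof.
split=> [|c f f' /asboolP tf /asboolP tf']; apply/asboolP.
  exact: is_testfun0.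
exact: is_testfun_lin.
Qed.

HB.instance Definition _ X :=
  GRing.isSubmodClosed.Build _ _ (testfun_pred X) (testfun_pred_submod X).

(* The test functions D(X), as functions on the whole of R^d that are
   supported in X. *)
Record testfun (X : set 'rV[R]_d) := TestFun {
  testfun_fun :> 'rV[R]_d -> R[i]^o ;
  _ : testfun_fun \in testfun_pred X
}.

HB.instance Definition _ X := [isSub for @testfun_fun X].
HB.instance Definition _ X := [Choice of testfun X by <:].
HB.instance Definition _ X :=
  [SubChoice_isSubLmodule of testfun X by <:].

End SmoothFunctions.

Section TestFunctionTopology.
Context {R : realType} {d : nat} {X : set 'rV[R]_d}.
Implicit Types (phi psi chi : testfun X) (p q : testfun X -> R).

Lemma testfunP phi : is_testfun X phi.
Proof. by case: phi => f /= /asboolP. Qed.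

Lemma testfunD phi psi x : (phi + psi) x = phi x + psi x.
Proof. by []. Qed.

Lemma testfunZ (a : R[i]) phi x : (a *: phi) x = a * phi x.
Proof. by []. Qed.

Definition testpartials s phi : testfun X :=
  TestFun (asboolT (is_testfun_partials s (testfunP phi))).

(* The C^m norm: the supremum of all partial derivatives of order at most m;
   it is finite on test functions. *)
Definition Cnorm (m : nat) phi : \bar R :=
  ereal_sup [set y | exists s x,
    (size s <= m)%N /\ y = (normc (partials s phi x))%:E].

(* The continuous seminorms of the inductive limit topology of D(X), i.e. of
   the finest locally convex topology for which the inclusions of the Frechet
   spaces D_K (K a compact subset of X) are continuous: the seminorms whose
   restriction to each D_K is continuous. *)
Definition lf_seminorm p :=
  [/\ forall phi psi, p (phi + psi) <= p phi + p psi,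
      forall (a : R[i]) phi, p (a *: phi) = normc a * p phi &
      forall K : set 'rV[R]_d, compact K -> K `<=` X ->
        exists (C : R) (m : nat), 0 <= C /\
          forall phi, supp phi `<=` K -> ((p phi)%:E <= C%:E * Cnorm m phi)%E].

Definition testfun_nbhs phi : set_system (testfun X) := fun U =>
  exists p e, [/\ lf_seminorm p, 0 < e & [set psi | p (psi - phi) < e] `<=` U].

HB.instance Definition _ := hasNbhs.Build (testfun X) testfun_nbhs.

Lemma normc_ge0 (z : R[i]) : 0 <= normc z.
Proof. by case: z => a b; rewrite sqrtr_ge0. Qed.

Lemma Cnorm_ge0 m phi : (0 <= Cnorm m phi)%E.
Proof.
apply: (@le_trans _ _ (normc (partials [::] phi 0))%:E).
  by rewrite lee_fin normc_ge0.
by apply: ereal_sup_ubound; exists [::], 0.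
Qed.

Lemma le_Cnorm m m' phi : (m <= m')%N -> (Cnorm m phi <= Cnorm m' phi)%E.
Proof.
move=> mm'; apply: le_ereal_sup => _ [s [x [sm ->]]].
by exists s, x; split=> //; exact: leq_trans mm'.
Qed.

Lemma lf_seminorm0 p : lf_seminorm p -> p 0 = 0.
Proof. by move=> [_ pZ _]; rewrite -(scale0r 0) pZ normc0 mul0r. Qed.

Lemma lf_seminormN p phi : lf_seminorm p -> p (- phi) = p phi.
Proof. by move=> [_ pZ _]; rewrite -scaleN1r pZ normcN normc1 mul1r. Qed.

Lemma lf_seminorm_ge0 p phi : lf_seminorm p -> 0 <= p phi.
Proof.
move=> sp; have [pD _ _] := sp.
have := pD phi (- phi); rewrite subrr lf_seminorm0 // lf_seminormN //.
by rewrite -mulr2n pmulrn_lge0.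
Qed.

Lemma lf_seminorm_cst0 : lf_seminorm (fun=> 0).
Proof.
split=> [*|*|K _ _]; rewrite ?addr0 ?mulr0 //.
by exists 0, 0%N; split=> // phi _; rewrite mul0e.
Qed.

Lemma lf_seminormD p q : lf_seminorm p -> lf_seminorm q ->
  lf_seminorm (fun phi => p phi + q phi).
Proof.
move=> [pD pZ pK] [qD qZ qK]; split.
- by move=> phi psi; rewrite addrACA lerD.
- by move=> a phi; rewrite pZ qZ mulrDr.
- move=> K cK KX; have [C [m [C0 Cp]]] := pK K cK KX.
  have [C' [m' [C'0 Cq]]] := qK K cK KX.
  exists (C + C'), (maxn m m'); split; first exact: addr_ge0.
  move=> phi phiK; rewrite !EFinD ge0_muleDl ?lee_fin //.
  apply: leeD.
  + apply: (le_trans (Cp _ phiK)); apply: lee_wpmul2l; rewrite ?lee_fin //.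
    by apply: le_Cnorm; exact: leq_maxl.
  + apply: (le_trans (Cq _ phiK)); apply: lee_wpmul2l; rewrite ?lee_fin //.
    by apply: le_Cnorm; exact: leq_maxr.
Qed.

Let testfun_nbhs_filter phi : ProperFilter (nbhs phi).
Proof.
split.
  move=> [p [e [sp e0 /(_ phi)]]]; apply => /=.
  by rewrite subrr lf_seminorm0.
split.
- by exists (fun=> 0), 1; split=> //; exact: lf_seminorm_cst0.
- move=> U V [p [e [sp e0 pU]]] [q [e' [sq e'0 qV]]].
  exists (fun phi => p phi + q phi), (Num.min e e'); split.
  + exact: lf_seminormD.
  + by rewrite lt_min e0.
  + move=> psi /=; rewrite lt_min => /andP[pq pq']; split.
      apply: pU => /=; apply: le_lt_trans pq.
      by rewrite lerDl lf_seminorm_ge0.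
    apply: qV => /=; apply: le_lt_trans pq'.
    by rewrite lerDr lf_seminorm_ge0.
- move=> U V UV [p [e [sp e0 pU]]]; exists p, e; split=> //.
  exact: subset_trans UV.
Qed.

Let testfun_nbhs_singleton phi (U : set (testfun X)) : nbhs phi U -> U phi.
Proof.
move=> [p [e [sp e0 pU]]]; apply: pU => /=.
by rewrite subrr lf_seminorm0.
Qed.

Let testfun_nbhs_nbhs phi (U : set (testfun X)) :
  nbhs phi U -> nbhs phi (nbhs^~ U).
Proof.
move=> [p [e [sp e0 pU]]]; exists p, e; split=> // psi /= pe.
exists p, (e - p (psi - phi)); split=> //; first by rewrite subr_gt0.
move=> chi /=; rewrite ltrBrDr => ce; apply: pU => /=.
apply: le_lt_trans ce; have [pD _ _] := sp.
by rewrite -(subrKA psi); exact: pD.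
Qed.

HB.instance Definition _ := Nbhs_isNbhsTopological.Build (testfun X)
  testfun_nbhs_filter testfun_nbhs_singleton testfun_nbhs_nbhs.

End TestFunctionTopology.

Section Distributions.
Context {R : realType} {d : nat}.
Implicit Types (X : set 'rV[R]_d) (P : mpoly d R[i]).

(* Von Neumann boundedness; MathComp-Analysis has it only for normed spaces. *)
Definition vN_bounded (K : numDomainType) (E : preTopologicalLmodType K)
    (B : set E) :=
  forall U : set E, nbhs 0 U ->
    exists2 r : K, 0 < r & forall a : K, r <= `|a| -> B `<=` [set a *: u | u in U].

(* The topology of uniform convergence on the bounded subsets of D(X); its
   restriction to the continuous linear forms is the strong dual topology. *)
Definition strong_dual_space X :=
  {family @vN_bounded R[i] (testfun X), testfun X -> R[i]^o}.

Definition distribution X : set (strong_dual_space X) :=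
  [set u | linear (u : testfun X -> R[i]^o) /\
           continuous (u : testfun X -> R[i]^o)].

(* A multi-index as a sequence of directions of differentiation. *)
Definition mseq (a : multinom d) : seq 'I_d :=
  flatten [seq nseq (a i) i | i <- enum 'I_d].

Definition dist_partial X (a : multinom d) (u : testfun X -> R[i]) :
    testfun X -> R[i] :=
  fun phi => (-1) ^+ mdeg a * u (testpartials (mseq a) phi).

Definition dist_PD X P (u : testfun X -> R[i]) : testfun X -> R[i] :=
  fun phi => \sum_(a <- msupp P)
    mcoeff a P * (0 -i* 1) ^+ mdeg a * dist_partial a u phi.

(* D'_P(X), whose coercion to a type carries the relative topology. *)
Definition dist_ker P X : set (strong_dual_space X) :=
  [set u | @distribution X u /\ forall phi, dist_PD P u phi = 0].

End Distributions.
Arguments distribution {R d} X.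
Arguments dist_ker {R d} P X.

Section Polynomials.
Context {R : realType} {d : nat}.
Implicit Types (P : mpoly d R[i]).

Definition principal_part P : mpoly d R[i] := pihomog mdeg (msize P).-1 P.

Definition real_eval P (x : 'rV[R]_d) : R[i] := meval (fun i => (x 0 i)%:C) P.

Definition characteristic P (N : 'rV[R]_d) :=
  N != 0 /\ real_eval (principal_part P) N = 0.

Definition degree_in (i : 'I_d) P : \bar int :=
  \big[maxe/-oo%E]_(a <- msupp P) (Posz (a i))%:E.

End Polynomials.

Section Restriction.
Context {R : realType} {d : nat} {X1 X2 : set 'rV[R]_d} (P : mpoly d R[i])
  (X12 : X1 `<=` X2).

Lemma is_testfun_incl (f : 'rV[R]_d -> R[i]) :
  is_testfun X1 f -> is_testfun X2 f.
Proof. by move=> [sf cf fX]; split=> //; exact: subset_trans X12. Qed.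

Definition testfun_incl (phi : testfun X1) : testfun X2 :=
  TestFun (asboolT (is_testfun_incl (testfunP phi))).

Lemma testfun_incl_lin : linear testfun_incl.
Proof. by move=> a phi psi; exact: val_inj. Qed.

Lemma testfun_incl_continuous : continuous testfun_incl.
Proof.
move=> phi U [p [e [[pD pZ pK] e0 pU]]].
exists (fun psi => p (testfun_incl psi)), e; split=> //.
  split=> [f g|a f|K cK KX].
  - have -> : testfun_incl (f + g) = testfun_incl f + testfun_incl g.
      exact: val_inj.
    exact: pD.
  - have -> : testfun_incl (a *: f) = a *: testfun_incl f by exact: val_inj.
    exact: pZ.
  - have [C [m [C0 Cp]]] := pK K cK (subset_trans KX X12).
    by exists C, m; split=> // f fK; exact: Cp.
move=> psi /= pe; apply: pU => /=.
by have <- : testfun_incl (psi - phi) = testfun_incl psi - testfun_incl phi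
  by exact: val_inj.
Qed.

Lemma dist_restrict_subproof (u : dist_ker P X2) :
  (fun phi : testfun X1 => set_val u (testfun_incl phi)) \in dist_ker P X1.
Proof.
have [[ulin ucont] uP] := set_mem (valP u).
apply/mem_set; split; first split.
- by move=> a phi psi; rewrite testfun_incl_lin; exact: ulin.
- move=> phi; apply: continuous_comp; last exact: ucont.
  exact: testfun_incl_continuous.
- move=> phi; rewrite -[RHS](uP (testfun_incl phi)); apply: eq_bigr => a _.
  by congr (_ * (_ * set_val u _)); exact: val_inj.
Qed.

Definition dist_restrict (u : dist_ker P X2) : dist_ker P X1 :=
  exist (fun v : strong_dual_space X1 => v \in dist_ker P X1)
    (fun phi => set_val u (testfun_incl phi)) (dist_restrict_subproof u).

End Restriction.

(* Main.v *)
Require Import Defs.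
From HB Require Import structures.
From mathcomp Require Import all_boot all_order all_algebra.
From mathcomp Require Import all_classical all_reals all_analysis.
From mathcomp Require Import complex.
From mathcomp Require Import -(notations) mpoly.
From mathcomp Require Import ring lra zify.

Set Implicit Arguments.
Unset Strict Implicit.
Unset Printing Implicit Defensive.

Import Order.TTheory GRing.Theory Num.Theory numFieldNormedType.Exports.

Local Open Scope classical_set_scope.
Local Open Scope ring_scope.
Local Open Scope complex_scope.

(* Write [PT] for the formal transpose of [P(D)]. Let [C] be a compact component
   of [~` X1 `&` H_c] contained in [X2], and let [x] be a point of [C].

   The degree condition on the [Q_k] says that [z_d^m] is the only monomial of
   degree at least [m] in [z_1] and [z_d] alone that occurs in [P(z)]. Hence
   [PT (sum_N g_N(z_1) (z_d - x_d)^N / N!) = 0] can be solved for the [g_N] by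
   recursion, starting from a bump function [g_0]; each step costs less than one
   derivative, so that for [g_0] of a suitable Gevrey class the series converges.
   This gives a smooth [w] with [PT w = 0], [w x != 0], which vanishes unless
   [z_1] is close to [c].

   As [C] is compact there is a cutoff [chi] such that [psi := chi w] is a test
   function on [X2], while [chi] is locally constant near the points of
   [supp psi] outside [X1], so that [phi := PT psi] is a test function on [X1].
   Every [u] in [D'_P(X2)] vanishes on [phi]. On the other hand [P(D)] has a
   fundamental solution with pole [x]; since [x] is not in [X1], its restriction
   to [X1] lies in [D'_P(X1)], and its value on [phi] is [psi x != 0]. Hence the
   restriction map does not have dense range.

   As [e_d] is noncharacteristic, the fundamental solution is a Hahn-Banach
   extension, its bound being an elementary [L^2] estimate: for the weight
   [exp(z_d^2)] the adjoint [a'] of [a = d/dz_d] satisfies [a' a = a a' + 2],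
   which gives [|| sum_k B_k a^k f || >= || B_m' f ||] for operators [B_k] that do
   not involve [z_d], and [B_m] is here a nonzero constant. *)

(** * Smooth functions *)

Section Calculus.
Context {R : realType} {d : nat}.
Implicit Types (f g h : 'rV[R]_d -> R) (x v : 'rV[R]_d) (s : seq 'I_d).

(** The margin that makes the series converge is small. The coefficient of index [N + m] is computed
    from those of index [N + b], [b < m], with at most [m - b - 1] derivatives, so that about
    [N - N/m] derivatives of [g_0] enter [g_N]. A general bump function has no bound on its
    derivatives, and an analytic one does not exist; Gevrey order [1 + 1/(2m)] spends [N/(2m)] of
    the gain [N/m], and the other half beats every geometric factor when compared with [N!].

    The weighted estimate controls an [L^2] norm, while the Hahn-Banach extension requires a bound
    on the value at a point. The operator has constant coefficients and commutes with derivatives,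
    so a Sobolev inequality closes this gap. Besides it, the integral only has to be linear and
    positive, to vanish on derivatives, and to be bounded by the supremum times the size of a box;
    limits of Riemann sums suffice for that. *)

Lemma line_quotient g x v (t : R) :
  (fun h : R => h^-1 *: (((fun t => g (x + t *: v)) \o shift t) (h *: (1 : R))
     - g (x + t *: v))) =
  (fun h : R => h^-1 *: ((g \o shift (x + t *: v)) (h *: v) - g (x + t *: v))).
Proof.
apply/funext => h /=; congr (_ *: (g _ - _)).
by rewrite (_ : h *: (1 : R) = h) ?scalerDl 1?addrCA//; exact: mulr1.
Qed.

Lemma is_derive_line g x v (t : R) df :
  is_derive (x + t *: v) v g df <->
  is_derive t (1 : R) (fun t => g (x + t *: v)) df.
Proof.
by split=> -[dg <-]; apply: DeriveDef; move: dg;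
  rewrite /derivable /derive line_quotient.
Qed.

Lemma is_derive_comp1 (G : R -> R) g x v a df :
  is_derive x v g df -> is_derive (g x) 1 G a -> is_derive x v (G \o g) (a * df).
Proof.
rewrite -{1}[x]addr0 -(scale0r v) => /is_derive_line dg dG.
have -> : x = x + 0 *: v by rewrite scale0r addr0.
apply/is_derive_line; apply: is_derive1_comp => //.
by rewrite scale0r addr0.
Qed.

Lemma MVT_line g x v (t : R) : (forall y, derivable g y v) ->
  exists2 c : R, `|c| <= `|t| & g (x + t *: v) - g x = t * 'D_v g (x + c *: v).
Proof.
move=> dg.
have key y (u : R) : 0 <= u -> exists2 c : R, 0 <= c <= u &
    g (y + u *: v) - g y = u * 'D_v g (y + c *: v).
  move=> u0.
  have dl (r : R) : is_derive r (1 : R) (fun t => g (y + t *: v))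
      ('D_v g (y + r *: v)).
    by apply/is_derive_line; exact: DeriveDef.
  have [|c] := @MVT_segment _ (fun t => g (y + t *: v))
      (fun t => 'D_v g (y + t *: v)) 0 u u0 (fun r _ => dl r).
    apply: continuous_subspaceT => r; apply: differentiable_continuous.
    by apply/derivable1_diffP; case: (dl r).
  rewrite in_itv /= => cu; rewrite scale0r addr0 subr0 => ->.
  by exists c; rewrite // mulrC.
have [t0|t0] := leP 0 t.
  have [c /andP[c0 ct] ->] := key x t t0.
  by exists c => //; rewrite !ger0_norm.
(* For [t < 0] the segment is run through from its other end [x + t *: v]. *)
have Nt0 : 0 <= - t by rewrite oppr_ge0 ltW.
have [c /andP[c0 ct]] := key (x + t *: v) (- t) Nt0.
rewrite -addrA -scalerDl subrr scale0r addr0 => E.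
exists (t + c); first by rewrite (ltr0_norm t0) ler_norml; apply/andP; split; lra.
by rewrite scalerDl addrA -opprB E mulNr opprK.
Qed.

Lemma taylor_line g x v (t C : R) :
  (forall y, derivable g y v) -> (forall y, derivable ('D_v g) y v) ->
  (forall c : R, `|c| <= `|t| -> `|'D_v ('D_v g) (x + c *: v)| <= C) ->
  `|g (x + t *: v) - g x - t * 'D_v g x| <= C * t ^+ 2.
Proof.
move=> dg ddg bC; have [c ct ->] := MVT_line x t dg.
have [c' cc' E] := MVT_line x c ddg.
rewrite -mulrBr E !normrM.
have C0 : 0 <= C by apply: le_trans (bC 0 _); rewrite ?normr0.
have B := bC c' (le_trans cc' ct).
rewrite [leLHS](_ : _ = `|'D_v ('D_v g) (x + c' *: v)| * (`|c| * `|t|)); last by ring.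
rewrite (_ : t ^+ 2 = `|t| * `|t|); last by rewrite -expr2 real_normK ?num_real.
by apply: ler_pM => //; rewrite ?mulr_ge0// ler_pM.
Qed.

Lemma rsmooth_continuous g : rsmooth g -> continuous g.
Proof. by move=> /(_ [::])[]. Qed.

Lemma rsmooth_derivable g i x : rsmooth g -> derivable g x (basisv i).
Proof. by move=> /(_ [::])[_]; exact. Qed.

Arguments rsmooth_derivable [g] i x _.
Lemma rsmooth_derive g i : rsmooth g -> rsmooth ('D_(basisv i) g).
Proof. exact: (rsmooth_partials [:: i]). Qed.

(** Coinduction spares all formulas for higher derivatives: stability of a class under one partial
    derivative passes to every list of directions. *)
Lemma rsmooth_coind (F : set ('rV[R]_d -> R)) :
  (forall g, F g -> continuous g /\
    forall i, (forall x, derivable g x (basisv i)) /\ F ('D_(basisv i) g)) ->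
  forall g, F g -> rsmooth g.
Proof.
move=> HF g Fg s.
have Fs : F (rpartials s g) by elim: s => //= i s IH; have [_ /(_ i)[]] := HF _ IH.
by have [cs ds] := HF _ Fs; split=> // i x; have [] := ds i.
Qed.

Definition derivatives (G : nat -> R -> R) :=
  forall k t, is_derive t (1 : R) (G k) (G k.+1 t).

Lemma derivatives_continuous G k : derivatives G -> continuous (G k).
Proof.
move=> dG t; apply: differentiable_continuous; apply/derivable1_diffP.
by case: (dG k t).
Qed.

(** The constructors are chosen so that the sum, product, quotient and chain rules express a partial
    derivative by the same constructors. In [smooth_alg_comp] the order [k] is arbitrary because
    differentiating [G k] produces [G k.+1]. *)
Inductive smooth_alg : ('rV[R]_d -> R) -> Prop :=
| smooth_alg_base f : rsmooth f -> smooth_alg f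
| smooth_alg_cst (c : R) : smooth_alg (fun=> c)
| smooth_alg_coord i : smooth_alg (fun x => x 0 i)
| smooth_alg_add f g : smooth_alg f -> smooth_alg g ->
    smooth_alg (fun x => f x + g x)
| smooth_alg_mul f g : smooth_alg f -> smooth_alg g ->
    smooth_alg (fun x => f x * g x)
| smooth_alg_inv f : smooth_alg f -> (forall x, f x != 0) ->
    smooth_alg (fun x => (f x)^-1)
| smooth_alg_comp G k f : derivatives G -> smooth_alg f ->
    smooth_alg (fun x => G k (f x)).

Lemma is_derive_coord i j x :
  is_derive x (basisv j) (fun x : 'rV[R]_d => x 0 i) (i == j)%:R.
Proof.
rewrite -{1}[x]addr0 -(scale0r (basisv j)); apply/is_derive_line.
have dl : is_derive (0 : R) (1 : R) (cst (x 0 i) + ((i == j)%:R \*: @id R))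
    (0 + (i == j)%:R *: (1 : R)).
  exact: is_deriveD.
move: dl; rewrite add0r (_ : _ *: 1 = (i == j)%:R :> R); last exact: mulr1.
congr (is_derive _ _ _ _).
by apply/funext => t; rewrite /= !mxE eqxx /= eq_sym mulrC.
Qed.

Lemma smooth_alg_derive f : smooth_alg f -> continuous f /\
  forall i, (forall x, derivable f x (basisv i)) /\
    smooth_alg ('D_(basisv i) f).
Proof.
elim=> {f} [f sf|c|i|f g sf [cf df] sg [cg dg]|f g sf [cf df] sg [cg dg]
  |f sf [cf df] f0|G k f dG sf [cf df]].
- split; first exact: rsmooth_continuous.
  move=> i; split; first by move=> x; exact: rsmooth_derivable.
  exact/smooth_alg_base/rsmooth_derive.
- split=> [|i]; first exact: cst_continuous.
  split=> [x|]; first exact: derivable_cst.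
  rewrite (_ : 'D_(basisv i) _ = fun=> 0); first exact: smooth_alg_cst.
  by apply/funext => x; rewrite derive_cst.
- split=> [|j]; first exact: coord_continuous.
  split=> [x|]; first by case: (is_derive_coord i j x).
  rewrite (_ : 'D_(basisv j) _ = fun=> (i == j)%:R :> R); first exact: smooth_alg_cst.
  by apply/funext => x; case: (is_derive_coord i j x).
- split=> [x|i]; first exact: (cvgD (cf x) (cg x)).
  have [[dfi sfi] [dgi sgi]] := (df i, dg i).
  split=> [x|]; first exact: (derivableD (dfi x) (dgi x)).
  rewrite (_ : 'D_(basisv i) _ = fun x => 'D_(basisv i) f x + 'D_(basisv i) g x).
    exact: smooth_alg_add.
  by apply/funext => x; exact: (deriveD (dfi x) (dgi x)).
- split=> [x|i]; first exact: (cvgM (cf x) (cg x)).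
  have [[dfi sfi] [dgi sgi]] := (df i, dg i).
  split=> [x|]; first exact: (derivableM (dfi x) (dgi x)).
  rewrite (_ : 'D_(basisv i) _ =
      fun x => f x * 'D_(basisv i) g x + g x * 'D_(basisv i) f x).
    by apply: smooth_alg_add; apply: smooth_alg_mul.
  by apply/funext => x; exact: (deriveM (dfi x) (dgi x)).
- split=> [x|i]; first exact: (cvgV (f0 x) (cf x)).
  have [dfi sfi] := df i.
  split=> [x|]; first exact: (derivableV (f0 x) (dfi x)).
  rewrite (_ : 'D_(basisv i) _ =
      fun x => -1 * ((f x)^-1 * (f x)^-1 * 'D_(basisv i) f x)).
    apply: smooth_alg_mul; first exact: smooth_alg_cst.
    apply: smooth_alg_mul => //.
    by apply: smooth_alg_mul; exact: smooth_alg_inv.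
  apply/funext => x; rewrite (deriveV (f0 x) (dfi x)).
  by rewrite mulN1r -mulNr -invfM -expr2.
- split=> [x|i].
    by apply: continuous_comp; [exact: cf|exact: derivatives_continuous].
  have [dfi sfi] := df i.
  have D x : is_derive x (basisv i) (fun x => G k (f x))
      (G k.+1 (f x) * 'D_(basisv i) f x).
    by apply: (@is_derive_comp1 (G k)); [exact: DeriveDef|exact: dG].
  split=> [x|]; first by case: (D x).
  rewrite (_ : 'D_(basisv i) _ = fun x => G k.+1 (f x) * 'D_(basisv i) f x).
    by apply: smooth_alg_mul => //; exact: smooth_alg_comp.
  by apply/funext => x; case: (D x).
Qed.

Lemma smooth_alg_rsmooth f : smooth_alg f -> rsmooth f.
Proof. by apply: rsmooth_coind => g /smooth_alg_derive. Qed.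

Lemma rsmoothM f g : rsmooth f -> rsmooth g -> rsmooth (fun x => f x * g x).
Proof.
by move=> sf sg; apply: smooth_alg_rsmooth;
  apply: smooth_alg_mul; exact: smooth_alg_base.
Qed.

Lemma rsmoothD f g : rsmooth f -> rsmooth g -> rsmooth (fun x => f x + g x).
Proof.
by move=> sf sg; apply: smooth_alg_rsmooth;
  apply: smooth_alg_add; exact: smooth_alg_base.
Qed.

Lemma rsmooth_cst (c : R) : rsmooth (fun _ : 'rV[R]_d => c).
Proof. exact/smooth_alg_rsmooth/smooth_alg_cst. Qed.

Lemma deriveDx f g i x : rsmooth f -> rsmooth g ->
  'D_(basisv i) (fun x => f x + g x) x =
  'D_(basisv i) f x + 'D_(basisv i) g x.
Proof.
by move=> sf sg; exact: (deriveD (rsmooth_derivable i x sf) (rsmooth_derivable i x sg)).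
Qed.

Lemma deriveMx f g i x : rsmooth f -> rsmooth g ->
  'D_(basisv i) (fun x => f x * g x) x =
  'D_(basisv i) f x * g x + f x * 'D_(basisv i) g x.
Proof.
move=> sf sg; rewrite (deriveM (rsmooth_derivable i x sf) (rsmooth_derivable i x sg)).
by rewrite /GRing.scale /= addrC mulrC.
Qed.

(** The second difference over a square of side [t] is symmetric in the two directions. Two mean
    value steps, taken in either order, turn it into [t * t] times a mixed derivative near [x], and
    both mixed derivatives are continuous. *)
Lemma deriveC g i j : rsmooth g ->
  'D_(basisv i) ('D_(basisv j) g) = 'D_(basisv j) ('D_(basisv i) g).
Proof.
move=> sg; apply/funext => x; apply/eqP; rewrite -subr_eq0 -normr_le0.
apply/ler_addgt0Pr => e e0; rewrite add0r.
have cont k l : continuous ('D_(basisv k) ('D_(basisv l) g)).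
  exact/rsmooth_continuous/rsmooth_derive/rsmooth_derive.
have e2 : 0 < e / 2 by rewrite divr_gt0.
have near_lt k l : \forall y \near x,
    `|'D_(basisv k) ('D_(basisv l) g) x - 'D_(basisv k) ('D_(basisv l) g) y| < e / 2.
  by have /cvgrPdist_lt/(_ _ e2) := cont k l x.
have [r /= r0 rP] := (nbhs_ballP _ _).1 (filterI (near_lt i j) (near_lt j i)).
have mixed k l t : 0 < t -> exists c c', [/\ `|c| <= t, `|c'| <= t &
   g (x + t *: basisv k + t *: basisv l) - g (x + t *: basisv l)
   - (g (x + t *: basisv k) - g x)
   = t * (t * 'D_(basisv l) ('D_(basisv k) g)
        (x + c *: basisv k + c' *: basisv l))].
  move=> t0.
  pose q y := g (y + t *: basisv l) - g y.
  have dq y m : is_derive y (basisv m) q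
      ('D_(basisv m) g (y + t *: basisv l) - 'D_(basisv m) g y).
    apply: is_deriveB; last exact/DeriveDef/erefl/rsmooth_derivable.
    rewrite -{1}[y]addr0 -(scale0r (basisv m)); apply/is_derive_line.
    have -> : (fun u : R => g (y + u *: basisv m + t *: basisv l)) =
      (fun u : R => g (y + t *: basisv l + u *: basisv m)).
      by apply/funext => u; rewrite addrAC.
    apply/is_derive_line; rewrite scale0r addr0.
    exact/DeriveDef/erefl/rsmooth_derivable.
  have dqk y : derivable q y (basisv k) by case: (dq y k).
  have [c ct E1] := MVT_line x t dqk.
  have dgl y : derivable ('D_(basisv k) g) y (basisv l).
    exact/rsmooth_derivable/rsmooth_derive.
  have [c' ct' E2] := MVT_line (x + c *: basisv k) t dgl.
  rewrite (gtr0_norm t0) in ct ct'.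
  exists c, c'; split=> //; rewrite -E2 [RHS](_ : _ = t * 'D_(basisv k) q (x + c *: basisv k)).
    by rewrite -E1 /q; ring.
  by congr (_ * _); case: (dq (x + c *: basisv k) k) => _ ->.
(* Basis vectors have norm at most 1, so the intermediate points lie within [t + t < r] of [x]. *)
pose t : R := r / 4.
have t0 : 0 < t by rewrite divr_gt0.
have t2r : t + t < r by clear -r0; rewrite /t; lra.
have [c [c' [ct ct' E]]] := mixed i j t t0.
have [b [b' [bt bt' E']]] := mixed j i t t0.
have near_x (u w : R) k l : `|u| <= t -> `|w| <= t ->
    ball x r (x + u *: basisv k + w *: basisv l).
  move=> ut wt; rewrite -ball_normE /ball_ /= -addrA opprD addrA subrr sub0r.
  rewrite normrN; apply: le_lt_trans (ler_normD _ _) _; rewrite !normrZ.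
  have b1 m : `|basisv m : 'rV[R]_d| <= 1.
    rewrite /Num.norm /= mx_normrE; apply/bigmax_leP; split=> // -[p q] _.
    by rewrite mxE /=; case: (_ && _); rewrite ?normr0 ?normr1.
  have bm (p : R) m : `|p| <= t -> `|p| * `|basisv m : 'rV[R]_d| <= t.
    by move=> pt; rewrite -[leRHS]mulr1; exact: (ler_pM (normr_ge0 _) (normr_ge0 _) pt (b1 m)).
  exact: (le_lt_trans (lerD (bm _ _ ut) (bm _ _ wt)) t2r).
have aux (p q u1 u2 a1 a2 : R) : p = t * (t * u1) -> q = t * (t * u2) -> p = q ->
    `|a1 - u1| < e / 2 -> `|a2 - u2| < e / 2 -> `|a2 - a1| <= e.
  move=> -> -> E12 A1 A2.
  have u12 : u1 = u2 by apply: (mulfI (lt0r_neq0 t0)); exact: (mulfI (lt0r_neq0 t0)).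
  rewrite u12 distrC in A1; apply: le_trans (ler_distD u2 _ _) _.
  by apply: ltW; rewrite [ltRHS]splitr ltrD.
apply: (aux _ _ _ _ _ _ E E').
- by rewrite (addrAC x); ring.
- exact: (rP _ (near_x _ _ i j ct ct')).2.
- exact: (rP _ (near_x _ _ j i bt bt')).1.
Qed.

Lemma rpartials_perm s s' g : rsmooth g -> perm_eq s s' ->
  rpartials s g = rpartials s' g.
Proof.
move=> sg; move: s'; elim: s => [|i s IH] s' ps.
  by move: ps; rewrite perm_sym => /perm_nilP ->.
have is' : i \in s' by rewrite -(perm_mem ps) mem_head.
case/splitPr: is' ps => s1 s2; rewrite perm_sym -cat1s perm_catCA.
rewrite /= perm_sym perm_cons => ps.
transitivity ('D_(basisv i) (rpartials (s1 ++ s2) g)); first by rewrite -(IH _ ps).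
elim: s1 {ps} => // j s1 IH1.
transitivity ('D_(basisv j) ('D_(basisv i) (rpartials (s1 ++ s2) g))).
  exact: (deriveC i j (rsmooth_partials (s1 ++ s2) sg)).
by rewrite IH1.
Qed.

End Calculus.
Arguments rsmooth_derivable {R d} [g] i x _.

(** Serves where the rules of differentiation do not reach: at the flat point of [flat_exp] and for
    sums of series. *)
Lemma is_derive_quadratic (R : realType) (V : normedModType R) (f : V -> R)
    (x v : V) (df C r : R) : 0 < r ->
  (forall t, `|t| < r -> `|f (x + t *: v) - f x - t * df| <= C * t ^+ 2) ->
  is_derive x v f df.
Proof.
move=> r0 fC.
have cv : (h^-1 *: ((f \o shift x) (h *: v) - f x) @[h --> 0^'] --> df).
  apply/cvgrPdist_lt => e e0; near=> h.
  have h0 : h != 0 by near: h; exact: nbhs_dnbhs_neq.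
  have hr : `|h| < r by near: h; exact: dnbhs0_lt.
  have he : `|h| < e / (`|C| + 1).
    by near: h; apply: dnbhs0_lt; rewrite divr_gt0 // ltr_wpDl.
  have nh : 0 < `|h| by rewrite normr_gt0.
  rewrite -(ltr_pM2l nh) distrC -normrM mulrBr.
  rewrite (_ : h * (h^-1 *: _) = f (x + h *: v) - f x); last first.
    by rewrite /= (addrC _ x) mulrA mulfV // mul1r.
  apply: le_lt_trans (fC _ hr) _.
  rewrite -[h ^+ 2]ger0_norm ?sqr_ge0// normrX expr2 mulrCA ltr_pM2l //.
  rewrite ltr_pdivlMr ?ltr_wpDl // in he; apply: le_lt_trans he.
  by rewrite mulrC ler_wpM2l //; apply: le_trans (ler_norm C) _; rewrite lerDl.
by apply: DeriveDef; [exact: cvgP cv|exact: cvg_lim cv].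
Unshelve. all: by end_near. Qed.

(** * Bump functions of Gevrey class *)

Section GevreyBump.
Context {R : realType} (s : nat).
Hypothesis s_gt0 : (0 < s)%N.
Implicit Types (n k : nat) (x : R).

(** The powers of [x^-1] make the family closed under differentiation up to linear combinations. The
    exponent [s] sets the Gevrey order to [1 + 1/s]. *)
Definition flat_exp n x := if 0 < x then x^-1 ^+ n * expR (- x^-1 ^+ s) else 0.

Lemma flat_exp_ge0 n x : 0 <= flat_exp n x.
Proof.
rewrite /flat_exp; case: ltP => // x0.
by rewrite mulr_ge0 ?expR_ge0 ?exprn_ge0 // invr_ge0 ltW.
Qed.

(** With [z = x^-1] and [q = n %/ s + 1], the power [z ^+ n] is at most [1 + z ^+ (s * q)], and a
    single term of the exponential series bounds [(z ^+ s) ^+ q] by [q!] times [expR (z ^+ s)]. *)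
Lemma flat_exp_le n x : flat_exp n x <= 2 * ((n %/ s).+1)`!%:R.
Proof.
rewrite /flat_exp; case: ltP => [x0|_]; last by rewrite mulr_ge0.
set z := x^-1; set q := (n %/ s).+1.
have z0 : 0 <= z by rewrite invr_ge0 ltW.
have zn : z ^+ n <= 1 + (z ^+ s) ^+ q.
  rewrite -exprM; have [z1|z1] := leP z 1.
    by apply: le_trans (exprn_ile1 _ z0 z1) _; rewrite lerDl exprn_ge0.
  apply: le_trans (_ : z ^+ (s * q) <= _); last by rewrite lerDr.
  by rewrite ler_weXn2l ?ltW // mulnC ltnW // ltn_ceil.
have t0 : 0 <= z ^+ s by rewrite exprn_ge0.
apply: le_trans (ler_wpM2r (expR_ge0 _) zn) _.
rewrite mulrDl mul1r mulr_natl mulr2n; apply: lerD.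
  apply: le_trans (_ : 1 <= _); first by rewrite -expR0 ler_expR oppr_le0.
  by rewrite ler1n fact_gt0.
rewrite expRN ler_pdivrMr ?expR_gt0 //.
have := expR_ge1Dxn (n %/ s) t0; rewrite -/q => h.
rewrite mulrC -ler_pdivrMr ?ltr0n ?fact_gt0 //.
by apply: le_trans h; rewrite lerDr.
Qed.

Lemma is_derive_expn n x : is_derive x (1 : R) (fun x => x ^+ n) (n%:R * x ^+ n.-1).
Proof.
have := @is_deriveX R R id n x 1 1 (is_derive_id _ _).
rewrite (_ : _ *: 1 = n%:R * x ^+ n.-1); last exact: mulr1.
by congr (is_derive _ _ _ _); apply/funext => y; elim: n => //= n IH; rewrite !exprS -IH.
Qed.

Lemma is_derive_flat_exp n x : is_derive x (1 : R) (flat_exp n)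
  (s%:R * flat_exp (n + s.+1) x - n%:R * flat_exp n.+1 x).
Proof.
have [x0|x0|x0] := ltgtP x 0.
- have -> : s%:R * flat_exp (n + s.+1) x - n%:R * flat_exp n.+1 x = 0.
    by rewrite /flat_exp ltNge (ltW x0) /= !mulr0 subr0.
  apply: (@near_eq_is_derive _ _ _ (cst 0)).
  near=> y; rewrite /flat_exp ltNge (_ : y <= 0) //.
  by apply: ltW; near: y; exact: lt_nbhsl.
- pose H (z : R) := z ^+ n * expR (- z ^+ s).
  have dH z : is_derive z (1 : R) H
      (z ^+ n * (expR (- z ^+ s) * - (s%:R * z ^+ s.-1)) +
       expR (- z ^+ s) * (n%:R * z ^+ n.-1)).
    have d1 : is_derive z (1 : R) (fun z : R => - z ^+ s) (- (s%:R * z ^+ s.-1)).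
      exact: is_deriveN (is_derive_expn s z).
    have d2 : is_derive z (1 : R) (expR \o (fun z : R => - z ^+ s))
        (expR (- z ^+ s) * - (s%:R * z ^+ s.-1)).
      exact: is_derive1_comp.
    exact: is_deriveM (is_derive_expn n z) d2.
  have di : is_derive x (1 : R) (fun y : R => y^-1) (- x ^- 2).
    have := @is_deriveV R id x 1 1 (lt0r_neq0 x0) (is_derive_id _ _).
    by rewrite (_ : _ *: 1 = - x ^- 2); last exact: mulr1.
  apply: (@near_eq_is_derive _ _ _ (H \o (fun y : R => y^-1))).
    near=> y; rewrite /flat_exp (_ : 0 < y) //.
    by near: y; exact: lt_nbhsr.
  have := @is_derive1_comp R H (fun y => y^-1) x _ _ (dH _) di.
  congr (is_derive _ _ _ _); rewrite /flat_exp x0 -exprVn.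
  clear dH H di; set z := x^-1; set E := expR _.
  case: s s_gt0 => // s' _; rewrite /= addnS !exprS !exprD !exprS.
  case: n => [|n']; first by rewrite !mul0r; ring.
  by rewrite /= !exprS; ring.
- rewrite x0; have -> : s%:R * flat_exp (n + s.+1) 0 - n%:R * flat_exp n.+1 0 = 0.
    by rewrite /flat_exp ltxx !mulr0 subr0.
  (* At the origin, the bound on [flat_exp n.+2] says that [flat_exp n t] is at most a constant
     times [t ^+ 2], so the derivative there is 0. *)
  apply: (@is_derive_quadratic _ _ _ _ _ _ (2 * ((n.+2 %/ s).+1)`!%:R) 1) => // t _.
  rewrite add0r (_ : t *: 1 = t); last exact: mulr1.
  rewrite {2}/flat_exp ltxx subr0 mulr0 subr0 ger0_norm ?flat_exp_ge0//.
  apply: le_trans (_ : flat_exp n.+2 t * t ^+ 2 <= _); last first.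
    by rewrite ler_wpM2r ?sqr_ge0 ?flat_exp_le.
  rewrite /flat_exp; case: ltP => [t0|_]; last by rewrite mul0r.
  have -> : t^-1 ^+ n = t^-1 ^+ n.+2 * t ^+ 2.
    by rewrite !exprS expr0; field; rewrite gt_eqF.
  by rewrite mulrAC.
Unshelve. all: by end_near. Qed.

Fixpoint flat_der k n x :=
  if k is k'.+1 then s%:R * flat_der k' (n + s.+1) x - n%:R * flat_der k' n.+1 x
  else flat_exp n x.

Lemma is_derive_flat_der k n x :
  is_derive x (1 : R) (flat_der k n) (flat_der k.+1 n x).
Proof.
elim: k n => [|k IH] n; first exact: is_derive_flat_exp.
exact: (is_deriveB (is_deriveZ s%:R (IH (n + s.+1)%N)) (is_deriveZ n%:R (IH n.+1))).
Qed.

Lemma flat_der_eq0 k n x : x <= 0 -> flat_der k n x = 0.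
Proof.
move=> x0; elim: k n => [|k IH] n /=; last by rewrite !IH !mulr0 subr0.
by rewrite /flat_exp ltNge x0.
Qed.

Lemma flat_der_le k n x : `|flat_der k n x| <=
  2 * (2 * s%:R) ^+ k * (((n + k * s.+1) %/ s).+1)`!%:R.
Proof.
elim: k n => [|k IH] n /=.
  by rewrite mulr1 mul0n addn0 ger0_norm ?flat_exp_ge0 // flat_exp_le.
apply: le_trans (ler_normB _ _) _; rewrite !normrM !normr_nat.
set j := (n + 1 + k * s.+1)%N.
have -> : (n + k.+1 * s.+1 = j + s)%N by rewrite /j; lia.
(* A derivative either multiplies by [s] and shifts the index by [s.+1], or multiplies by [n] and
   shifts it by 1. The factor [n <= j] is absorbed by the larger factorial of the first term, so
   that both obey the same bound. *)
have W : n%:R * ((j %/ s).+1)`!%:R <= s%:R * (((j + s) %/ s).+1)`!%:R :> R.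
  rewrite -!natrM ler_nat divnDr ?dvdnn // divnn s_gt0 addn1 (factS (j %/ s).+1).
  rewrite mulnA leq_mul //; have := divn_eq j s; have := ltn_pmod j s_gt0.
  rewrite /j; nia.
have := IH (n + s.+1)%N; have := IH n.+1.
have -> : (n.+1 + k * s.+1 = j)%N by rewrite /j; lia.
have -> : (n + s.+1 + k * s.+1 = j + s)%N by rewrite /j; lia.
set c := 2 * (2 * s%:R) ^+ k => h1 h2.
have c0 : 0 <= c by rewrite mulr_ge0 ?exprn_ge0 // mulr_ge0.
apply: le_trans (lerD (ler_wpM2l (ler0n _ s) h2) (ler_wpM2l (ler0n _ n) h1)) _.
rewrite (_ : 2 * (2 * s%:R) ^+ k.+1 = 2 * s%:R * c); last by rewrite /c exprS; ring.
move: (ler_wpM2l c0 W); clearbody c; clear; lra.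
Qed.

(** The Leibniz rule for a product of two flat functions, one vanishing to the left of [- e] and one
    to the right of [e]: [a] and [b] count the derivatives that fell on each. Keeping the recursion
    with its [2 ^ k] leaves avoids binomial sums. *)
Fixpoint bump_der (e : R) k a b x :=
  if k is k'.+1 then bump_der e k' a.+1 b x - bump_der e k' a b.+1 x
  else flat_der a 0 (e + x) * flat_der b 0 (e - x).

Lemma is_derive_bump_der e k a b x :
  is_derive x (1 : R) (bump_der e k a b) (bump_der e k.+1 a b x).
Proof.
elim: k a b => [|k IH] a b; last exact: (is_deriveB (IH a.+1 b) (IH a b.+1)).
have d1 : is_derive x (1 : R) (flat_der a 0 \o (fun x => e + x))
    (flat_der a.+1 0 (e + x) * 1).
  apply: is_derive1_comp; first exact: is_derive_flat_der.
  by rewrite -[X in is_derive _ _ _ X]add0r; exact: is_deriveD.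
have d2 : is_derive x (1 : R) (flat_der b 0 \o (fun x => e - x))
    (flat_der b.+1 0 (e - x) * -1).
  apply: is_derive1_comp; first exact: is_derive_flat_der.
  by rewrite -[X in is_derive _ _ _ X]add0r; exact: is_deriveB.
have := is_deriveM d1 d2; congr (is_derive _ _ _ _).
by rewrite /GRing.scale /=; ring.
Qed.

Lemma bump_der_le e k a b x : `|bump_der e k a b x| <=
  2 ^+ k * (4 * (2 * s%:R) ^+ (a + b + k) *
    ((a + b + k + (a + b + k) %/ s).+2)`!%:R).
Proof.
elim: k a b => [|k IH] a b /=; last first.
  apply: le_trans (ler_normB _ _) _.
  apply: le_trans (lerD (IH _ _) (IH _ _)) _.
  have -> : (a.+1 + b + k = a + b + k.+1)%N by lia.
  have -> : (a + b.+1 + k = a + b + k.+1)%N by lia.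
  move: (4 * _ * _) => X; rewrite [2 ^+ k.+1]exprS; lra.
rewrite mul1r addn0 normrM.
apply: le_trans (ler_pM (normr_ge0 _) (normr_ge0 _) (flat_der_le a 0 _) (flat_der_le b 0 _)) _.
rewrite !add0n exprD.
rewrite [leLHS](_ : _ = 4 * ((2 * s%:R) ^+ a * (2 * s%:R) ^+ b) *
  ((((a * s.+1) %/ s).+1)`! * (((b * s.+1) %/ s).+1)`!)%:R); last first.
  by rewrite natrM; ring.
apply: ler_wpM2l; first by rewrite mulr_ge0 ?mulr_ge0 ?exprn_ge0 ?mulr_ge0.
rewrite ler_nat.
have q c : ((c * s.+1) %/ s = c + c %/ s)%N.
  by rewrite mulnS divnDMl // addnC.
rewrite !q.
have fM i j : (i`! * j`! <= (i + j)`!)%N.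
  have := bin_fact (leq_addr j i); rewrite addKn => <-.
  by rewrite leq_pmull // bin_gt0 leq_addr.
apply: leq_trans (fM _ _) _; apply: leq_fact.
have : (a %/ s + b %/ s <= (a + b) %/ s)%N.
  by rewrite leq_divRL // mulnDl leq_add // leq_trunc_div.
lia.
Qed.

Lemma gevrey_bump (e : R) : 0 < e -> exists F : nat -> R -> R,
  [/\ derivatives F, F 0 0 != 0, forall k x, e <= `|x| -> F k x = 0 &
    forall k x, `|F k x| <= 4 * (4 * s%:R) ^+ k * ((k + k %/ s).+2)`!%:R].
Proof.
move=> e0; exists (fun k => bump_der e k 0 0); split.
- by move=> k x; exact: is_derive_bump_der.
- by rewrite /= addr0 subr0 /flat_exp e0 mulf_neq0 // mulf_neq0 ?gt_eqF ?expR_gt0.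
- move=> k x ex; move: 0%N {2}0%N => a b.
  elim: k a b => [|k IH] a b /=; last by rewrite !IH subr0.
  move: ex; rewrite ler_normr => /orP[ex|ex].
    by rewrite (flat_der_eq0 b) ?mulr0 // subr_le0.
  by rewrite (flat_der_eq0 a) ?mul0r //; rewrite -[x]opprK subr_le0.
- move=> k x; apply: le_trans (bump_der_le _ _ _ _ _) _.
  rewrite !add0n (_ : 4 * s%:R = 2 * (2 * s%:R)); last by ring.
  by rewrite [leRHS](_ : _ = 2 ^+ k * (4 * (2 * s%:R) ^+ k * ((k + k %/ s).+2)`!%:R)) //
    exprMn; ring.
Qed.

End GevreyBump.

(** * The formal solution *)

(** When [N] grows by [q], the left factorial gains [q - 1] factors of size at most [2 * N.+1] and
    the right one [q] factors of size at least [N.+1]. For large [N] the additional factor outweighs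
    [B ^+ q]. *)
Lemma fact_growth (R : realType) (B : R) (q c : nat) : 0 <= B -> (0 < q)%N ->
  exists2 C : R, 0 <= C &
    forall N, B ^+ N * (N - N %/ q + c)`!%:R <= C * N`!%:R.
Proof.
move=> B0 q0.
have expl i j k : (i <= j -> i ^ k <= j ^ k)%N.
  by case: k => // k ij; rewrite leq_exp2r.
have fact_le K j : ((K + j)`! <= K`! * (K + j) ^ j)%N.
  elim: j => [|j IH]; first by rewrite addn0 muln1.
  rewrite addnS factS expnS mulnCA leq_mul //; apply: leq_trans IH _.
  by rewrite leq_mul // expl.
have fact_ge K j : (K`! * K.+1 ^ j <= (K + j)`!)%N.
  elim: j => [|j IH]; first by rewrite addn0 muln1.
  rewrite addnS factS expnS mulnCA leq_mul //; lia.
pose t N : R := B ^+ N * (N - N %/ q + c)`!%:R / N`!%:R.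
have t0 N : 0 <= t N by rewrite divr_ge0 // mulr_ge0 ?exprn_ge0.
(* [c + q <= N] gives the bound [2 * N.+1] for the new factors on the left; the second entry gives
   [B ^+ q * 2 ^+ q <= N.+1]. *)
pose N0 := maxn (c + q) (Num.truncn (B ^+ q * 2 ^+ q)).
have step N : (N0 <= N)%N -> t (N + q)%N <= t N.
  rewrite geq_max => /andP[cN BN].
  have {}BN : B ^+ q * 2 ^+ q <= N.+1%:R.
    apply: ltW; apply: lt_le_trans (truncnS_gt _) _.
    by rewrite ler_nat.
  rewrite ler_pdivrMr ?ltr0n ?fact_gt0 // mulrAC ler_pdivlMr ?ltr0n ?fact_gt0 //.
  set K := (N - N %/ q + c)%N.
  have -> : (N + q - (N + q) %/ q + c = K + q.-1)%N.
    by rewrite divnDr ?dvdnn // divnn q0 /K; have := leq_div N q; lia.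
  have h1 : ((K + q.-1)`!%:R <= K`!%:R * (2 * N.+1%:R) ^+ q.-1 :> R).
    rewrite -natrM -natrX -natrM ler_nat; apply: leq_trans (fact_le _ _) _.
    rewrite leq_mul // expl // /K.
    by have := leq_subr (N %/ q) N; move: (N - N %/ q)%N => X; lia.
  have h2 : (N`!%:R * N.+1%:R ^+ q <= (N + q)`!%:R :> R).
    by rewrite -natrX -natrM ler_nat.
  have h3 : B ^+ q * (2 * N.+1%:R) ^+ q.-1 <= N.+1%:R ^+ q.
    rewrite exprMn mulrA -[in leRHS](prednK q0) exprSr [leRHS]mulrC.
    rewrite ler_wpM2r ?exprn_ge0 //; apply: le_trans BN.
    by rewrite ler_wpM2l ?exprn_ge0 // ler_weXn2l ?ler1n // leq_pred.
  rewrite exprD.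
  have n0 n : 0 <= n%:R :> R by [].
  have b0 : 0 <= B ^+ N by rewrite exprn_ge0.
  have bq : 0 <= B ^+ q by rewrite exprn_ge0.
  apply: le_trans (_ : B ^+ N * B ^+ q * (K`!%:R * (2 * N.+1%:R) ^+ q.-1) * N`!%:R <= _).
    by apply: ler_wpM2r => //; apply: ler_wpM2l => //; apply: mulr_ge0.
  apply: le_trans (_ : B ^+ N * K`!%:R * (N`!%:R * N.+1%:R ^+ q) <= _); last first.
    by apply: ler_wpM2l => //; apply: mulr_ge0.
  rewrite [leLHS](_ : _ = B ^+ N * K`!%:R * (N`!%:R * (B ^+ q * (2 * N.+1%:R) ^+ q.-1))); last by ring.
  by apply: ler_wpM2l; [apply: mulr_ge0|apply: ler_wpM2l].
(* From [N0] on, [t] does not increase along steps of [q], so each value is bounded by one of the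
   first [N0 + q] values. *)
exists (\sum_(N < N0 + q) t N); first exact: sumr_ge0.
move=> N; rewrite -ler_pdivrMr ?ltr0n ?fact_gt0 // -/(t N).
have [n] := ubnP N; elim: n N => // n IH N /ltnSE Nn.
have [NN|NN] := ltnP N (N0 + q).
  by rewrite (bigD1 (Ordinal NN)) //= lerDl sumr_ge0.
have -> : N = (N - q + q)%N by lia.
by apply: le_trans (step _ _) (IH _ _); lia.
Qed.

Section FormalSolution.
Context {R : realType}.
Implicit Types (z : R[i]) (G : nat -> R -> R[i]).

Definition nrm1 z : R := `|complex.Re z| + `|complex.Im z|.

Lemma nrm1_ge0 z : 0 <= nrm1 z. Proof. by rewrite addr_ge0. Qed.

Lemma nrm1_0 : nrm1 0 = 0. Proof. by rewrite /nrm1 /= normr0 addr0. Qed.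

Lemma ler_nrm1D z z' : nrm1 (z + z') <= nrm1 z + nrm1 z'.
Proof.
case: z z' => x y [x' y'] /=; rewrite /nrm1 /= addrACA.
by apply: lerD; exact: ler_normD.
Qed.

Lemma ler_nrm1M z z' : nrm1 (z * z') <= nrm1 z * nrm1 z'.
Proof.
case: z z' => x y [x' y'] /=; rewrite /nrm1 /=.
apply: le_trans (lerD (ler_normB _ _) (ler_normD _ _)) _.
by rewrite !normrM; lra.
Qed.

Lemma ler_nrm1_sum n (F : 'I_n -> R[i]) :
  nrm1 (\sum_(i < n) F i) <= \sum_(i < n) nrm1 (F i).
Proof.
elim/big_ind2: _ => [|x z y t xz yt|//]; first by rewrite nrm1_0.
by apply: le_trans (ler_nrm1D _ _) _; exact: lerD.
Qed.

Definition cderivatives G := derivatives (fun k x => complex.Re (G k x)) /\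
  derivatives (fun k x => complex.Im (G k x)).

Lemma cderivatives0 : cderivatives (fun _ _ => 0).
Proof. by split=> k x /=; exact: is_derive_cst. Qed.

Lemma cderivatives_lin (c : R[i]) G G' : cderivatives G -> cderivatives G' ->
  cderivatives (fun k x => c * G k x + G' k x).
Proof.
case: c => a b [rG iG] [rG' iG'].
have key (p q : R) (u v w : nat -> R -> R) : derivatives u -> derivatives v ->
   derivatives w -> derivatives (fun k x => p * u k x + (q * v k x + w k x)).
  move=> du dv dw k x.
  exact: (is_deriveD (is_deriveZ p (du k x)) (is_deriveD (is_deriveZ q (dv k x)) (dw k x))).
split.
  rewrite (_ : (fun _ => _) = fun k x => a * complex.Re (G k x) +
    (- b * complex.Im (G k x) + complex.Re (G' k x))); first exact: key.
  by apply/funext => k; apply/funext => x; case: (G k x) (G' k x) => ? ? [? ?] /=; ring.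
rewrite (_ : (fun _ => _) = fun k x => a * complex.Im (G k x) +
  (b * complex.Re (G k x) + complex.Im (G' k x))); first exact: key.
by apply/funext => k; apply/funext => x; case: (G k x) (G' k x) => ? ? [? ?] /=; ring.
Qed.

Lemma cderivatives_sum n (c : nat -> R[i]) (G : nat -> nat -> R -> R[i]) :
  (forall j, (j < n)%N -> cderivatives (G j)) ->
  cderivatives (fun k x => \sum_(j < n) c j * G j k x).
Proof.
elim: n => [|n IH] dG.
  rewrite (_ : (fun _ => _) = fun _ _ => 0); first exact: cderivatives0.
  by apply/funext => k; apply/funext => x; rewrite big_ord0.
rewrite (_ : (fun _ => _) =
    fun k x => c n * G n k x + \sum_(j < n) c j * G j k x).
  by apply: cderivatives_lin; [exact: dG|apply: IH => j jn; apply: dG; lia].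
by apply/funext => k; apply/funext => x; rewrite big_ord_recr addrC.
Qed.

Context (m : nat) (c : nat -> nat -> R[i]) (F : nat -> R -> R).
Hypothesis m_gt0 : (0 < m)%N.

(** The range [a < m - b] expresses that only terms with [a + b < m] enter the recursion, so that a
    step costs fewer derivatives than it gains in index. *)
Definition next (v : nat -> nat -> R -> R[i]) k x :=
  \sum_(b < m) \sum_(a < m - b) c a b * v b (k + a)%N x.

(* The state after [N] steps holds the coefficients of index [N .. N + m - 1]. *)
Fixpoint coef_state N : nat -> nat -> R -> R[i] :=
  if N is N'.+1 then fun i => if (i.+1 < m)%N then coef_state N' i.+1
                              else next (coef_state N')
  else fun i k x => if i == 0%N then (F k x)%:C else 0.

Definition coef_sol N := coef_state N 0.

Lemma coef_state_shift N i j : (i + j < m)%N ->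
  coef_state (N + j) i = coef_state N (i + j).
Proof.
elim: j i => [|j IH] i ij; first by rewrite !addn0.
rewrite addnS /= ifT; last by lia.
by rewrite IH addSnnS.
Qed.

Lemma coef_sol_rec N k x : coef_sol (N + m) k x =
  \sum_(b < m) \sum_(a < m - b) c a b * coef_sol (N + b) (k + a)%N x.
Proof.
rewrite /coef_sol -(prednK m_gt0) -addSnnS coef_state_shift; last by lia.
rewrite add0n prednK //= prednK // ltnn /next; apply: eq_bigr => b _.
apply: eq_bigr => a _; rewrite coef_state_shift ?add0n //.
Qed.

Lemma coef_sol_derivatives N : derivatives F -> cderivatives (coef_sol N).
Proof.
move=> dF; rewrite /coef_sol; elim: N 0%N => [|N IH] i.
  rewrite /=; case: eqP => _; last exact: cderivatives0.
  by split=> [//|k x] /=; exact: is_derive_cst.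
rewrite /=; case: ifP => _; first exact: IH.
have shift a G : cderivatives G -> cderivatives (fun k => G (k + a)%N).
  by move=> [rG iG]; split=> k x; [exact: rG|exact: iG].
rewrite (_ : next _ = fun k x => \sum_(b < m) 1 *
    \sum_(a < m - b) c a b * coef_state N b (k + a)%N x); last first.
  by apply/funext => k; apply/funext => x; apply: eq_bigr => b _; rewrite mul1r.
apply: (@cderivatives_sum m (fun=> 1)
  (fun b k x => \sum_(a < m - b) c a b * coef_state N b (k + a)%N x)) => b _.
apply: (@cderivatives_sum (m - b) (c^~ b) (fun a k => coef_state N b (k + a)%N)).
by move=> a _; exact: shift.
Qed.

Lemma coef_sol_eq0 N k x : (forall k, F k x = 0) -> coef_sol N k x = 0.
Proof.
move=> F0; rewrite /coef_sol; elim: N 0%N k => [|N IH] i k /=.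
  by rewrite F0 if_same.
case: ifP => _; first exact: IH.
by rewrite /next big1 // => b _; rewrite big1 // => a _; rewrite IH mulr0.
Qed.

(** Induction on the number of derivatives: at most [m - b - 1] are added in passing from index
    [N + b] to [N + m], and [N - N %/ m] grows by at least as much. [A] exceeds the sum of all
    coefficients of a step, so one factor [A] per step is enough. *)
Lemma coef_sol_le (M : nat -> R) : {homo M : k l / (k <= l)%N >-> k <= l} ->
  (forall k x, `|F k x| <= M k) ->
  exists2 A : R, 1 <= A & forall N k x,
    nrm1 (coef_sol N k x) <= A ^+ N * M (k + (N - N %/ m))%N.
Proof.
move=> homM FM; pose A := 1 + \sum_(b < m) \sum_(a < m - b) nrm1 (c a b).
have S0 : 0 <= \sum_(b < m) \sum_(a < m - b) nrm1 (c a b).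
  by apply: sumr_ge0 => b _; apply: sumr_ge0 => a _; exact: nrm1_ge0.
have A1 : 1 <= A by rewrite lerDl.
have M0 k : 0 <= M k by apply: le_trans (FM k 0); exact: normr_ge0.
exists A => // N; have [n] := ubnP N; elim: n N => // n IH N /ltnSE Nn k x.
have [Nm|mN] := ltnP N m.
  rewrite /coef_sol -[N]add0n coef_state_shift //= add0n.
  apply: le_trans (_ : M (k + (N - N %/ m))%N <= _); last first.
    by rewrite ler_peMl // exprn_ege1.
  case: eqP => _; last by rewrite nrm1_0.
  rewrite /nrm1 /= normr0 addr0; apply: le_trans (FM _ _) _.
  by apply: homM; exact: leq_addr.
have [N' EN] : exists N', N = (N' + m)%N by exists (N - m)%N; rewrite subnK.
rewrite EN coef_sol_rec; apply: le_trans (ler_nrm1_sum _) _.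
apply: le_trans (_ : \sum_(b < m) \sum_(a < m - b) nrm1 (c a b) *
   (A ^+ (N' + m).-1 * M (k + (N' + m - (N' + m) %/ m))%N) <= _).
  apply: ler_sum => b _; apply: le_trans (ler_nrm1_sum _) _.
  apply: ler_sum => a _; apply: le_trans (ler_nrm1M _ _) _.
  rewrite ler_wpM2l ?nrm1_ge0 //.
  apply: le_trans (IH (N' + b)%N _ _ _) _; first by have := ltn_ord b; lia.
  apply: ler_pM => //; first by rewrite exprn_ge0 // (le_trans ler01).
    by rewrite ler_weXn2l //; have := ltn_ord b; lia.
  apply: homM; rewrite (divnDr N' (dvdnn m)) divnn m_gt0.
  have := leq_div2r m (leq_addr b N'); have := leq_div (N' + b) m.
  by have := ltn_ord a; have := ltn_ord b; lia.
under eq_bigr => b _ do rewrite -mulr_suml.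
rewrite -mulr_suml mulrA ler_wpM2r //.
have -> : A ^+ (N' + m) = A * A ^+ (N' + m).-1 by rewrite -exprS prednK //; lia.
by rewrite ler_wpM2r ?lerDr // exprn_ge0 // (le_trans ler01).
Qed.

End FormalSolution.

Lemma coef_sol_exists (R : realType) (m : nat) (c : nat -> nat -> R[i]) (e : R) :
  (0 < m)%N -> 0 < e -> exists g : nat -> nat -> R -> R[i],
  [/\ forall N, cderivatives (g N),
      forall N k x, g (N + m)%N k x =
        \sum_(b < m) \sum_(a < m - b) c a b * g (N + b)%N (k + a)%N x,
      g 0 0 0 != 0,
      forall N k x, e <= `|x| -> g N k x = 0 &
      forall k (B : R), 0 <= B -> exists2 C : R, 0 <= C & forall N x,
        nrm1 (g N k x) * B ^+ N <= C * N`!%:R].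
Proof.
(* Gevrey order [1 + 1/s] spends [K %/ s] on [K] derivatives, about half of the [N %/ m] saved by
   the recursion. The other half is left as the [N - N %/ s] that [fact_growth] asks for. *)
move=> m0 e0; pose s := (2 * m)%N; have s0 : (0 < s)%N by rewrite /s; lia.
have [F [dF F0 Fe FM]] := @gevrey_bump R s s0 e e0.
pose M k : R := 4 * (4 * s%:R) ^+ k * ((k + k %/ s).+2)`!%:R.
have s1 : 1 <= 4 * s%:R :> R by rewrite -natrM ler1n; lia.
have s0R : 0 <= 4 * s%:R :> R by rewrite mulr_ge0.
have homM : {homo M : k l / (k <= l)%N >-> k <= l}.
  move=> k l kl; rewrite /M.
  have p0 j : 0 <= 4 * (4 * s%:R) ^+ j :> R by apply: mulr_ge0; rewrite ?exprn_ge0.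
  apply: (ler_pM (p0 k)) => //; first by rewrite ler_wpM2l // ler_weXn2l.
  by rewrite ler_nat leq_fact // !ltnS leq_add // leq_div2r.
have [A A1 gM] := coef_sol_le c m0 homM FM.
have A0 : 0 <= A by rewrite (le_trans ler01).
exists (coef_sol m c F); split.
- by move=> N; exact: coef_sol_derivatives.
- by move=> N k x; exact: coef_sol_rec.
- by apply: contra F0; rewrite /coef_sol /= eq_complex => /andP[].
- by move=> N k x ex; apply: coef_sol_eq0 => k'; exact: Fe.
- move=> k B B0; pose D := A * (4 * s%:R) * B.
  have D0 : 0 <= D by rewrite !mulr_ge0.
  have [C C0 CP] := @fact_growth R D s (2 * k + 3) D0 s0.
  exists (4 * (4 * s%:R) ^+ k * C); first by rewrite !mulr_ge0 ?exprn_ge0.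
  move=> N x; set K := (k + (N - N %/ m))%N.
  have BN : 0 <= B ^+ N by rewrite exprn_ge0.
  apply: le_trans (ler_wpM2r BN (gM N k x)) _.
  apply: le_trans (_ : 4 * (4 * s%:R) ^+ k *
      (D ^+ N * (N - N %/ s + (2 * k + 3))`!%:R) <= _); last first.
    by rewrite -[leRHS]mulrA ler_wpM2l // mulr_ge0 ?exprn_ge0.
  rewrite /M -/K.
  have hK : (K + K %/ s <= (N - N %/ s + (2 * k + 1)))%N.
    have h1 : (K %/ s <= N %/ s + k + 1)%N.
      have : (K <= k + N)%N by rewrite /K leq_add2l leq_subr.
      move=> /(leq_div2r s) h; apply: leq_trans h _; rewrite (divnD k N s0).
      rewrite -addnA [(_ + (N %/ s + _))%N]addnCA -addnA leq_add2l.
      by rewrite leq_add ?leq_div // leq_b1.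
    have h2 : (2 * (N %/ s) <= N %/ m)%N.
      rewrite leq_divRL //; apply: leq_trans (leq_trunc_div N s).
      by rewrite {2}/s mulnCA mulnA [(2 * _ * m)%N]mulnAC.
    have aux p q r l n : (p <= r + l + 1 -> 2 * r <= q -> q <= n ->
        l + (n - q) + p <= n - r + (2 * l + 1))%N by clear; lia.
    exact: (aux _ _ _ _ _ h1 h2 (leq_div N m)).
  have h4 : (4 * s%:R) ^+ K <= (4 * s%:R) ^+ k * (4 * s%:R) ^+ N :> R.
    by rewrite -exprD ler_weXn2l // /K leq_add2l leq_subr.
  have h5 : ((K + K %/ s).+2)`!%:R <= (N - N %/ s + (2 * k + 3))`!%:R :> R.
    rewrite ler_nat leq_fact //.
    have aux p q l : (p <= q + (2 * l + 1) -> p.+2 <= q + (2 * l + 3))%N by clear; lia.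
    exact: aux hK.
  rewrite /D (exprMn _ (A * (4 * s%:R))) (exprMn _ A).
  rewrite [leLHS](_ : _ = (4 * A ^+ N * B ^+ N) *
     ((4 * s%:R) ^+ K * ((K + K %/ s).+2)`!%:R)); last by ring.
  rewrite [leRHS](_ : _ = (4 * A ^+ N * B ^+ N) *
     (((4 * s%:R) ^+ k * (4 * s%:R) ^+ N) * (N - N %/ s + (2 * k + 3))`!%:R)); last first.
    by move: (4 * s%:R) => Z; ring.
  rewrite ler_wpM2l // ?mulr_ge0 ?exprn_ge0 //.
  by apply: ler_pM => //; rewrite exprn_ge0.
Qed.

(** * Null solutions *)

Section HalfSeries.
Context {R : realType}.
Implicit Types u v : nat -> R.

(** A fixed ratio is enough: the bounds on the coefficients hold for every base [B], which absorbs
    any other geometric factor beforehand. *)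
Definition half_bounded u := exists C : R, forall N, `|u N| <= C / 2 ^+ N.

Definition ssum u : R := limn (series u).

Lemma half_bound_partial u C n k : (forall N, `|u N| <= C / 2 ^+ N) ->
  `|series u (n + k)%N - series u n| <= 2 * C / 2 ^+ n - 2 * C / 2 ^+ (n + k).
Proof.
move=> uC; elim: k => [|k IH]; first by rewrite addn0 !subrr normr0.
rewrite addnS [series u _]/series /= big_nat_recr //= addrAC.
apply: le_trans (ler_normD _ _) _; apply: le_trans (lerD IH (uC _)) _.
rewrite exprS invfM; set X := (2 ^+ (n + k))^-1; move: X => X.
by rewrite le_eqVlt; apply/orP; left; apply/eqP; field.
Qed.

Lemma half_bounded_cvg u : half_bounded u -> cvgn (series u).
Proof.
move=> [C uC]; apply: normed_cvg.
have C0 : 0 <= C by have := uC 0; rewrite expr0 divr1; apply: le_trans; exact: normr_ge0.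
apply: (@series_le_cvg _ _ (geometric C 2^-1)).
- by move=> n; exact: normr_ge0.
- by move=> n; rewrite /geometric /= mulr_ge0 // exprn_ge0 // invr_ge0.
- by move=> n; rewrite /geometric /= exprVn.
- by apply: is_cvg_geometric_series; rewrite gtr0_norm ?invr_gt0 // invf_lt1 // ltr1n.
Qed.

Lemma ssum_le u C n : (forall N, `|u N| <= C / 2 ^+ N) ->
  `|ssum u - series u n| <= 2 * C / 2 ^+ n.
Proof.
move=> uC; have C0 : 0 <= C.
  by have := uC 0; rewrite expr0 divr1; apply: le_trans; exact: normr_ge0.
have cu : cvgn (series u) by apply: half_bounded_cvg; exists C.
have -> : ssum u - series u n = limn (fun k => series u (k + n)%N - series u n).
  apply/esym/cvg_lim => //; apply: cvgB; last exact: cvg_cst.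
  by rewrite cvg_shiftn.
have cv : cvgn (fun k => series u (k + n)%N - series u n).
  apply: is_cvgB; last exact: is_cvg_cst.
  by apply/cvg_ex; exists (ssum u); rewrite /= cvg_shiftn.
have cl : `|limn (fun k => series u (k + n)%N - series u n)| =
    limn (fun k => `|series u (k + n)%N - series u n|).
  by apply/esym/cvg_lim => //; exact: (cvg_norm cv).
rewrite cl; apply: limr_le; first exact: is_cvg_norm.
near=> k; rewrite addnC; apply: le_trans (half_bound_partial n k uC) _.
by rewrite lerBlDr lerDl divr_ge0 ?exprn_ge0 // mulr_ge0.
Unshelve. all: by end_near. Qed.

Lemma half_bounded_lin (a : R) u v : half_bounded u -> half_bounded v ->
  half_bounded (fun N => a * u N + v N).
Proof.
move=> [C uC] [D vD]; exists (`|a| * C + D) => N.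
rewrite mulrDl -mulrA; apply: le_trans (ler_normD _ _) _.
by rewrite normrM lerD // ler_wpM2l.
Qed.

Lemma ssum_lin (a : R) u v : half_bounded u -> half_bounded v ->
  ssum (fun N => a * u N + v N) = a * ssum u + ssum v.
Proof.
move=> hu hv; apply: cvg_lim => //.
have -> : series (fun N => a * u N + v N) = fun n => a * series u n + series v n.
  by apply/funext => n; rewrite /series /= mulr_sumr -big_split.
apply: cvgD; last exact: half_bounded_cvg.
by apply: cvgM; [exact: cvg_cst|exact: half_bounded_cvg].
Qed.

Lemma ssum_lin3 (t : R) u v w : half_bounded u -> half_bounded v -> half_bounded w ->
  ssum (fun N => u N - v N - t * w N) = ssum u - ssum v - t * ssum w.
Proof.
move=> hu hv hw.
have -> : (fun N => u N - v N - t * w N) =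
    fun N => - t * w N + (-1 * v N + u N) by apply/funext => N; ring.
by rewrite ssum_lin ?ssum_lin //; [ring|exact: half_bounded_lin].
Qed.

Lemma ssum0 : ssum (fun=> 0) = 0.
Proof.
apply: cvg_lim => //; rewrite (_ : series _ = cst 0); first exact: cvg_cst.
by apply/funext => n; rewrite /series /= big1.
Qed.

Lemma ssum_shift u b : half_bounded u -> (forall N, (N < b)%N -> u N = 0) ->
  ssum u = ssum (fun N => u (N + b)%N).
Proof.
move=> hu u0; apply/esym/cvg_lim => //.
have -> : series (fun N => u (N + b)%N) = fun n => series u (n + b)%N.
  apply/funext => n; rewrite /series /= [RHS](big_cat_nat (n := b)) ?leq_addl //=.
  rewrite [X in _ = X + _](_ : _ = 0); last first.
    by rewrite big_nat big1 // => i ib; exact: u0.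
  by rewrite add0r -{2}[b]add0n big_addn addnK.
by rewrite cvg_shiftn; exact: half_bounded_cvg hu.
Qed.

End HalfSeries.

(** * Termwise differentiation of series *)

Section SmoothSeries.
Context {R : realType} {d : nat}.
Implicit Types (x : 'rV[R]_d) (s : seq 'I_d).

(** Adding up the Taylor bounds of the terms bounds the Taylor remainder of the sum by a multiple of
    [t ^+ 2], which identifies its derivative without a theorem on uniform limits. *)
Lemma smooth_series (f : nat -> 'rV[R]_d -> R) :
  (forall N, rsmooth (f N)) ->
  (forall s r, exists C : R, forall N x, `|x| <= r ->
    `|rpartials s (f N) x| <= C / 2 ^+ N) ->
  rsmooth (fun x => ssum (f ^~ x)) /\
  forall s, rpartials s (fun x => ssum (f ^~ x)) =
    fun x => ssum (fun N => rpartials s (f N) x).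
Proof.
move=> sf fC.
have hb s x : half_bounded (fun N => rpartials s (f N) x).
  by have [C CP] := fC s `|x|; exists C => N; exact: CP.
pose S s x := ssum (fun N => rpartials s (f N) x).
have dS s i x : is_derive x (basisv i) (S s) (S (i :: s) x).
  (* The radius covers all [x + t *: basisv i] with [|t| < 1]. *)
  have [C CP] := fC [:: i, i & s] (`|x| + `|basisv i : 'rV[R]_d|).
  apply: (@is_derive_quadratic _ _ _ _ _ _ (2 * C) 1) => // t t1.
  pose u N := rpartials s (f N) (x + t *: basisv i) - rpartials s (f N) x
     - t * rpartials (i :: s) (f N) x.
  have uC N : `|u N| <= (C * t ^+ 2) / 2 ^+ N.
    rewrite mulrAC; apply: (@taylor_line _ _ (rpartials s (f N))).
    - by move=> y; have [_] := sf N s; exact.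
    - by move=> y; have [_] := sf N (i :: s); exact.
    - move=> c ct; apply: CP; apply: le_trans (ler_normD _ _) _.
      rewrite lerD2l normrZ -[leRHS]mul1r ler_wpM2r //.
      by apply: le_trans ct _; exact: ltW.
  have := ssum_le 0 uC; rewrite expr0 divr1 /series /= big_geq // subr0 mulrA.
  by rewrite /S -(ssum_lin3 t (hb s (x + t *: basisv i)) (hb s x) (hb (i :: s) x)).
have cS s : continuous (S s).
  move=> x; apply: (@cvgrPdist_lt _ R^o _ (nbhs x) _ (S s) (S s x)).2 => e e0.
  have [C CP] := fC s (`|x| + 1).
  have C0 : 0 <= C.
    have := CP 0%N x; rewrite expr0 divr1 lerDl ler01 => /(_ isT).
    exact: le_trans.
  (* Cutting the series at [n] leaves two tails of size [2 * C / 2 ^+ n], one at [x] and one at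
     [y]. *)
  have [n nP] : exists n : nat, 4 * C / 2 ^+ n < e / 2.
    pose n := (Num.truncn (4 * C / (e / 2))).+1; exists n.
    have e2 : 0 < e / 2 by rewrite divr_gt0.
    rewrite ltr_pdivrMr ?exprn_gt0 // [ltRHS]mulrC -ltr_pdivrMr //.
    apply: lt_trans (truncnS_gt _) _.
    by rewrite -natrX ltr_nat ltn_expl.
  have cfin : {for x, continuous (fun y => series (fun N => rpartials s (f N) y) n)}.
    elim: (n) => [|k IH].
      rewrite (_ : (fun y => _) = cst 0); first exact: cst_continuous.
      by apply/funext => y; rewrite /series /= big_geq.
    rewrite (_ : (fun y => _) = fun y => series (fun N => rpartials s (f N) y) k
      + rpartials s (f k) y).
      exact: (cvgD IH ((sf k s).1 x)).
    by apply/funext => y; rewrite /series /= big_nat_recr.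
  have e2 : 0 < e / 2 by rewrite divr_gt0.
  have /cvgrPdist_lt/(_ _ e2) near1 := cfin.
  near=> y.
  have y1 : `|x - y| < 1.
    by near: y; have /cvgrPdist_lt := (@cvg_id _ (nbhs x)); apply.
  have ny : `|y| <= `|x| + 1.
    have -> : `|y| = `|x - (x - y)| by rewrite subKr.
    apply: le_trans (ler_normB _ _) _; rewrite lerD2l; exact: ltW.
  have near_y : `|series (fun N => rpartials s (f N) x) n -
     series (fun N => rpartials s (f N) y) n| < e / 2 by near: y.
  have xC N : `|rpartials s (f N) x| <= C / 2 ^+ N by apply: CP; rewrite lerDl.
  have b1 := ssum_le n xC.
  have b2 := ssum_le n (fun N => CP N y ny).
  rewrite -/(S s _) in b1; rewrite -/(S s _) in b2.
  set sx := series _ n in near_y b1; set sy := series _ n in near_y b2.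
  rewrite (_ : S s x - S s y = (S s x - sx) + (sx - sy) - (S s y - sy)); last by ring.
  apply: le_lt_trans (ler_normB _ _) _.
  apply: le_lt_trans (lerD (ler_normD _ _) b2) _.
  have -> : e = 2 * C / 2 ^+ n + e / 2 + (e / 2 - 2 * C / 2 ^+ n) by field.
  apply: ler_ltD; first by rewrite lerD // ltW.
  rewrite ltrBrDr -mulrDl -mulrDl (_ : 2 + 2 = 4) //; ring.
have rS s : rpartials s (S [::]) = S s.
  elim: s => //= i s ->; apply/funext => x; by case: (dS s i x).
split; last exact: rS.
move=> s; rewrite -/(S [::]) rS; split; first exact: cS.
by move=> i x; case: (dS s i x).
Unshelve. all: by end_near. Qed.

End SmoothSeries.

Section NullSolution.
Context {R : realType} {d : nat} (i0 i1 : 'I_d).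
Hypothesis i01 : i0 != i1.

Lemma rpartials_prod (G H : nat -> R -> R) (c y : R) (s : seq 'I_d) :
  derivatives G -> derivatives H ->
  rpartials s (fun x : 'rV[R]_d => G 0 (x 0 i0 - c) * H 0 (x 0 i1 - y)) =
  fun x => (all (mem [:: i0; i1]) s)%:R *
    (G (count_mem i0 s) (x 0 i0 - c) * H (count_mem i1 s) (x 0 i1 - y)).
Proof.
move=> dG dH; elim: s => [|i s IH].
  by apply/funext => x; rewrite /= mul1r.
rewrite [LHS](_ : _ = 'D_(basisv i) (rpartials s
  (fun x : 'rV[R]_d => G 0 (x 0 i0 - c) * H 0 (x 0 i1 - y)))) // IH.
apply/funext => x; set a := count_mem i0 s; set b := count_mem i1 s.
have dc (F : nat -> R -> R) k j z : derivatives F ->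
    is_derive x (basisv i) (fun x : 'rV[R]_d => F k (x 0 j - z))
      (F k.+1 (x 0 j - z) * (j == i)%:R).
  move=> dF; apply: (@is_derive_comp1 _ _ (F k) (fun x : 'rV[R]_d => x 0 j - z)).
    by rewrite -[_%:R]subr0; apply: is_deriveB; exact: is_derive_coord.
  exact: dF.
have dp := is_deriveM (dc G a i0 c dG) (dc H b i1 y dH).
have -> : 'D_(basisv i) (fun x : 'rV[R]_d => (all (mem [:: i0; i1]) s)%:R *
    (G a (x 0 i0 - c) * H b (x 0 i1 - y))) x =
  (all (mem [:: i0; i1]) s)%:R * (G a (x 0 i0 - c) *
     (H b.+1 (x 0 i1 - y) * (i1 == i)%:R) +
     H b (x 0 i1 - y) * (G a.+1 (x 0 i0 - c) * (i0 == i)%:R)).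
  by have := is_deriveZ (all (mem [:: i0; i1]) s)%:R dp; case.
rewrite /= !inE -/a -/b ![_ == i]eq_sym.
have [->|ii0] := eqVneq i i0.
  by rewrite (negPf i01) /= !add0n !add1n !mulr0 add0r mulr1 [in LHS]mulrC; ring.
have [_|_] := eqVneq i i1.
  by rewrite /= !add0n !add1n mulr1 !mulr0 addr0.
by rewrite /= !mulr0 addr0 mulr0 mul0r.
Qed.

(** The [b]-th derivative of [t ^+ N / N!]. The case distinction matters: for [b > N] truncated
    subtraction would give 1 instead of 0. *)
Definition mono_der N b (t : R) : R :=
  if (b <= N)%N then t ^+ (N - b) / (N - b)`!%:R else 0.

Lemma mono_der_derivatives N : derivatives (mono_der N).
Proof.
move=> b t; rewrite /mono_der; have [bN|Nb] := ltnP b N; last first.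
  have [bN|bN] := leqP b N.
    have -> : (N - b = 0)%N by lia.
    rewrite (_ : (fun _ => _) = cst (1 / 1)); first exact: is_derive_cst.
    by apply/funext => u; rewrite expr0 fact0.
  exact: is_derive_cst.
rewrite (ltnW bN).
have := is_deriveZ ((N - b)`!%:R^-1 : R) (is_derive_expn (N - b) t).
have -> : (fun t : R => t ^+ (N - b) / (N - b)`!%:R) =
   ((N - b)`!%:R^-1 : R) \*: (fun x : R => x ^+ (N - b)).
  by apply/funext => u /=; rewrite mulrC.
congr (is_derive _ _ _ _).
have -> : (N - b = (N - b.+1).+1)%N by lia.
rewrite /GRing.scale /= factS natrM invfM; field.
by rewrite nat1r !pnatr_eq0 -lt0n fact_gt0.
Qed.

(** The quotient of [N!] by [(N - b)!] is [b!] times a binomial coefficient, which is at most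
    [2 ^+ N]. *)
Lemma mono_der_le N b (t r : R) : `|t| <= r -> 1 <= r ->
  `|mono_der N b t| * N`!%:R <= b`!%:R * (2 * r) ^+ N.
Proof.
move=> tr r1; have r0 : 0 <= r by rewrite (le_trans ler01).
rewrite /mono_der; case: leqP => [bN|_]; last first.
  by rewrite normr0 mul0r mulr_ge0 // exprn_ge0 // mulr_ge0.
rewrite normrM normrX normfV normr_nat mulrAC ler_pdivrMr ?ltr0n ?fact_gt0 //.
rewrite -(bin_fact bN) exprMn.
have h1 : `|t| ^+ (N - b) <= r ^+ N.
  apply: le_trans (_ : r ^+ (N - b) <= _); first by rewrite lerXn2r.
  by rewrite ler_weXn2l // leq_subr.
have h2 : 'C(N, b)%:R <= 2 ^+ N :> R.
  rewrite -natrX ler_nat; elim: N b {bN h1} => [|n IH] [|k] //.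
    by rewrite bin0 expn_gt0.
  by rewrite binS expnS mul2n -addnn leq_add.
rewrite !natrM [leLHS](_ : _ = (b`!%:R * (N - b)`!%:R) *
  ('C(N, b)%:R * `|t| ^+ (N - b))); last by ring.
rewrite [leRHS](_ : _ = (b`!%:R * (N - b)`!%:R) * (2 ^+ N * r ^+ N)); last by ring.
by rewrite ler_wpM2l ?mulr_ge0 // ler_pM // exprn_ge0.
Qed.


Definition csum (u : nat -> R[i]) : R[i] :=
  ssum (fun N => complex.Re (u N)) +i* ssum (fun N => complex.Im (u N)).

Definition chalf (u : nat -> R[i]) := half_bounded (fun N => nrm1 (u N)).

Lemma chalfRI u : chalf u -> half_bounded (fun N => complex.Re (u N)) /\
  half_bounded (fun N => complex.Im (u N)).
Proof.
move=> [C uC]; split; exists C => N; apply: le_trans (uC N);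
  by rewrite [leRHS]ger0_norm ?nrm1_ge0 // /nrm1 ?lerDl ?lerDr.
Qed.

Lemma csum_lin (c : R[i]) u v : chalf u -> chalf v ->
  csum (fun N => c * u N + v N) = c * csum u + csum v.
Proof.
move=> /chalfRI[ur ui] /chalfRI[vr vi]; case: c => a b.
apply/eqP; rewrite eq_complex /csum /=; apply/andP; split; apply/eqP.
  rewrite (_ : (fun N => _) = fun N => a * complex.Re (u N) +
    (- b * complex.Im (u N) + complex.Re (v N))).
    by rewrite !ssum_lin //; [ring|exact: half_bounded_lin].
  by apply/funext => N; case: (u N) (v N) => ? ? [? ?] /=; ring.
rewrite (_ : (fun N => _) = fun N => a * complex.Im (u N) +
  (b * complex.Re (u N) + complex.Im (v N))).
  by rewrite !ssum_lin //; [ring|exact: half_bounded_lin].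
by apply/funext => N; case: (u N) (v N) => ? ? [? ?] /=; ring.
Qed.

Lemma chalf_lin (c : R[i]) u v : chalf u -> chalf v ->
  chalf (fun N => c * u N + v N).
Proof.
move=> [C uC] [D vD]; exists (nrm1 c * C + D) => N.
rewrite ger0_norm ?nrm1_ge0 // mulrDl -mulrA.
apply: le_trans (ler_nrm1D _ _) _; apply: lerD.
  apply: le_trans (ler_nrm1M _ _) _; rewrite ler_wpM2l ?nrm1_ge0 //.
  exact: le_trans (ler_norm _) (uC N).
exact: le_trans (ler_norm _) (vD N).
Qed.

Lemma csum0 : csum (fun=> 0) = 0.
Proof. by rewrite /csum /= ssum0. Qed.

Lemma chalf0 : chalf (fun=> 0).
Proof. by exists 0 => N; rewrite nrm1_0 normr0 mul0r. Qed.

Lemma csum_sum n (c : nat -> R[i]) (u : nat -> nat -> R[i]) :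
  (forall j, chalf (u j)) ->
  chalf (fun N => \sum_(j < n) c j * u j N) /\
  csum (fun N => \sum_(j < n) c j * u j N) = \sum_(j < n) c j * csum (u j).
Proof.
move=> hu; elim: n => [|n [IH1 IH2]].
  rewrite (_ : (fun N => _) = fun=> 0); last by apply/funext => N; rewrite big_ord0.
  by rewrite csum0 big_ord0; split => //; exact: chalf0.
rewrite (_ : (fun N => _) =
    fun N => c n * u n N + \sum_(j < n) c j * u j N); last first.
  by apply/funext => N; rewrite big_ord_recr addrC.
by rewrite csum_lin // IH2 big_ord_recr addrC; split => //; exact: chalf_lin.
Qed.

Lemma coord_le_norm (x : 'rV[R]_d) i : `|x 0 i| <= `|x|.
Proof.
rewrite [in leRHS]/Num.norm /= mx_normrE.
exact: (@le_bigmax _ R _ 0 (fun p : 'I_1 * 'I_d => `|x p.1 p.2|) (0, i)).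
Qed.

(** [K a b] stands for the coefficient of the derivative of order [a] along [i0] and [b] along [i1].
    The family [W] lists the derivatives of [w], which depends on these two coordinates only; in
    this form the equation can be matched with the multi-indices of [P]. *)
Lemma null_solution (m : nat) (K : nat -> nat -> R[i]) (x0 : 'rV[R]_d) (e : R) :
  (0 < m)%N -> 0 < e -> K 0 m != 0 ->
  (forall a b, (m <= a + b)%N -> (a, b) != (0, m) -> K a b = 0) ->
  exists w : 'rV[R]_d -> R[i], [/\ smooth w, w x0 != 0,
    forall x : 'rV[R]_d, e <= `|x 0 i0 - x0 0 i0| -> w x = 0 &
    exists W : nat -> nat -> 'rV[R]_d -> R[i],
      (forall s x, partials s w x = (all (mem [:: i0; i1]) s)%:R *
         W (count_mem i0 s) (count_mem i1 s) x) /\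
      forall x, \sum_(b < m.+1) \sum_(a < m.+1) K a b * W a b x = 0].
Proof.
move=> m0 e0 K0 Kab.
pose c a b := - K a b / K 0 m.
have [g [dg grec g0 ge gB]] := coef_sol_exists c m0 e0.
pose X (x : 'rV[R]_d) : R := x 0 i0 - x0 0 i0; pose T (x : 'rV[R]_d) : R := x 0 i1 - x0 0 i1.
pose u a b x N : R[i] := g N a (X x) * (mono_der N b (T x))%:C.
have bnd a b r : exists2 C : R, 0 <= C & forall N (x : 'rV[R]_d), `|x| <= r ->
    nrm1 (u a b x N) <= C / 2 ^+ N.
  pose r' := `|r| + `|x0 0 i1| + 1.
  have r1 : 1 <= r' by rewrite lerDr addr_ge0.
  have rp : 0 < r' by rewrite (lt_le_trans ltr01).
  (* Of the base [4 * r'], the part [2 * r'] pays for [mono_der_le], and the remaining 2 is the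
     geometric decay of the terms. *)
  have [C C0 CP] := gB a (4 * r') (mulr_ge0 (ler0n _ _) (ltW rp)).
  exists (C * b`!%:R) => [|N x xr]; first by rewrite mulr_ge0.
  have Tr : `|T x| <= r'.
    apply: le_trans (ler_normB _ _) _; rewrite /r' -addrA lerD //.
      by apply: le_trans (coord_le_norm x i1) _; apply: le_trans xr (ler_norm r).
    by rewrite lerDl.
  have h1 := CP N (X x); have h2 := mono_der_le N b Tr r1.
  apply: le_trans (ler_nrm1M _ _) _; rewrite {2}/nrm1 /= normr0 addr0.
  rewrite ler_pdivlMr ?exprn_gt0 //.
  have P0 : 0 < (2 * r') ^+ N * N`!%:R.
    by rewrite mulr_gt0 ?ltr0n ?fact_gt0 // exprn_gt0 // mulr_gt0.
  rewrite -(ler_pM2r P0).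
  rewrite [leLHS](_ : _ = (nrm1 (g N a (X x)) * (4 * r') ^+ N) *
     (`|mono_der N b (T x)| * N`!%:R)); last first.
    by rewrite (_ : 4 * r' = 2 * (2 * r')) ?exprMn; [ring|ring].
  rewrite [leRHS](_ : _ = (C * N`!%:R) * (b`!%:R * (2 * r') ^+ N)); last by ring.
  by apply: ler_pM => //; rewrite mulr_ge0 ?nrm1_ge0 ?exprn_ge0 // mulr_ge0 // ltW.
have hu a b x : chalf (u a b x).
  have [C C0 CP] := bnd a b `|x|; exists C => N.
  by rewrite ger0_norm ?nrm1_ge0 // CP.
pose re (z : R[i]) := complex.Re z; pose im (z : R[i]) := complex.Im z.
pose f (p : R[i] -> R) N (x : 'rV[R]_d) := p (g N 0 (X x)) * mono_der N 0 (T x).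
have smooth_part (p : R[i] -> R) : (forall z, `|p z| <= nrm1 z) ->
   (forall z r, p (z * r%:C) = p z * r) ->
   (forall N, derivatives (fun k x => p (g N k x))) ->
   rsmooth (fun x => ssum (f p ^~ x)) /\
   forall s, rpartials s (fun x => ssum (f p ^~ x)) = fun x =>
     (all (mem [:: i0; i1]) s)%:R *
       ssum (fun N => p (u (count_mem i0 s) (count_mem i1 s) x N)).
  move=> pn pM dp.
  have E s N : rpartials s (f p N) = fun x => (all (mem [:: i0; i1]) s)%:R *
     p (u (count_mem i0 s) (count_mem i1 s) x N).
    rewrite (@rpartials_prod (fun k x => p (g N k x)) (mono_der N)) //.
      by apply/funext => x; rewrite /u pM.
    exact: mono_der_derivatives.
  have Cs s r : exists C : R, forall N (x : 'rV[R]_d), `|x| <= r ->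
    `|rpartials s (f p N) x| <= C / 2 ^+ N.
    have [C C0 CP] := bnd (count_mem i0 s) (count_mem i1 s) r.
    exists C => N x xr; rewrite E; apply: le_trans (CP N x xr).
    by rewrite normrM; case: (all _ s); rewrite ?normr1 ?mul1r // normr0 mul0r nrm1_ge0.
  have fs N : rsmooth (f p N).
    apply: smooth_alg_rsmooth; apply: smooth_alg_mul.
      apply: (@smooth_alg_comp _ _ (fun k x => p (g N k x)) 0) => //.
      exact: (smooth_alg_add (smooth_alg_coord _) (smooth_alg_cst _)).
    apply: (@smooth_alg_comp _ _ (mono_der N) 0); first exact: mono_der_derivatives.
    exact: (smooth_alg_add (smooth_alg_coord _) (smooth_alg_cst _)).
  have [sS pS] := smooth_series fs Cs; split => // s; rewrite pS.
  apply/funext => x; rewrite (_ : (fun N => _) = fun N =>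
     (all (mem [:: i0; i1]) s)%:R * p (u (count_mem i0 s) (count_mem i1 s) x N) + 0).
    have hp : half_bounded (fun N => p (u (count_mem i0 s) (count_mem i1 s) x N)).
      have [C C0 CP] := bnd (count_mem i0 s) (count_mem i1 s) `|x|.
      by exists C => N; apply: le_trans (pn _) (CP _ _ _).
    have h0 : half_bounded (fun=> 0 : R) by exists 0 => N; rewrite normr0 mul0r.
    by rewrite ssum_lin // ssum0 addr0.
  by apply/funext => N; rewrite E addr0.
have [|||sr pr] := smooth_part re.
- by move=> z; rewrite /nrm1 lerDl.
- by move=> [x y] r; rewrite /re /= mulr0 subr0.
- by move=> N; case: (dg N).
have [|||si pi] := smooth_part im.
- by move=> z; rewrite /nrm1 lerDr.
- by move=> [x y] r; rewrite /im /= mulr0 add0r.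
- by move=> N; case: (dg N).
pose w x : R[i] := ssum (f re ^~ x) +i* ssum (f im ^~ x).
have wE x : w x = csum (u 0 0 x).
  rewrite /w /csum; congr (_ +i* _); congr ssum; apply/funext => N; rewrite /f /u.
    by case: (g N 0 (X x)) => ? ?; rewrite /re /= mulr0 subr0.
  by case: (g N 0 (X x)) => ? ?; rewrite /im /= mulr0 add0r.
(* Shifting the summation by [b] puts all derivatives along [i1] on the same monomials
   [T x ^+ N / N!], so that the equation can be checked coefficient by coefficient. *)
have uS a b x : csum (u a b x) =
    csum (fun N => g (N + b)%N a (X x) * (T x ^+ N / N`!%:R)%:C).
  have u0 N : (N < b)%N -> u a b x N = 0.
    by move=> Nb; rewrite /u /mono_der leqNgt Nb mulr0.
  have [hr hi] := chalfRI (hu a b x).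
  have uE N : u a b x (N + b)%N = g (N + b)%N a (X x) * (T x ^+ N / N`!%:R)%:C.
    by rewrite /u /mono_der leq_addl addnK.
  rewrite /csum (@ssum_shift _ _ b hr) => [|N /u0->//].
  rewrite (@ssum_shift _ _ b hi) => [|N /u0->//].
  by congr (_ +i* _); congr ssum; apply/funext => N; rewrite uE.
have huS a b x : chalf (fun N => g (N + b)%N a (X x) * (T x ^+ N / N`!%:R)%:C).
  have [C C0 CP] := bnd a b `|x|; exists C => N.
  have := CP (N + b)%N x (lexx _); rewrite /u /mono_der leq_addl addnK => h.
  rewrite ger0_norm ?nrm1_ge0 //; apply: le_trans h _.
  by rewrite ler_wpM2l // lef_pV2 ?posrE ?exprn_gt0 // ler_weXn2l ?ler1n // leq_addr.
exists w; split.
- exact: (conj sr si).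
- have -> : w x0 = g 0%N 0%N 0.
    rewrite wE uS /csum.
    have tr (p : R[i] -> R) : (forall z r, p (z * r%:C) = p z * r) ->
       ssum (fun N => p (g (N + 0)%N 0%N (X x0) * (T x0 ^+ N / N`!%:R)%:C)) = p (g 0%N 0%N 0).
      move=> pM; apply: cvg_lim => //; apply: cvg_near_cst; exists 1%N => // -[//|n] _ /=.
      rewrite /series /= big_nat_recl // big1 ?addr0 => [|j _].
        by rewrite pM expr0 fact0 divr1 mulr1 /X subrr.
      by rewrite pM /T subrr expr0n /= mul0r mulr0.
    rewrite (tr re) ?(tr im); first by case: (g _ _ _).
      by move=> [? ?] r; rewrite /im /= mulr0 add0r.
    by move=> [? ?] r; rewrite /re /= mulr0 subr0.
  exact: g0.
- move=> x ex; rewrite wE (_ : u 0 0 x = fun=> 0) ?csum0 //.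
  by apply/funext => N; rewrite /u ge // mul0r.
exists (fun a b x => csum (u a b x)); split.
  move=> s x; rewrite /partials.
  rewrite (_ : (fun y => complex.Re (w y)) = fun x => ssum (f re ^~ x)) // pr.
  rewrite (_ : (fun y => complex.Im (w y)) = fun x => ssum (f im ^~ x)) // pi.
  rewrite /csum; case: (all _ s); rewrite ?mul1r // !mul0r.
  by apply/eqP; rewrite eq_complex /= !eqxx.
move=> x.
under eq_bigr => b _ do under eq_bigr => a _ do rewrite uS.
pose v a b N := g (N + b)%N a (X x) * (T x ^+ N / N`!%:R)%:C.
have h1 (b : nat) := @csum_sum m.+1 (K ^~ b) (fun a => v a b) (fun a => huS a b x).
rewrite (eq_bigr (fun b : 'I_m.+1 => 1 * csum (fun N => \sum_(a < m.+1) K a b * v a b N))); last first.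
  by move=> b _; rewrite mul1r (h1 b).2.
rewrite -(@csum_sum m.+1 (fun=> 1) (fun b N => \sum_(a < m.+1) K a b * v a b N)
  (fun b => (h1 b).1)).2.
rewrite (_ : (fun N => _) = fun=> 0) ?csum0 //; apply/funext => N.
under eq_bigr => b _ do rewrite mul1r.
rewrite (eq_bigr (fun b : 'I_m.+1 => (\sum_(a < m.+1) K a b * g (N + b)%N a (X x)) *
  (T x ^+ N / N`!%:R)%:C)); last first.
  by move=> b _; rewrite mulr_suml; apply: eq_bigr => a _; rewrite /v mulrA.
rewrite -mulr_suml (_ : \sum_(b < m.+1) _ = 0) ?mul0r //.
(* For [b = m] only [a = 0] contributes, and the recursion makes that term cancel all the others. *)
rewrite big_ord_recr /= [X in _ + X](_ : _ = K 0 m * g (N + m)%N 0 (X x)); last first.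
  rewrite big_ord_recl [X in _ + X]big1 ?addr0 // => a _.
  by rewrite Kab ?mul0r //= leq_addl.
rewrite grec mulr_sumr -big_split big1 //= => b _.
rewrite mulr_sumr; apply/eqP; rewrite addr_eq0; apply/eqP.
rewrite -sumrN (big_ord_widen m.+1 (fun a => - (K 0 m * (c a b * g (N + b)%N (0 + a)%N (X x))))); last first.
  by rewrite (leq_trans (leq_subr _ _)).
rewrite [RHS]big_mkcond; apply: eq_bigr => a _; case: ifP => ab.
  by rewrite /c add0n; field.
rewrite Kab ?mul0r //; first by lia.
by apply: contraNneq K0 => -[_ bm]; have := ltn_ord b; rewrite bm ltnn.
Qed.

End NullSolution.

(** * Cutting off along a compact component *)

Section Chains.
Context {R : realType} {d : nat}.
Local Notation T := ('rV[R]_d).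
Implicit Types (x y z : T) (Y K L : set T) (delta : R).

Lemma compact_seq_cluster K (u : nat -> T) : compact K -> (forall n, K (u n)) ->
  exists2 p, K p & forall e N, 0 < e -> exists2 n, (N <= n)%N & `|p - u n| < e.
Proof.
move=> cK uK.
have [|p [Kp clp]] := cK (u @ \oo) _; first by exists 0%N => // n _; exact: uK.
exists p => // e N e0.
have [||z [[n /= Nn <-] uz]] := clp (u @` [set n | (N <= n)%N]) (ball p e).
- by exists N => // n /= Nn; exists n.
- exact: nbhsx_ballx.
by exists n => //; move: uz; rewrite -ball_normE.
Qed.

Lemma invSn_lt (e : R) : 0 < e -> exists N, forall n, (N <= n)%N -> n.+1%:R^-1 < e.
Proof.
move=> e0; exists (Num.truncn e^-1) => n Nn.
rewrite invf_plt ?posrE //; apply: lt_le_trans (truncnS_gt _) _.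
by rewrite ler_nat ltnS.
Qed.

Lemma compact_gap K L : compact K -> closed L -> K `&` L = set0 ->
  exists2 eta : R, 0 < eta & forall u v, K u -> L v -> eta <= `|u - v|.
Proof.
move=> cK cL KL; apply: contrapT => /forall2NP no.
have H n : exists uv : T * T, [/\ K uv.1, L uv.2 & `|uv.1 - uv.2| < n.+1%:R^-1].
  have [//|] := no n.+1%:R^-1.
  apply: contra_notP => /forallNP h u v Ku Lv; rewrite leNgt; apply/negP => uv.
  by apply: (h (u, v)).
have [w wP] := choice H.
have [|p Kp pP] := compact_seq_cluster (u := fun n => (w n).1) cK.
  by move=> n; case: (wP n).
suff Lp : L p by have : (K `&` L) p by []; rewrite KL.
apply: cL => B /nbhs_ballP[e /= e0 eB].
have e2 : 0 < e / 2 by rewrite divr_gt0.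
have [N NP] := invSn_lt e2; have [n Nn pn] := pP _ N e2.
have [_ Lv uv] := wP n; exists (w n).2; split=> //; apply: eB.
rewrite -ball_normE /ball_ /=; apply: le_lt_trans (ler_distD (w n).1 _ _) _.
by rewrite [ltRHS]splitr ltrD // (lt_trans uv) // NP.
Qed.

(* In a compact set the connected component of [x] is the set of the points that
   are reached from [x] by [delta]-chains for every [delta > 0]. *)
Inductive chain Y delta x : T -> Prop :=
| chain_refl : chain Y delta x x
| chain_step y z : chain Y delta x y -> Y z -> `|y - z| < delta -> chain Y delta x z.

Lemma chain_sub Y delta x z : Y x -> chain Y delta x z -> Y z.
Proof. by move=> Yx; elim. Qed.

Lemma chain_le Y delta delta' x z : delta <= delta' ->
  chain Y delta x z -> chain Y delta' x z.
Proof.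
move=> dd; elim=> [|u v _ cu Yv uv]; first exact: chain_refl.
by apply: chain_step cu Yv _; exact: lt_le_trans dd.
Qed.

Lemma chain_exit Y delta x z (P : T -> Prop) : chain Y delta x z -> P x -> ~ P z ->
  exists u v, [/\ chain Y delta x v, P u, ~ P v & `|u - v| < delta].
Proof.
move=> cz Px; elim: cz => [//|u v cu IH Yv uv nPv].
have [Pu|nPu] := pselect (P u); last exact: IH.
by exists u, v; split=> //; exact: chain_step cu Yv uv.
Qed.

Lemma chain_limit Y x (z : nat -> T) p : Y p ->
  (forall n, chain Y n.+1%:R^-1 x (z n)) ->
  (forall e N, 0 < e -> exists2 n, (N <= n)%N & `|p - z n| < e) ->
  forall delta, 0 < delta -> chain Y delta x p.
Proof.
move=> Yp cz zp delta d0; have [N NP] := invSn_lt d0.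
have [n Nn pn] := zp _ N d0.
apply: (@chain_step _ _ _ (z n)) => //; last by rewrite distrC.
by apply: chain_le (cz n); exact/ltW/NP.
Qed.

(** If the set [Q] of reachable points split into two closed pieces at distance [eta], ever finer
    chains from [x] to the other piece would all leave the [eta / 3]-neighbourhood of the first.
    Their exit points cluster at a point of [Q] that is too far from the first piece to lie in it
    and too close to it to lie in the other. *)
Lemma chain_component Y x : compact Y -> Y x ->
  [set z | forall delta, 0 < delta -> chain Y delta x z] `<=` connected_component Y x.
Proof.
move=> cY Yx; set Q := [set z | _].
have YQ : Q `<=` Y by move=> z /(_ 1 ltr01); exact: chain_sub.
have Qx : Q x by move=> *; exact: chain_refl.
have clY : closed Y by apply: compact_closed => //; exact: norm_hausdorff.
have clQ : closed Q.
  move=> z zQ delta d0.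
  have Yz : Y z by apply: clY => B /zQ[u [Qu Bu]]; exists u; split=> //; exact: YQ.
  have [u [Qu uz]] := zQ (ball z delta) (nbhsx_ballx _ _ d0).
  apply: (@chain_step _ _ _ u) => //; first exact: Qu.
  by move: uz; rewrite -ball_normE /ball_ /= distrC.
apply: connected_component_max => //.
apply: contrapT => /connectedPn[E [E0 QE sepE]].
have clE b : closed (E b).
  move=> z zE; have Qz : Q z.
    by apply: clQ => B /zE[u [Eu Bu]]; exists u; split=> //; rewrite QE; case: b Eu {zE}; [right|left].
  move: Qz; rewrite QE; have [s1 s2] := sepE.
  case: b zE => zE [] // Ez; exfalso.
    by have : (E false `&` closure (E true)) z by []; rewrite s2.
  by have : (closure (E false) `&` E true) z by []; rewrite s1.
have [b Eb] : exists b, E b x.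
  by move: Qx; rewrite QE => -[]; [exists false|exists true].
have [v Ev] := E0 (~~ b).
have Qb c z : E c z -> Q z by move=> Ez; rewrite QE; case: c Ez; [right|left].
have EE : E b `&` E (~~ b) = set0.
  have [s1 s2] := sepE; apply/seteqP; split=> // z [].
  case: b {Eb Ev} => /= Ez Ez'.
    suff : (E false `&` closure (E true)) z by rewrite s2.
    by split => //; exact: subset_closure.
  suff : (E false `&` closure (E true)) z by rewrite s2.
  by split => //; exact: subset_closure.
have cEb : compact (E b).
  by apply: (subclosed_compact _ cY) => // z /Qb/YQ.
have [eta eta0 gap] := compact_gap cEb (clE (~~ b)) EE.
have eta3 : 0 < eta / 3 by rewrite divr_gt0.
pose P z := exists2 u, E b u & `|u - z| < eta / 3.
have Px : P x by exists x => //; rewrite subrr normr0.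
have nPv : ~ P v.
  move=> [u Eu uv]; have := gap u v Eu Ev; rewrite leNgt (lt_trans uv) //.
  by rewrite ltr_pdivrMr // ltr_pMr // ltr1n.
have H n : exists w : T * T, [/\ chain Y n.+1%:R^-1 x w.2, P w.1, ~ P w.2 & `|w.1 - w.2| < eta / 3].
  have d0 : 0 < Num.min (eta / 3) n.+1%:R^-1 by rewrite lt_min eta3 invr_gt0 /=.
  have [u [u' [cu Pu nPu']]] := chain_exit (Qb _ _ Ev _ d0) Px nPv.
  rewrite lt_min => /andP[uu' _]; exists (u, u'); split=> //=.
  by apply: chain_le cu; rewrite ge_min lexx orbT.
have [w wP] := choice H.
have [|p Yp pP] := compact_seq_cluster (u := fun n => (w n).2) cY.
  by move=> n; case: (wP n) => /(chain_sub Yx).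
have Qp : Q p by apply: chain_limit pP => // n; case: (wP n).
have [n _ pn] := pP _ 0%N eta3; have [_ [u Eu uw] nP ww] := wP n.
have [Ep|Ep] : E b p \/ E (~~ b) p.
  by move: Qp; rewrite QE => -[]; case: (b) => /=; [right|left|left|right].
  by apply: nP; exists p.
have := gap u p Eu Ep; rewrite leNgt => /negP; apply.
have -> : u - p = (u - (w n).1) + ((w n).1 - (w n).2) - (p - (w n).2).
  by rewrite opprB !addrA subrK subrK.
apply: le_lt_trans (ler_normB _ _) _; apply: le_lt_trans (lerD (ler_normD _ _) (lexx _)) _.
have -> : eta = eta / 3 + eta / 3 + eta / 3 by field.
by rewrite ltrD // ltrD.
Qed.

End Chains.

(** * Smooth cutoff functions around a compact component *)

Section Cutoff.
Context {R : realType} {d : nat}.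
Local Notation T := ('rV[R]_d).

Lemma smooth_alg_prod (I : Type) (s : seq I) (h : I -> T -> R) :
  (forall i, smooth_alg (h i)) -> smooth_alg (fun z => \prod_(i <- s) h i z).
Proof.
move=> sh; elim: s => [|i s IH].
  rewrite (_ : (fun _ => _) = fun=> 1); first exact: smooth_alg_cst.
  by apply/funext => z; rewrite big_nil.
rewrite (_ : (fun _ => _) = fun z => h i z * \prod_(i <- s) h i z).
  exact: smooth_alg_mul.
by apply/funext => z; rewrite big_cons.
Qed.

(** Row vectors carry the maximum norm, so a product of plateau functions of the single coordinates
    has the required shape. Each coordinate enters with both signs because its absolute value is not
    smooth. *)
Lemma bump_exists (y : T) (r : R) : 0 < r -> exists b : T -> R,
  [/\ rsmooth b, forall z, `|z - y| < r / 2 -> b z = 1 &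
    forall z, r <= `|z - y| -> b z = 0].
Proof.
move=> r0.
pose g (k : nat) : R -> R := @flat_der R 1 k 0.
have dg : derivatives g by move=> k t; exact: is_derive_flat_der.
have g_gt0 t : 0 < t -> 0 < g 0%N t.
  by move=> t0; rewrite /g /= /flat_exp t0 expr0 mul1r expR_gt0.
have g_ge0 t : 0 <= g 0%N t by exact: flat_exp_ge0.
have g_eq0 t : t <= 0 -> g 0%N t = 0 by move=> t0; exact: flat_der_eq0.
(* The usual transition function from 1 on [t <= r / 2] to 0 on [t >= r]; at least one of the two
   summands of the denominator is positive. *)
pose q t := g 0%N (r - t) * (g 0%N (r - t) + g 0%N (t - r / 2))^-1.
have den t : g 0%N (r - t) + g 0%N (t - r / 2) != 0.
  rewrite gt_eqF //; have [rt|tr] := ltP t r.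
    by rewrite ltr_pwDl // g_gt0 // subr_gt0.
  by rewrite ltr_wpDl // g_gt0 // subr_gt0 (lt_le_trans _ tr) // ltr_pdivrMr // ltr_pMr // ltr1n.
have q1 t : t <= r / 2 -> q t = 1.
  move=> tr; rewrite /q; have := den t; rewrite (@g_eq0 (t - r / 2)) ?subr_le0 //.
  by rewrite addr0 => h; rewrite mulfV.
have q0 t : r <= t -> q t = 0 by move=> rt; rewrite /q g_eq0 ?mul0r // subr_le0.
have sq (f : T -> R) : smooth_alg f -> smooth_alg (fun z => q (f z)).
  move=> sf; have s1 : smooth_alg (fun z => g 0%N (r - f z)).
    apply: (smooth_alg_comp 0 dg).
    rewrite (_ : (fun _ => _) = fun z => r + -1 * f z); last first.
      by apply/funext => z; rewrite mulN1r.
    by apply: smooth_alg_add; [exact: smooth_alg_cst|apply: smooth_alg_mul => //; exact: smooth_alg_cst].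
  apply: smooth_alg_mul => //; apply: smooth_alg_inv => // ; apply: smooth_alg_add => //.
  apply: (smooth_alg_comp 0 dg).
  by apply: smooth_alg_add => //; exact: smooth_alg_cst.
pose h (z : T) i := q (z 0 i - y 0 i) * q (y 0 i - z 0 i).
have sh i : smooth_alg (fun z => h z i).
  apply: smooth_alg_mul; apply: sq.
    exact: smooth_alg_add (smooth_alg_coord _) (smooth_alg_cst _).
  rewrite (_ : (fun _ => _) = fun z : T => y 0 i + -1 * z 0 i); last first.
    by apply/funext => z; rewrite mulN1r.
  apply: smooth_alg_add; first exact: smooth_alg_cst.
  by apply: smooth_alg_mul; [exact: smooth_alg_cst|exact: smooth_alg_coord].
exists (fun z => \prod_(i < d) h z i); split.
- by apply: smooth_alg_rsmooth; exact: (@smooth_alg_prod _ _ (fun i z => h z i)).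
- move=> z zy; rewrite big1 // => i _.
  have zi : `|z 0 i - y 0 i| < r / 2.
    by have := coord_le_norm (z - y) i; rewrite !mxE => /le_lt_trans; exact.
  rewrite /h !q1 ?mulr1 //.
    by rewrite (le_trans (ler_norm _)) // distrC ltW.
  by rewrite (le_trans (ler_norm _)) // ltW.
- move=> z zy; have [[i0 i]] : exists ij : 'I_1 * 'I_d, r <= `|(z - y) ij.1 ij.2|.
    have [ij E] : exists ij : 'I_1 * 'I_d, `|z - y| = `|(z - y) ij.1 ij.2|.
      by apply: mx_norm_neq0; rewrite gt_eqF // (lt_le_trans r0).
    by exists ij; rewrite -E.
  rewrite /= (ord1 i0) !mxE => ri; rewrite (bigD1 i) //= /h.
  move: ri; rewrite ler_normr => /orP[ri|ri]; first by rewrite q0 // !mul0r.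
  by rewrite (q0 (y 0 i - z 0 i)) ?mulr0 ?mul0r // -opprB.
Qed.

(** The component itself may fail to be isolated in [A]. The cutoff is therefore placed around the
    class [K] of points reached from [x] by chains of one small mesh: it is isolated in [A] and
    still close to the component. On the hyperplane, a point of [S] outside [X1] lies in [A], hence
    in [K], near which [chi] is 1. *)
Lemma component_cutoff (i0 : 'I_d) (c : R) (X1 X2 : set T) (x : T) :
  open X1 -> open X2 ->
  let A := ~` X1 `&` [set y : T | y 0 i0 = c] in
  A x -> compact (connected_component A x) -> connected_component A x `<=` X2 ->
  exists (chi : T -> R) (S : set T) (e : R), [/\ rsmooth chi, chi x = 1, compact S,
    0 < e & (forall z, chi z != 0 -> S z) /\
    forall z : T, `|z 0 i0 - c| <= e -> S z ->
      X2 z /\ (X1 z \/ \forall y \near z, chi y = 1)].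
Proof.
move=> oX1 oX2 A Ax cC CX2; set C := connected_component A x in cC CX2.
have clA : closed A.
  apply: closedI; first exact: open_closedC.
  rewrite (_ : [set y : T | y 0 i0 = c] = (fun y : T => y 0 i0) @^-1` [set c]) //.
  apply: closed_comp => [y _|]; first exact: coord_continuous.
  exact: closed_eq.
have Cx : C x by exact: connected_component_refl.
have CA : C `<=` A by exact: connected_component_sub.
have [rho2 rho20 gap2] : exists2 eta : R, 0 < eta &
    forall u v, C u -> (~` X2) v -> eta <= `|u - v|.
  apply: compact_gap => //; first exact: open_closedC.
  by apply/seteqP; split=> // z [/CX2].
pose rho := rho2 / 2; have rho0 : 0 < rho by rewrite divr_gt0.
have X2near u z : C u -> `|u - z| < 2 * rho -> X2 z.
  move=> Cu uz; apply: contrapT => nX2; have := gap2 u z Cu nX2.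
  by rewrite leNgt; move: uz; rewrite /rho mulrC divfK // => ->.
pose N := [set z : T | exists2 u, C u & `|u - z| < rho].
have clN z : closure N z -> exists2 u, C u & `|u - z| < 2 * rho.
  move=> /(_ _ (nbhsx_ballx z rho rho0))[v [[u Cu uv]]].
  rewrite -ball_normE /ball_ /= distrC => vz; exists u => //.
  apply: le_lt_trans (ler_distD v _ _) _.
  by rewrite mulr_natl mulr2n ltrD.
pose Y := A `&` closure N.
have bndC : exists M : R, forall u, C u -> `|u| <= M.
  have [M [_ MP]] := compact_bounded cC; exists (M + 1) => u Cu.
  by apply: MP => //; rewrite ltrDl.
have cY : compact Y.
  apply: bounded_closed_compact; last by apply: closedI => //; exact: closed_closure.
  have [M MP] := bndC; exists (M + 2 * rho); split; first exact: num_real.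
  move=> M' MM' z [_ /clN[u Cu uz]] /=; apply/ltW/(le_lt_trans _ MM').
  rewrite -[z](subKr u); apply: le_trans (ler_normB _ _) _.
  by apply: lerD; [exact: MP|exact: ltW].
have Nx : N x by exists x => //; rewrite subrr normr0.
have Yx : Y x by split=> //; exact: subset_closure.
(* [Y] is the part of [A] close to [C], which is compact; the component of [x] in it is connected in
   [A] and so contained in [C]. *)
have Q_C : [set z | forall delta, 0 < delta -> chain Y delta x z] `<=` C.
  apply: subset_trans (chain_component cY Yx) _.
  apply: connected_component_max => //.
  - exact: connected_component_refl.
  - by apply: subset_trans (@connected_component_sub _ _ _) _ => z [].
  - exact: component_connected.
(* If every mesh failed, points far from [C] reached by ever finer chains would cluster at a point
   reached with every mesh, that is, at a point of [C]. *)
have [delta delta0 dP] : exists2 delta, 0 < delta &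
    forall z, chain Y delta x z -> exists2 u, C u & `|u - z| < rho / 2.
  apply: contrapT => /forall2NP no.
  have H n : exists z, chain Y n.+1%:R^-1 x z /\ forall u, C u -> rho / 2 <= `|u - z|.
    have [//|h] := no n.+1%:R^-1.
    apply: contra_notP h => /forallNP h z cz; apply: contrapT => nu.
    apply: (h z); split=> // u Cu; rewrite leNgt; apply/negP => uz.
    by apply: nu; exists u.
  have [w wP] := choice H.
  have [|p Yp pP] := compact_seq_cluster (u := w) cY.
    by move=> n; case: (wP n) => /(chain_sub Yx).
  have Cp : C p by apply: Q_C => delta d0; apply: chain_limit pP _ d0 => // n; case: (wP n).
  have r2 : 0 < rho / 2 by rewrite divr_gt0.
  have [n _ pn] := pP _ 0%N r2; have [_ /(_ p Cp)] := wP n.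
  by rewrite leNgt pn.
pose K := chain Y delta x.
have KY : K `<=` Y by move=> z; exact: chain_sub.
(* [2 * r < delta] allows a chain one more step into [A], and [2 * r < rho / 2] keeps the end of
   that step in [N], hence in [Y]. *)
pose r := Num.min delta rho / 8.
have r0 : 0 < r by rewrite divr_gt0 // lt_min delta0.
have rd : 2 * r < delta.
  have : Num.min delta rho <= delta by rewrite ge_min lexx.
  by rewrite /r; clear -delta0 r0; move: (Num.min _ _) => q; lra.
have rrho : 2 * r < rho / 2.
  have : Num.min delta rho <= rho by rewrite ge_min lexx orbT.
  by rewrite /r; clear -rho0 r0; move: (Num.min _ _) => q; lra.
have nearK k z : K k -> `|k - z| < 2 * r -> exists2 u, C u & `|u - z| < rho.
  move=> Kk kz; have [u Cu uk] := dP k Kk; exists u => //.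
  apply: le_lt_trans (ler_distD k _ _) _; rewrite [ltRHS]splitr ltrD //.
  exact: lt_trans kz rrho.
have KA k z : K k -> A z -> `|k - z| < 2 * r -> K z.
  move=> Kk Az kz; apply: (@chain_step _ _ _ _ _ k) => //; last exact: lt_trans kz rd.
  by split=> //; apply: subset_closure; exact: nearK Kk kz.
have clK : closed K.
  have clY : closed Y by apply: compact_closed => //; exact: norm_hausdorff.
  move=> z zK; have Yz : Y z by apply: clY => B /zK[u [Ku Bu]]; exists u; split=> //; exact: KY.
  have [u [Ku uz]] := zK (ball z delta) (nbhsx_ballx _ _ delta0).
  apply: (@chain_step _ _ _ _ _ u) => //.
  by move: uz; rewrite -ball_normE /ball_ /= distrC.
have cK : compact K by exact: subclosed_compact cY KY.
have r4 : 0 < r / 4 by rewrite divr_gt0.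
have [b bP] := choice (fun y => bump_exists y r0).
have [F FK KF] : finite_subset_cover K (fun y => ball y (r / 4)) K.
  move: cK; rewrite compact_cover; apply.
    by move=> y _; exact: ball_open.
  by move=> y Ky; exists y => //; exact: ballxx.
pose Fs : seq T := finmap.enum_fset F.
(* The value is 1 as soon as one bump is 1, and 0 where all bumps vanish. Balls of radius [r / 4]
   cover [K], and the bumps are 1 up to [r / 2], so [chi] is 1 on a neighbourhood of [K]. *)
pose chi z := 1 - \prod_(y <- Fs) (1 - b y z).
have schi : rsmooth chi.
  apply: smooth_alg_rsmooth; rewrite (_ : chi = fun z => 1 + -1 * \prod_(y <- Fs) (1 + -1 * b y z)).
    have s1 h : smooth_alg h -> smooth_alg (fun z : T => 1 + -1 * h z).
      move=> sh; apply: smooth_alg_add; first exact: smooth_alg_cst.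
      by apply: smooth_alg_mul => //; exact: smooth_alg_cst.
    apply: (s1); apply: (@smooth_alg_prod _ _ (fun y z => 1 + -1 * b y z)) => y.
    by apply: (s1); apply: smooth_alg_base; case: (bP y).
  by apply/funext => z; rewrite /chi mulN1r; congr (_ - _); apply: eq_bigr => y _; rewrite mulN1r.
have FsubK y : y \in Fs -> K y by move=> yF; have := FK y yF; rewrite inE.
have chi1 k : K k -> \forall z \near k, chi z = 1.
  move=> /KF[y /= yF ky]; apply/nbhs_ballP; exists (r / 4) => //= z kz.
  rewrite /chi (bigD1_seq y) ?finmap.fset_uniq //=; case: (bP y) => _ b1 _.
  rewrite b1 ?subrr ?mul0r ?subr0 //.
  move: ky kz; rewrite -!ball_normE /ball_ /= => ky kz.
  rewrite distrC; apply: le_lt_trans (ler_distD k _ _) _.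
  have -> : r / 2 = r / 4 + r / 4 by field.
  exact: ltrD.
pose S := closure [set z | chi z != 0].
have chi0 z : chi z != 0 -> exists2 k, K k & `|k - z| < r.
  apply: contraNP => nk; rewrite /chi big_seq big1 ?subrr // => y yF.
  case: (bP y) => _ _ b0; rewrite b0 ?subr0 // leNgt; apply/negP => zy.
  by apply: nk; exists y; [exact: FsubK|rewrite distrC].
have SK z : S z -> exists2 k, K k & `|k - z| < 2 * r.
  move=> /(_ _ (nbhsx_ballx z r r0))[v [/= /chi0[k Kk kv]]].
  rewrite -ball_normE /ball_ /= distrC => vz; exists k => //.
  by apply: le_lt_trans (ler_distD v _ _) _; rewrite mulr_natl mulr2n ltrD.
have cS : compact S.
  apply: bounded_closed_compact; last exact: closed_closure.
  have [M MP] := bndC; exists (M + rho); split; first exact: num_real.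
  move=> M' MM' z /SK[k Kk kz] /=; have [u Cu uz] := nearK k z Kk kz.
  apply/ltW/(le_lt_trans _ MM'); rewrite -[z](subKr u).
  apply: le_trans (ler_normB _ _) _.
  by apply: lerD; [exact: MP|exact: ltW].
have SX2 z : S z -> X2 z.
  move=> /SK[k Kk kz]; have [u Cu uz] := nearK k z Kk kz.
  by apply: (X2near u) => //; rewrite (lt_trans uz) // mulr_natl mulr2n ltrDl.
exists chi, S.
(* Counterexamples approaching the hyperplane would cluster at a point of [S] on it. That point lies
   in the open set [X1] or in [K], and in both cases the conclusion holds nearby. *)
have [e e0 eP] : exists2 e : R, 0 < e & forall z : T, `|z 0 i0 - c| <= e -> S z ->
    X1 z \/ \forall y \near z, chi y = 1.
  apply: contrapT => /forall2NP no.
  have H n : exists z : T, [/\ `|z 0 i0 - c| <= n.+1%:R^-1, S z, ~ X1 z &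
      ~ \forall y \near z, chi y = 1].
    have [//|h] := no n.+1%:R^-1.
    apply: contra_notP h => /forallNP h z zc Sz; apply: contrapT => /not_orP[n1 n2].
    by apply: (h z).
  have [w wP] := choice H.
  have [|p Sp pP] := compact_seq_cluster (u := w) cS; first by move=> n; case: (wP n).
  have pc : p 0 i0 = c.
    apply/eqP; rewrite -subr_eq0 -normr_le0; apply/ler_addgt0Pr => e e0; rewrite add0r.
    have e2 : 0 < e / 2 by rewrite divr_gt0.
    have [M MP] := invSn_lt e2; have [n Mn pn] := pP _ M e2; have [wc _ _ _] := wP n.
    apply: le_trans (ler_distD (w n 0 i0) _ _) _; rewrite [leRHS]splitr lerD //.
      by have := coord_le_norm (p - w n) i0; rewrite !mxE => /le_trans; apply; exact: ltW.
    by apply: le_trans wc _; exact/ltW/MP.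
  have [X1p|nX1p] := pselect (X1 p).
    have [e /= e0 eX] := (nbhs_ballP _ _).1 (oX1 p X1p).
    have [n _ pn] := pP _ 0%N e0; have [_ _ nX1 _] := wP n; apply: nX1.
    by apply: eX; rewrite -ball_normE.
  have [k Kk kp] := SK p Sp.
  have Kp : K p by apply: KA Kk _ kp.
  have [e /= e0 eX] := (nbhs_ballP _ _).1 (near_join (chi1 p Kp)).
  have [n _ pn] := pP _ 0%N e0; have [_ _ _ nc] := wP n; apply: nc.
  by apply: eX; rewrite -ball_normE.
exists e; split=> //.
- by have /nbhs_singleton := chi1 x (chain_refl _ _ _).
- split=> [z z0|z ze Sz]; first exact: subset_closure.
  by split; [exact: SX2|exact: eP].
Qed.

End Cutoff.

(** * The a priori estimate in abstract form *)

Section AbstractEstimate.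
Context {R : realType} {V : zmodType} (form : V -> V -> R).
Hypothesis formDl : forall u v w, form (u + v) w = form u w + form v w.
Hypothesis formC : forall u v, form u v = form v u.
Hypothesis form_ge0 : forall u, 0 <= form u u.
Context (a a' : V -> V).
Hypothesis a'D : forall u v, a' (u + v) = a' u + a' v.
Hypothesis adj_a : forall u v, form (a u) v = form u (a' v).
Hypothesis comm_a : forall u, a' (a u) = a (a' u) + u *+ 2.

Let form_sumr I (r : seq I) (P : pred I) (F : I -> V) u :
  form u (\sum_(i <- r | P i) F i) = \sum_(i <- r | P i) form u (F i).
Proof.
have form0 : form u 0 = 0.
  have := formDl 0 0 u; rewrite addr0 formC => /eqP.
  by rewrite -subr_eq0 opprD addNKr oppr_eq0 => /eqP.
apply: (big_morph (form u)) => // v w.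
by rewrite formC formDl !(formC u).
Qed.

Let form_suml I (r : seq I) (P : pred I) (F : I -> V) u :
  form (\sum_(i <- r | P i) F i) u = \sum_(i <- r | P i) form (F i) u.
Proof. by rewrite formC form_sumr; apply: eq_bigr => i _; rewrite formC. Qed.

Let formMnr u v n : form u (v *+ n) = n%:R * form u v.
Proof.
have <- : \sum_(i < n) v = v *+ n by rewrite sumr_const card_ord.
by rewrite form_sumr sumr_const card_ord mulr_natl.
Qed.

Let adj_a' u v : form (a' u) v = form u (a v).
Proof. by rewrite formC -adj_a formC. Qed.

Let a'Mn u n : a' (u *+ n) = a' u *+ n.
Proof.
elim: n => [|n IH]; last by rewrite !mulrS a'D IH.
rewrite !mulr0n; have /eqP := a'D 0 0; rewrite addr0 -subr_eq0.
by rewrite opprD addNKr oppr_eq0 => /eqP.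
Qed.

Let iter_comm k u : iter k a' (a u) = a (iter k a' u) + iter k.-1 a' u *+ (2 * k).
Proof.
elim: k => [|k IH]; first by rewrite muln0 mulr0n addr0.
rewrite iterS IH a'D comm_a -addrA a'Mn; congr (_ + _).
case: k {IH} => [|k]; first by rewrite muln0 mulr0n addr0.
by rewrite -iterS -mulrnDr; congr (_ *+ _); lia.
Qed.

(** The product without the power of 2 counts the ways to contract [j] of the [k] factors with [j]
    of the [l] factors; each contraction contributes the commutator 2. *)
Let coef k l j : R := (2 ^ j * j`! * 'C(k, j) * 'C(l, j))%:R.

(* Anti-normal ordering: all the [a'] are moved to the right of the [a]. *)
Lemma form_iter n k l u v : (k < n)%N ->
  form (iter k a u) (iter l a v) =
  \sum_(j < n) coef k l j * form (iter (l - j) a' u) (iter (k - j) a' v).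
Proof.
elim: k u v n => [|k IH] u v n kn.
  case: n kn => // n _; rewrite big_ord_recl big1 => [|i _].
    rewrite /coef !bin0 subn0 sub0n mul1r addr0 /=.
    by elim: l u => // l IHl u; rewrite iterS -adj_a' IHl -iterSr.
  by rewrite /coef bin0n /= muln0 mul0n mul0r.
rewrite iterSr (IH (a u) v n); last exact: ltnW.
under eq_bigr => j _ do rewrite iter_comm formDl.
have shift (F : nat -> R) : F n.-1 = 0 ->
    \sum_(j < n) F j = \sum_(j < n) (if (j : nat) is j'.+1 then F j' else 0).
  case: n kn => // n _ /= Fn; rewrite big_ord_recr /= Fn addr0.
  by rewrite big_ord_recl /= add0r.
under eq_bigr => j _ do rewrite mulrDr adj_a -iterS.
rewrite big_split /= (shift (fun j => coef k l j *
  form (iter (l - j).-1 a' u *+ (2 * (l - j))) (iter (k - j) a' v))); last first.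
  (* Here [k < n.-1], so the last term drops out and the summation index can be shifted by one. *)
  have -> : coef k l n.-1 = 0 by rewrite /coef bin_small ?muln0 //; lia.
  by rewrite mul0r.
rewrite -big_split; apply: eq_bigr => -[[|j] jn] _ /=.
  by rewrite addr0 /coef !bin0 !subn0.
have formMnl w z q : form (w *+ q) z = q%:R * form w z.
  by rewrite formC formMnr formC.
have -> : coef k l j.+1 * form (iter (l - j.+1) a' u) (a' (iter (k - j.+1) a' v)) =
    coef k l j.+1 * form (iter (l - j.+1) a' u) (iter (k - j) a' v).
  have [jk|kj] := ltnP j k; last by rewrite /coef (@bin_small k) // muln0 mul0n !mul0r.
  by rewrite -iterS -subSn.
rewrite subSS formMnl (_ : (l - j).-1 = l - j.+1)%N; last by rewrite subnS.
rewrite mulrA -mulrDl; congr (_ * _); rewrite -natrM -natrD; congr _%:R.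
rewrite binS; have := mul_bin_left l j; rewrite factS expnS => E.
rewrite [X in (_ + X)%N](_ : _ =
   2 ^ j * j`! * 'C(k, j) * 2 * ((l - j) * 'C(l, j)))%N; last by ring.
by rewrite -E; ring.
Qed.

Context (B B' : nat -> V -> V).
Hypothesis B'D : forall k u v, B' k (u + v) = B' k u + B' k v.
Hypothesis adj_B : forall k u v, form (B k u) v = form u (B' k v).
Hypothesis comm_Ba : forall k u, B k (a u) = a (B k u).
Hypothesis comm_Ba' : forall k u, B k (a' u) = a' (B k u).
Hypothesis comm_BB' : forall k l u, B k (B' l u) = B' l (B k u).

(** Since the [B k] commute with [a], [a'] and all [B' l], reordering turns the right-hand side into
    a sum of squares [form (T j) (T j)] with weights [2 ^ j * j!]. The square with [j = m] is that
    of [B' m u], and its weight is at least 1. *)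
Lemma form_operator_ge m u :
  form (B' m u) (B' m u) <=
  form (\sum_(k < m.+1) B k (iter k a u)) (\sum_(k < m.+1) B k (iter k a u)).
Proof.
have iterB k l v : B k (iter l a v) = iter l a (B k v).
  by elim: l => //= l <-.
have iterB' k l v : B k (iter l a' v) = iter l a' (B k v).
  by elim: l => //= l <-.
have B'Mn k v n : B' k (v *+ n) = B' k v *+ n.
  elim: n => [|n IH]; last by rewrite !mulrS B'D IH.
  rewrite !mulr0n; have /eqP := B'D k 0 0; rewrite addr0 -subr_eq0.
  by rewrite opprD addNKr oppr_eq0 => /eqP.
pose T j := \sum_(l < m.+1) B' l (iter (l - j) a' u) *+ 'C(l, j).
have -> : form (\sum_(k < m.+1) B k (iter k a u))
     (\sum_(k < m.+1) B k (iter k a u)) =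
   \sum_(j < m.+1) (2 ^ j * j`!)%:R * form (T j) (T j).
  rewrite form_suml.
  under eq_bigr => k _.
    rewrite form_sumr; under eq_bigr => l _.
      rewrite !iterB (@form_iter m.+1) //; under eq_bigr => j _.
        rewrite -!iterB' adj_B -comm_BB' formC adj_B formC.
        over.
      over.
    over.
  rewrite [RHS](eq_bigr (fun j : 'I_m.+1 => \sum_(k < m.+1) \sum_(l < m.+1)
    coef k l j * form (B' l (iter (l - j) a' u)) (B' k (iter (k - j) a' u)))).
    rewrite [RHS]exchange_big /=; apply: eq_bigr => k _.
    by rewrite [RHS]exchange_big.
  move=> j _; rewrite /T form_suml mulr_sumr exchange_big; apply: eq_bigr => k _ /=.
  rewrite form_sumr mulr_sumr; apply: eq_bigr => l _.
  rewrite formMnr formC formMnr !mulrA -!natrM /coef.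
  by congr (_ * _) => //; congr _%:R; lia.
rewrite big_ord_recr /=; apply: ler_wpDl.
  by apply: sumr_ge0 => j _; apply: mulr_ge0.
have -> : T m = B' m u.
  rewrite /T big_ord_recr /= subnn binn mulr1n big1 ?add0r // => l _.
  by rewrite bin_small // mulr0n.
rewrite ler_peMl //; rewrite (ler_nat _ 1) muln_gt0 expn_gt0 fact_gt0 //.
Qed.

End AbstractEstimate.

(** * Integration by Riemann sums *)

Section RiemannSums.
Context {R : realType} {d : nat} (x0 : 'rV[R]_d).
Local Notation T := ('rV[R]_d).
Implicit Types (F G : T -> R) (s : seq 'I_d) (h b C L : R) (n : nat).

(** The sum remains a function of the point, so that sums in several directions compose; [b] is the
    offset of the first node. *)
Definition rsum h b n i F : T -> R := fun y =>
  h * \sum_(t < n) F (y + (h * t%:R + b) *: basisv i).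

Definition rsums h b n s F := foldl (fun G i => rsum h b n i G) F s.

Lemma rsumC h b n i j F : rsum h b n i (rsum h b n j F) = rsum h b n j (rsum h b n i F).
Proof.
apply/funext => y; rewrite /rsum -!mulr_sumr; congr (_ * (_ * _)).
rewrite exchange_big; apply: eq_bigr => t _; apply: eq_bigr => u _.
by rewrite addrAC.
Qed.

Lemma rsums_perm h b n s s' F : perm_eq s s' -> rsums h b n s F = rsums h b n s' F.
Proof.
elim: s s' F => [|i s IH] s' F ps.
  by move: ps; rewrite perm_sym => /perm_nilP ->.
have is' : i \in s' by rewrite -(perm_mem ps) mem_head.
case/splitPr: is' ps => s1 s2; rewrite perm_sym -cat1s perm_catCA.
rewrite /= perm_sym perm_cons => ps; rewrite /= (IH _ _ ps).
elim: s1 F {ps} => //= j s1 IH1 F.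
by rewrite rsumC IH1.
Qed.

Lemma rsums_lin h b n s (a : R) F G : rsums h b n s (fun z => a * F z + G z) =
  fun z => a * rsums h b n s F z + rsums h b n s G z.
Proof.
elim: s F G => //= i s IH F G; rewrite -IH; congr (rsums _ _ _ _ _).
by apply/funext => z; rewrite /rsum big_split -mulr_sumr /=; ring.
Qed.

(** Sums over the directions [s] evaluated at [x0] visit only this slice. That the remaining
    coordinates agree with those of [x0] locates the boundary points of a telescoping sum outside
    the support. *)
Definition slice s (z : T) := forall j, j \notin s -> z 0 j = x0 0 j.

Definition boxed s C L F := forall z, slice s z -> `|F z| <= C /\
  ((exists2 j, j \in s & L < `|z 0 j - x0 0 j|) -> F z = 0).

Lemma grid_count h L (a : R) n : 0 < h -> 0 <= L ->
  h * \sum_(t < n) (`|a + h * t%:R| <= L)%R%:R <= 2 * L + h.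
Proof.
move=> h0 L0.
(* The nodes clamped to the interval from [- L] to [L + h]: [psi] grows by [h] at each node of
   absolute value at most [L] and never decreases, so the count is bounded by a telescoping sum. *)
pose psi (t : nat) : R := Num.min (Num.max (a + h * t%:R) (- L)) (L + h).
have step t : h * (`|a + h * t%:R| <= L)%R%:R <= psi t.+1 - psi t.
  rewrite /psi -natr1 mulrDr mulr1 addrA; set y := a + _.
  have [|] := boolP (`|y| <= L); rewrite ler_norml => yL.
    move/andP: yL => [y1 y2]; rewrite mulr1.
    rewrite !max_l ?min_l //; lra.
  rewrite mulr0 subr_ge0; clearbody y.
  have h1 : Num.max y (- L) <= Num.max (y + h) (- L).
    by rewrite ge_max !le_max lexx orbT andbT lerDl (ltW h0).
  by rewrite le_min !ge_min h1 lexx orbT.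
rewrite mulr_sumr; apply: le_trans (_ : \sum_(t < n) (psi t.+1 - psi t) <= _).
  by apply: ler_sum => t _; exact: step.
rewrite -(big_mkord xpredT (fun t => psi t.+1 - psi t)) telescope_sumr //.
have h1 : psi n <= L + h by rewrite /psi ge_min lexx orbT.
have h2 : - L <= psi 0 by rewrite /psi le_min le_max lexx orbT /=; lra.
lra.
Qed.

Lemma basisv_coord (z : T) (u : R) i j : (z + u *: basisv i) 0 j = z 0 j + u * (i == j)%:R.
Proof. by rewrite !mxE eqxx /= eq_sym. Qed.

Lemma boxed_ge0 s C L F : boxed s C L F -> 0 <= C.
Proof. by move=> /(_ x0 (fun _ _ => erefl))[h _]; apply: le_trans h. Qed.

Lemma rsum_boxed h b n i s C L F : 0 < h <= 1 -> 0 <= L -> i \notin s ->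
  boxed (i :: s) C L F -> boxed s (C * (2 * L + 1)) L (rsum h b n i F).
Proof.
move=> /andP[h0 h1] L0 ns bF z sz; have C0 := boxed_ge0 bF.
pose y (t : 'I_n) := z + (h * t%:R + b) *: basisv i.
have yj t j : j != i -> y t 0 j = z 0 j.
  by move=> ji; rewrite basisv_coord eq_sym (negPf ji) mulr0 addr0.
have sy t : slice (i :: s) (y t).
  by move=> j; rewrite inE negb_or => /andP[ji js]; rewrite yj // sz.
split; last first.
  move=> [j js jL]; rewrite /rsum big1 ?mulr0 // => t _.
  apply: (bF _ (sy t)).2; exists j; first by rewrite inE js orbT.
  by rewrite yj //; apply: contraNneq ns => <-.
rewrite /rsum normrM gtr0_norm //.
apply: le_trans (_ : h * \sum_(t < n) C * (`|(z 0 i + b - x0 0 i) + h * t%:R| <= L)%R%:R <= _).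
  rewrite ler_pM2l //; apply: le_trans (ler_norm_sum _ _ _) _.
  apply: ler_sum => t _; have [|tL] := boolP (_ <= L).
    by rewrite mulr1 => _; exact: (bF _ (sy t)).1.
  rewrite mulr0 (bF _ (sy t)).2 ?normr0 //; exists i; first exact: mem_head.
  rewrite basisv_coord eqxx mulr1 ltNge; apply: contra tL.
  by rewrite (_ : _ - _ = z 0 i + b - x0 0 i + h * t%:R) //; ring.
rewrite -mulr_sumr mulrCA ler_wpM2l //.
by apply: le_trans (grid_count _ _ h0 L0) _; rewrite lerD2l.
Qed.

Lemma rsums_boxed h b n s C L F : 0 < h <= 1 -> 0 <= L -> uniq s ->
  boxed s C L F -> `|rsums h b n s F x0| <= C * (2 * L + 1) ^+ size s.
Proof.
move=> h01 L0; elim: s C F => [|i s IH] C F /=.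
  by move=> _ /(_ x0 (fun _ _ => erefl))[Fx _]; rewrite expr0 mulr1.
move=> /andP[ns us] bF; rewrite exprS mulrA; apply: IH => //.
exact: rsum_boxed.
Qed.

Lemma rsums_slice h b n s F G : 0 < h <= 1 -> uniq s ->
  (forall z, slice s z -> F z = G z) -> rsums h b n s F x0 = rsums h b n s G x0.
Proof.
move=> h01 us FG; apply/eqP; rewrite -subr_eq0 -normr_le0.
have := @rsums_boxed h b n s 0 0 (fun z => -1 * G z + F z) h01 (lexx _) us.
rewrite rsums_lin mul0r mulN1r addrC; apply.
by move=> z sz; rewrite FG // mulN1r addNr normr0.
Qed.

Lemma rsum_half_le h n i F G : 0 <= h -> (forall z, `|F z| <= G z) ->
  forall z, `|rsum h 0 n i F z| <= rsum h (- (h * n%:R)) (n + n) i G z.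
Proof.
move=> h0 FG z; rewrite /rsum normrM ger0_norm // ler_wpM2l //.
rewrite big_split_ord /=; apply: le_trans (ler_norm_sum _ _ _) _.
apply: le_trans (_ : \sum_(t < n) G (z + (h * (n + t)%:R - h * n%:R) *: basisv i) <= _).
  apply: ler_sum => t _; rewrite natrD mulrDr addrAC subrr add0r addr0.
  exact: FG.
by rewrite lerDr sumr_ge0 // => t _; exact: le_trans (FG _).
Qed.

Lemma rsums_half_le h n s F G : 0 <= h -> (forall z, `|F z| <= G z) ->
  forall z, `|rsums h 0 n s F z| <= rsums h (- (h * n%:R)) (n + n) s G z.
Proof.
by move=> h0; elim: s F G => //= i s IH F G FG; apply: IH; exact: rsum_half_le.
Qed.

Lemma rsums_ge0 h b n s F z : 0 <= h -> (forall z, 0 <= F z) -> 0 <= rsums h b n s F z.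
Proof.
move=> h0; elim: s F z => //= i s IH F z F0; apply: IH => y.
by rewrite /rsum mulr_ge0 // sumr_ge0.
Qed.

(** Difference quotients telescope exactly on the grid, so the sum of a derivative is a boundary
    term plus the sum of this error, which is of order [h]. *)
Definition diff_error h i F : T -> R := fun z =>
  'D_(basisv i) F z - h^-1 * (F (z + h *: basisv i) - F z).

Lemma rsum_derive h b n i F y : h != 0 -> rsum h b n i ('D_(basisv i) F) y =
  rsum h b n i (diff_error h i F) y +
  (F (y + (h * n%:R + b) *: basisv i) - F (y + b *: basisv i)).
Proof.
move=> h0.
have -> : F (y + (h * n%:R + b) *: basisv i) - F (y + b *: basisv i) =
    \sum_(t < n) (F (y + (h * t.+1%:R + b) *: basisv i) -
                  F (y + (h * t%:R + b) *: basisv i)).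
  rewrite -(big_mkord xpredT (fun t => F (y + (h * t.+1%:R + b) *: basisv i) -
                  F (y + (h * t%:R + b) *: basisv i))).
  by rewrite (telescope_sumr (fun t => F (y + (h * t%:R + b) *: basisv i))) // mulr0 add0r.
rewrite /rsum !mulr_sumr -big_split; apply: eq_bigr => t _ /=.
have -> : y + (h * t.+1%:R + b) *: basisv i =
    y + (h * t%:R + b) *: basisv i + h *: basisv i.
  by rewrite -addrA -scalerDl -natr1; congr (_ + _ *: _); ring.
by rewrite /diff_error mulrBr mulrA mulfV // mul1r subrK.
Qed.

Definition csupp F := rsmooth F /\ exists2 L, 0 <= L &
  forall z : T, (exists j, L < `|z 0 j - x0 0 j|) -> F z = 0.

Definition bsupp F := exists C L : R, [/\ 0 <= L, forall z, `|F z| <= C &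
  forall z : T, (exists j, L < `|z 0 j - x0 0 j|) -> F z = 0].

Lemma csupp_bounded F : csupp F -> exists2 C, 0 <= C & forall z, `|F z| <= C.
Proof.
move=> [sF [L L0 FL]]; pose K := [set z : T | `|z - x0| <= L].
have cK : compact K.
  apply: bounded_closed_compact.
    exists (L + `|x0|); split; first exact: num_real.
    move=> M LM z zK /=; apply/ltW/(le_lt_trans _ LM).
    by rewrite -[z](subrK x0); apply: le_trans (ler_normD _ _) _; rewrite lerD2r.
  apply: (@closed_comp _ R^o (fun z : T => `|z - x0|) [set r : R | r <= L]).
    by move=> z _; exact: (cvg_norm (cvgB cvg_id (cvg_cst x0))).
  exact: closed_le.
have [M [_ MP]] : bounded_set (F @` K).
  apply: compact_bounded; apply: continuous_compact => //.
  exact/continuous_subspaceT/rsmooth_continuous.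
have FM z : `|F z| <= `|M| + 1.
  have [zK|nzK] := pselect (K z).
    have M1 : M < `|M| + 1 by rewrite (le_lt_trans (ler_norm M)) // ltrDl.
    by apply: (MP _ M1); exists z.
  rewrite FL ?normr0 ?addr_ge0 //; apply: contrapT => /forallNP h; apply: nzK.
  rewrite /K /= /Num.norm /= mx_normrE; apply/bigmax_leP; split=> // -[i j] _ /=.
  by rewrite (ord1 i) !mxE leNgt; apply/negP; exact: h.
by exists (`|M| + 1) => //; rewrite addr_ge0.
Qed.

Lemma csupp_derive F i : csupp F -> csupp ('D_(basisv i) F).
Proof.
move=> [sF [L L0 FL]]; split; first exact: rsmooth_derive.
exists L => // z [j zj].
have : \forall y \near z, F y = 0.
  apply/nbhs_ballP; exists (`|z 0 j - x0 0 j| - L); first by rewrite /= subr_gt0.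
  move=> y; rewrite -ball_normE /ball_ /= => zy; apply: FL; exists j.
  have h1 : `|z 0 j - y 0 j| < `|z 0 j - x0 0 j| - L.
    by have := coord_le_norm (z - y) j; rewrite !mxE => /le_lt_trans; exact.
  have := ler_distD (y 0 j) (z 0 j) (x0 0 j); lra.
move=> /(rpartials_near0 [:: i]) /nbhs_singleton.
by [].
Qed.

Lemma csupp_partials F s : csupp F -> csupp (rpartials s F).
Proof. by move=> cF; elim: s => //= i s; exact: csupp_derive. Qed.

Lemma csupp_bsupp F : csupp F -> bsupp F.
Proof.
by move=> cF; have [C _ CP] := csupp_bounded cF; case: cF => _ [L L0 LP]; exists C, L.
Qed.

Lemma diff_error_boxed F i : csupp F -> exists C L, 0 <= L /\
  forall h s, 0 < h <= 1 -> boxed s (C * h) L (diff_error h i F).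
Proof.
move=> cF; have [C C0 CP] := csupp_bounded (csupp_partials [:: i; i] cF).
have [sF [L L0 FL]] := cF.
have [_ [L' L'0 FL']] := csupp_derive i cF.
exists C, (L + L' + 1); split; first by rewrite !addr_ge0.
move=> h s /andP[h0 h1] z _; split.
  have := @taylor_line _ _ F z (basisv i) h C
    (fun y => @rsmooth_derivable _ _ F i y sF)
    (fun y => @rsmooth_derivable _ _ _ i y (rsmooth_derive i sF)) (fun c _ => CP _).
  move=> tl; rewrite -(ler_pM2l h0) -{1}(gtr0_norm h0) -normrM.
  rewrite (_ : h * diff_error h i F z =
    - (F (z + h *: basisv i) - F z - h * 'D_(basisv i) F z)).
    by rewrite normrN (_ : h * (C * h) = C * h ^+ 2) //; ring.
  by rewrite /diff_error; field; rewrite gt_eqF.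
move=> [j _ jL]; rewrite /diff_error FL'; last by exists j; lra.
rewrite (FL z); last by exists j; lra.
rewrite FL ?subrr ?mulr0 ?subr0 //; exists j; rewrite basisv_coord.
have hb : `|h * (i == j)%:R| <= 1.
  by rewrite normrM gtr0_norm //; case: (i == j); rewrite ?normr1 ?normr0 ?mulr1 ?mulr0.
have := ler_distD (z 0 j + h * (i == j)%:R) (z 0 j) (x0 0 j).
rewrite opprD addNKr normrN; lra.
Qed.


Section Integral.

(** With this mesh and [M k] nodes the grid reaches to distance [k + 1], beyond any given support,
    while the mesh tends to 0. *)
Let h (k : nat) : R := k.+1%:R^-1.
Let M (k : nat) : nat := (k.+1 * k.+1)%N.

Let h01 k : 0 < h k <= 1.
Proof. by rewrite invr_gt0 ltr0n /= invf_le1 ?ler1n. Qed.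

Let h0 k : h k != 0. Proof. by case/andP: (h01 k) => /lt0r_neq0. Qed.

Let hM k : h k * (M k)%:R = k.+1%:R.
Proof. by rewrite /h /M natrM mulrA mulVf ?mul1r // pnatr_eq0. Qed.

Let cvg_h (C : R) : (C * h k @[k --> \oo] --> (0 : R)).
Proof.
rewrite -(mulr0 C); apply: cvgM; first exact: cvg_cst.
exact: cvg_harmonic.
Qed.

Let half_sum k s F : R := rsums (h k) 0 (M k) s F x0.
Let full_sum k F : R := rsums (h k) (- (h k * (M k)%:R)) (M k + M k) (enum 'I_d) F x0.

Let full_sum_derive F i : csupp F ->
  full_sum k ('D_(basisv i) F) @[k --> \oo] --> (0 : R).
Proof.
move=> cF; have [C [L [L0 eb]]] := diff_error_boxed i cF.
have [sF [L' L'0 FL']] := cF.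
pose D := C * (2 * L + 1) ^+ size (enum 'I_d).
apply/norm_cvg0P.
apply: (@squeeze_cvgr _ _ _ _ (fun=> 0) (fun k => D * h k)); [|exact: cvg_cst|exact: cvg_h].
exists (Num.truncn L') => // k /= Lk.
have Lk' : L' < k.+1%:R.
  by apply: lt_le_trans (truncnS_gt _) _; rewrite ler_nat ltnS.
rewrite normr_ge0 /= /full_sum.
have pe : perm_eq (enum 'I_d) (i :: rem i (enum 'I_d)).
  by apply: perm_to_rem; rewrite mem_enum.
have ue := enum_uniq 'I_d.
have ns : i \notin rem i (enum 'I_d) by rewrite mem_rem_uniqF.
have us : uniq (rem i (enum 'I_d)) by exact: rem_uniq.
rewrite (rsums_perm _ _ _ _ pe) /= -/(rsums _ _ _ _ _).
rewrite (@rsums_slice _ _ _ _ _ (rsum (h k) (- (h k * (M k)%:R)) (M k + M k) i (diff_error (h k) i F))) //.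
  rewrite -[X in `|X|]/(rsums (h k) _ _ (i :: rem i (enum 'I_d)) _ x0).
  rewrite -(rsums_perm _ _ _ _ pe) /D mulrAC.
  by apply: rsums_boxed => //; exact: eb.
move=> z sz; rewrite rsum_derive //.
have zi : z 0 i = x0 0 i by rewrite sz.
rewrite !FL' ?subrr ?addr0 //; exists i; rewrite basisv_coord eqxx mulr1 zi addrAC subrr add0r hM.
  by rewrite normrN normr_nat.
by rewrite natrD mulrDr hM addrK normr_nat.
Qed.

(** The fundamental theorem of calculus on a half-line, once in each direction; the sign is that of
    the lower endpoint. *)
Let half_sum_partials F s : csupp F -> uniq s ->
  half_sum k s (rpartials s F) @[k --> \oo] --> (-1) ^+ size s * F x0.
Proof.
move=> cF; elim: s => [|i s IH] /=.
  by move=> _; rewrite /half_sum /= mul1r; exact: cvg_cst.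
move=> /andP[ns us].
have cG := csupp_partials s cF; set G := rpartials s F in cG IH.
have [C [L [L0 eb]]] := diff_error_boxed i cG.
have [sG [L' L'0 GL']] := cG.
rewrite exprS -mulrA mulN1r.
have E : \forall k \near \oo, half_sum k (i :: s) (diff_error (h k) i G) - half_sum k s G
    = half_sum k (i :: s) ('D_(basisv i) G).
  exists (Num.truncn L') => // k /= Lk.
  have Lk' : L' < k.+1%:R.
    by apply: lt_le_trans (truncnS_gt _) _; rewrite ler_nat ltnS.
  have := congr1 (fun f => f x0) (rsums_lin (h k) 0 (M k) s (-1) G
     (rsum (h k) 0 (M k) i (diff_error (h k) i G))) => /=.
  rewrite mulN1r addrC /half_sum /= => <-.
  apply: rsums_slice => // z sz; rewrite rsum_derive // mulN1r addrC.
  have zi : z 0 i = x0 0 i by rewrite sz.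
  rewrite scale0r [z + 0]addr0 [G (z + _ *: _)]GL' ?sub0r //; exists i.
  by rewrite basisv_coord eqxx mulr1 zi addrAC subrr add0r hM addr0 normr_nat.
apply: cvg_trans (near_eq_cvg E) _.
rewrite -(sub0r (_ * F x0)); apply: cvgB; last exact: IH.
apply/norm_cvg0P.
pose D := C * (2 * L + 1) ^+ size (i :: s).
apply: (@squeeze_cvgr _ _ _ _ (fun=> 0) (fun k => D * h k)); [|exact: cvg_cst|exact: cvg_h].
near=> k; rewrite normr_ge0 /= /D mulrAC; apply: rsums_boxed => //=; first exact/andP.
exact: eb.
Unshelve. all: by end_near. Qed.

Let bsupp_full F : bsupp F -> exists C, forall k, `|full_sum k F| <= C.
Proof.
move=> [C [L [L0 FC FL]]]; exists (C * (2 * L + 1) ^+ size (enum 'I_d)) => k.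
apply: rsums_boxed => //; first exact: enum_uniq.
by move=> z _; split=> // -[j _ jL]; apply: FL; exists j.
Qed.

Lemma bsupp_lin (a : R) F G : bsupp F -> bsupp G -> bsupp (fun z => a * F z + G z).
Proof.
move=> [C [L [L0 FC FL]]] [C' [L' [L'0 GC GL]]].
exists (`|a| * C + C'), (L + L'); split; first exact: addr_ge0.
  move=> z; apply: le_trans (ler_normD _ _) _; rewrite normrM lerD //.
  exact: ler_wpM2l.
move=> z [j zj]; rewrite FL; last by exists j; lra.
by rewrite GL; [rewrite mulr0 addr0|exists j; lra].
Qed.

(* The limit of Riemann sums along an ultrafilter: its values on nonsmooth
   functions depend on the ultrafilter, but only the five properties below are
   needed. *)
Lemma integral_exists : exists I : (T -> R) -> R,
  [/\ forall (a : R) F G, bsupp F -> bsupp G ->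
        I (fun z => a * F z + G z) = a * I F + I G,
      forall F, bsupp F -> (forall z, 0 <= F z) -> 0 <= I F,
      forall F i, csupp F -> I ('D_(basisv i) F) = 0,
      forall F (C L : R), 0 <= L -> (forall z, `|F z| <= C) ->
        (forall z : T, (exists j, L < `|z 0 j - x0 0 j|) -> F z = 0) ->
        `|I F| <= C * (2 * L + 1) ^+ d &
      forall F G, csupp F -> bsupp G ->
        (forall z, `|rpartials (enum 'I_d) F z| <= G z) -> `|F x0| <= I G].
Proof.
have [U [UU oU]] := ultraFilterLemma (F := \oo) _.
have cvgU (u : nat -> R) (C : R) : (forall k, `|u k| <= C) -> cvg (u @ U).
  move=> uC.
  have UuU : UltraFilter (u @ U).
    split=> [|G PG uG]; first exact: fmap_proper_filter.
    apply/seteqP; split=> // A GA.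
    have [//|nA] := in_ultra_setVsetC (u @^-1` A) UU.
    have /filter_ex[t [//]] : G (A `&` ~` A) by apply: filterI => //; exact: uG.
  have uU : U (u @^-1` `[- C, C]%classic).
    by apply: filterS filterT => k _ /=; have := uC k; rewrite in_itv ler_norml.
  have : compact `[- C, C]%classic by exact: segment_compact.
  by rewrite compact_ultra => /(_ _ UuU uU)[p [_ up]]; exact: cvgP up.
pose I F := lim (full_sum k F @[k --> U]).
have Icvg F : bsupp F -> cvg (full_sum k F @[k --> U]).
  by move=> /bsupp_full[C FC]; exact: cvgU FC.
have Ilim (u : nat -> R) (l : R) : u @ \oo --> l -> u @ U --> l.
  by move=> ul A /ul; exact: oU.
exists I; split.
- move=> a F G bF bG; apply: cvg_lim => //.
  rewrite /full_sum (_ : (fun k => _) = fun k => a * full_sum k F + full_sum k G); last first.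
    by apply/funext => k; rewrite rsums_lin.
  apply: cvgD; last exact: Icvg.
  by apply: cvgM; [exact: cvg_cst|exact: Icvg].
- move=> F bF F0; apply: limr_ge; first exact: Icvg.
  by apply: nearW => k; apply: rsums_ge0 => //; case/andP: (h01 k) => /ltW.
- by move=> F i cF; apply: cvg_lim => //; apply: Ilim; exact: full_sum_derive.
- move=> F C L L0 FC FL.
  have bF : bsupp F by exists C, L.
  rewrite -lim_norm; last exact: Icvg.
  apply: limr_le; first by apply: is_cvg_norm; exact: Icvg.
  have -> : (2 * L + 1) ^+ d = (2 * L + 1) ^+ size (enum 'I_d) by rewrite size_enum_ord.
  apply: nearW => k.
  apply: rsums_boxed => //; first exact: enum_uniq.
  by move=> z _; split=> // -[j _ jL]; apply: FL; exists j.
- move=> F G cF bG FG.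
  have cl := Ilim _ _ (half_sum_partials cF (enum_uniq 'I_d)).
  have -> : `|F x0| = lim (`|half_sum k (enum 'I_d) (rpartials (enum 'I_d) F)| @[k --> U]).
    apply/esym/cvg_lim => //; rewrite -[`|F x0|]mul1r.
    have -> : 1 = `|(-1) ^+ size (enum 'I_d)| :> R by rewrite normrX normrN1 expr1n.
    by rewrite -normrM; exact: cvg_norm cl.
  apply: ler_lim; [|exact: Icvg|].
    by apply: is_cvg_norm; exact: cvgP cl.
  by apply: nearW => k; apply: rsums_half_le => //; case/andP: (h01 k) => /ltW.
Qed.

End Integral.

End RiemannSums.

(** * The Hahn-Banach theorem *)

Section HahnBanach.
Context {R : realType} {V : lmodType R[i]} (p : V -> R).
Hypothesis pD : forall u v, p (u + v) <= p u + p v.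
Hypothesis pZ : forall (a : R) u, 0 <= a -> p (a%:C *: u) = a * p u.

(* A real-linear relation below the graph of [p]; it is automatically
   functional, see [dominated_functional]. *)
Let dominated (G : set (V * R)) :=
  (forall (a : R) x y, G x -> G y -> G (a%:C *: x.1 + y.1, a * x.2 + y.2)) /\
  (forall x, G x -> x.2 <= p x.1).

Let dominated_functional G v r t : dominated G -> G (v, r) -> G (v, t) -> r = t.
Proof.
move=> [lG dG].
have key x y : G (v, x) -> G (v, y) -> x <= y.
  move=> Gx Gy; have := dG _ (lG (-1) _ _ Gy Gx) => /=.
  rewrite rmorphN rmorph1 scaleN1r addNr.
  have -> : p 0 = 0 by rewrite -(scale0r 0) (pZ 0) // mul0r.
  by rewrite mulN1r addrC subr_le0.
by move=> Gr Gt; apply/eqP; rewrite eq_le !key.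
Qed.

(** The value at [v0] has to lie between all [x.2 - p (x.1 - v0)] and all [p (y.1 + v0) - y.2], and
    subadditivity of [p] leaves room for it. *)
Let dominated_extend G v0 : dominated G -> G (0, 0) ->
  exists2 H, dominated H & G `<=` H /\ exists c, H (v0, c).
Proof.
move=> [lG dG] G0.
pose S := [set x.2 - p (x.1 - v0) | x in G].
have lin1 x y : G x -> G y -> G (x.1 + y.1, x.2 + y.2).
  by move=> Gx Gy; have := lG 1 x y Gx Gy; rewrite scale1r mul1r.
have linZ a x : G x -> G (a%:C *: x.1, a * x.2).
  by move=> Gx; have := lG a x (0, 0) Gx G0; rewrite !addr0.
have Sub y : G y -> ubound S (p (y.1 + v0) - y.2).
  move=> Gy _ [x Gx <-]; rewrite lerBlDr addrAC lerBrDr.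
  apply: le_trans (dG _ (lin1 _ _ Gx Gy)) _ => /=.
  rewrite (_ : x.1 + y.1 = (y.1 + v0) + (x.1 - v0)) ?pD//.
  by rewrite addrACA subrr addr0 addrC.
have supS : has_sup S.
  split; first by exists (0 - p (0 - v0)), (0, 0).
  by exists (p (0 + v0) - 0); exact: (Sub (0, 0)).
pose c := sup S.
have c_ge x : G x -> x.2 - p (x.1 - v0) <= c.
  by move=> Gx; apply: sup_upper_bound => //; exists x.
have c_le y : G y -> c <= p (y.1 + v0) - y.2.
  by move=> Gy; apply: ge_sup; [case: supS|exact: Sub].
pose H := [set z : V * R | exists x a, G x /\ z = (x.1 + a%:C *: v0, x.2 + a * c)].
exists H; last split.
- split.
    move=> a _ _ [x [b [Gx ->]]] [y [b' [Gy ->]]] /=.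
    exists (a%:C *: x.1 + y.1, a * x.2 + y.2), (a * b + b'); split; first exact: lG.
    congr (_, _) => /=; last by ring.
    by rewrite rmorphD rmorphM /= scalerDl scalerDr -scalerA addrACA.
  move=> _ [x [a [Gx ->]]] /=; have [a0|a0|a0] := ltgtP a 0.
  - have b0 : 0 < - a by rewrite oppr_gt0.
    have h := c_ge _ (linZ (- a)^-1 x Gx); rewrite /= in h.
    have -> : x.1 + a%:C *: v0 = (- a)%:C *: ((- a)^-1%:C *: x.1 - v0).
      rewrite scalerBr scalerA -rmorphM mulfV ?gt_eqF// scale1r.
      by rewrite rmorphN scaleNr opprK.
    rewrite (pZ _ (ltW b0)); move/(ler_wpM2l (ltW b0)): h.
    rewrite mulrBr mulrA mulfV ?gt_eqF// mul1r. lra.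
  - have h := c_le _ (linZ a^-1 x Gx); rewrite /= in h.
    have -> : x.1 + a%:C *: v0 = a%:C *: (a^-1%:C *: x.1 + v0).
      by rewrite scalerDr scalerA -rmorphM mulfV ?gt_eqF// scale1r.
    rewrite (pZ _ (ltW a0)); move/(ler_wpM2l (ltW a0)): h.
    rewrite mulrBr mulrA mulfV ?gt_eqF// mul1r. lra.
  - by rewrite a0 mul0r scale0r !addr0 dG.
- by move=> [v r] Gx; exists (v, r), 0; rewrite scale0r mul0r !addr0.
- by exists c, (0, 0), 1; rewrite scale1r mul1r !add0r.
Qed.

Lemma real_hahn_banach (G0 : set (V * R)) : dominated G0 -> G0 (0, 0) ->
  exists f : V -> R, [/\ forall (a : R) u v, f (a%:C *: u + v) = a * f u + f v,
    forall u, f u <= p u & forall x, G0 x -> f x.1 = x.2].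
Proof.
move=> dG0 G00.
(* The union of the empty chain is empty, so [G0] is joined to each set instead of being required as
   a subset. *)
have [|A [dA maxA]] := @Zorn_bigcup (V * R)%type [set A | dominated (G0 `|` A)].
  move=> F FP tot /=; split.
    move=> a x y.
    have [[H FH]|F0] := pselect (exists H, F H); last first.
      move=> [Gx|[H /=]]; last by move=> FH; case: F0; exists H.
      move=> [Gy|[H /=]]; last by move=> FH; case: F0; exists H.
      by left; apply: dG0.1.
    have in1 z : (G0 `|` \bigcup_(X in F) X) z -> exists2 X, F X & (G0 `|` X) z.
      by move=> [Gz|[X FX Xz]]; [exists H => //; left|exists X => //; right].
    have sub X : F X -> G0 `|` X `<=` G0 `|` \bigcup_(X in F) X.
      by move=> FX z [Gz|Xz]; [left|right; exists X].
    move=> /in1[X FX Xx] /in1[Y FY Yy].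
    have [XY|YX] := tot _ _ FX FY.
      by apply: (sub Y FY); apply: (FP _ FY).1 => //; case: Xx => [|/XY]; [left|right].
    by apply: (sub X FX); apply: (FP _ FX).1 => //; case: Yy => [|/YX]; [left|right].
  move=> x [/dG0.2//|[X FX Xx]].
  by apply: (FP _ FX).2; right.
set G := G0 `|` A in dA.
have GT v : exists r, G (v, r).
  apply: contrapT => nv.
  have [H dH [GH [c Hc]]] := dominated_extend v dA (or_introl G00).
  apply: (maxA H).
    split; first by move=> x Ax; apply: GH; right.
    by move=> HA; apply: nv; exists c; right; exact: HA.
  rewrite /= (_ : G0 `|` H = H) // setUidr // => x Gx.
  by apply: GH; left.
have [f fG] := choice GT.
exists f; split.
- move=> a u v; apply: (dominated_functional dA (fG _)).
  exact: (dA.1 a _ _ (fG u) (fG v)).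
- by move=> u; exact: (dA.2 _ (fG u)).
- move=> [u r] G0u /=; apply: (dominated_functional dA (fG _)).
  by left.
Qed.

End HahnBanach.

(** [T] may fail to be injective: the values of [e] over those of [T] form a relation, and
    domination by [p] makes it functional. *)
Lemma hahn_banach (R : realType) (V U : lmodType R[i]) (p : V -> R)
    (T : U -> V) (e : U -> R[i]) :
  (forall u v, p (u + v) <= p u + p v) ->
  (forall (a : R[i]) u, p (a *: u) = Normc.normc a * p u) ->
  linear T -> linear (e : U -> R[i]^o) ->
  (forall f, Normc.normc (e f) <= p (T f)) ->
  exists u : V -> R[i], [/\ linear (u : V -> R[i]^o),
    forall v, Normc.normc (u v) <= p v & forall f, u (T f) = e f].
Proof.
move=> pD pZ lT le ep.
have normcR (a : R) : 0 <= a -> Normc.normc a%:C = a.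
  by move=> a0; rewrite /Normc.normc /= expr0n addr0 sqrtr_sqr ger0_norm.
have Re_le (z : R[i]) : complex.Re z <= Normc.normc z.
  case: z => x y; rewrite /Normc.normc /=; apply: le_trans (ler_norm x) _.
  by rewrite -sqrtr_sqr ler_wsqrtr // lerDl sqr_ge0.
have T0 : T 0 = 0 by have := lT (-1) 0 0; rewrite scaler0 addr0 scaleN1r addNr.
have e0 : e 0 = 0 by have := le (-1) 0 0; rewrite scaler0 addr0 scaleN1r addNr.
have p0 v : 0 <= p v.
  have := pD v (-1 *: v); rewrite pZ scaleN1r subrr -(scale0r 0) pZ.
  have -> : Normc.normc (-1 : R[i]) = 1.
    by rewrite /Normc.normc /= sqrrN expr1n oppr0 expr0n addr0 sqrtr1.
  by rewrite Normc.normc0 mul0r mul1r -mulr2n pmulrn_lge0.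
pose G0 := [set (T f, complex.Re (e f)) | f in [set: U]].
have [|||f [lf fp fG]] := @real_hahn_banach R V p pD _ G0.
- by move=> a u a0; rewrite pZ normcR.
- split.
    move=> a _ _ [u _ <-] [v _ <-] /=; exists (a%:C *: u + v) => //.
    rewrite lT le; congr (_, _); case: (e u) (e v) => x y [x' y'] /=.
    by rewrite mul0r subr0.
  by move=> _ [u _ <-] /=; exact: le_trans (Re_le _) (ep u).
- by exists 0 => //; rewrite T0 e0.
pose I : R[i] := 0 +i* 1.
(* A complex linear form is determined by its real part in this way. *)
pose u v := f v +i* - f (I *: v).
have fI v : f (I *: (I *: v)) = - f v.
  have f0 : f 0 = 0 by have := lf (-1) 0 0; rewrite scaler0 addr0 mulN1r addNr.
  have -> : I *: (I *: v) = (-1)%:C *: v + 0.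
    rewrite addr0 scalerA; congr (_ *: _); apply/eqP.
    by rewrite eq_complex /=; apply/andP; split; apply/eqP; ring.
  by rewrite lf f0 addr0 mulN1r.
have fZ (x y : R) v : f ((x +i* y) *: v) = x * f v + y * f (I *: v).
  have f0 : f 0 = 0 by have := lf (-1) 0 0; rewrite scaler0 addr0 mulN1r addNr.
  have -> : (x +i* y) *: v = x%:C *: v + (y%:C *: (I *: v) + 0).
    rewrite addr0 scalerA -scalerDl; congr (_ *: _); apply/eqP.
    by rewrite eq_complex /=; apply/andP; split; apply/eqP; ring.
  by rewrite lf lf f0 addr0.
have fD v w : f (v + w) = f v + f w by have := lf 1 v w; rewrite scale1r mul1r.
have lu : linear (u : V -> R[i]^o).
  move=> [x y] v w; apply/eqP; rewrite eq_complex /u /= scalerDr !fD (fZ x y v).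
  rewrite (_ : I *: ((x +i* y) *: v) = (x +i* y) *: (I *: v)); last by rewrite !scalerA mulrC.
  by rewrite (fZ x y (I *: v)) fI; apply/andP; split; apply/eqP; ring.
exists u; split=> //.
- move=> v; set z := u v; set r := Normc.normc z.
  have [z0|z0] := eqVneq r 0; first by rewrite z0.
  have r0 : 0 < r by rewrite lt_neqAle eq_sym z0 normc_ge0.
  rewrite -(ler_pM2l r0).
  have nJ : Normc.normc (complex.Re z -i* complex.Im z) = r.
    by rewrite /r; case: z {z0 r r0} => x y; rewrite /Normc.normc /= sqrrN.
  (* Multiplying [v] by the conjugate of [z] makes the value of [u] real and equal to the square of
     [r], so the bound on the real part applies. *)
  apply: le_trans (_ : f ((complex.Re z -i* complex.Im z) *: v) <= _).
    have -> : f ((complex.Re z -i* complex.Im z) *: v) =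
        complex.Re (u ((complex.Re z -i* complex.Im z) *: v)) by [].
    have u0 : u 0 = 0 by have := lu (-1) 0 0; rewrite scaler0 addr0 scaleN1r addNr.
    have := lu (complex.Re z -i* complex.Im z) v 0; rewrite !addr0 u0 => ->.
    rewrite -/z /r /Normc.normc; case: z {nJ r r0 z0} => x y.
    rewrite -expr2 sqr_sqrtr ?addr_ge0 ?sqr_ge0//= addr0 mulNr opprK.
    by rewrite !expr2.
  by apply: le_trans (fp _) _; rewrite pZ nJ.
- move=> v; have fT w : f (T w) = complex.Re (e w).
    by rewrite (fG (T w, complex.Re (e w))) //; exists w.
  rewrite /u fT (_ : I *: T v = T (I *: v)); last first.
    by have := lT I v 0; rewrite !addr0 T0 addr0.
  rewrite fT; have := le I v 0; rewrite !addr0 e0 => ->.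
  by case: (e v) => x y /=; rewrite addr0 mul0r mul1r sub0r opprK.
Qed.

(** * Fundamental solutions *)

Section TestFunctionOperators.
Context {R : realType} {d : nat} {X : set 'rV[R]_d}.
Implicit Types (f g : testfun X) (s t : seq 'I_d) (c : R[i]).

Definition repart f : 'rV[R]_d -> R := fun z => complex.Re (f z).
Definition impart f : 'rV[R]_d -> R := fun z => complex.Im (f z).

Lemma repart_smooth f : rsmooth (repart f).
Proof. by case: (testfunP f) => -[sf _] _ _; exact: sf. Qed.

Lemma impart_smooth f : rsmooth (impart f).
Proof. by case: (testfunP f) => -[_ sf] _ _; exact: sf. Qed.

Lemma testfun_eqP f g : repart f = repart g -> impart f = impart g -> f = g.
Proof.
move=> rfg ifg; apply: val_inj; apply/funext => z /=.
have := congr1 (@^~ z) rfg; have := congr1 (@^~ z) ifg.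
by rewrite /repart /impart; case: (testfun_fun f z) (testfun_fun g z) => a b [a' b'] /= -> ->.
Qed.

Lemma repart_lin c f g : repart (c *: f + g) = fun z =>
  complex.Re c * repart f z + (- complex.Im c * impart f z + repart g z).
Proof.
apply/funext => z; rewrite /repart /impart testfunD testfunZ.
by case: c (f z) (g z) => a b [u v] [u' v'] /=; ring.
Qed.

Lemma impart_lin c f g : impart (c *: f + g) = fun z =>
  complex.Re c * impart f z + (complex.Im c * repart f z + impart g z).
Proof.
apply/funext => z; rewrite /repart /impart testfunD testfunZ.
by case: c (f z) (g z) => a b [u v] [u' v'] /=; ring.
Qed.

Lemma repart_partials s f : repart (testpartials s f) = rpartials s (repart f).
Proof. by []. Qed.

Lemma impart_partials s f : impart (testpartials s f) = rpartials s (impart f).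
Proof. by []. Qed.

Lemma testpartials_lin s : linear (@testpartials R d X s).
Proof.
move=> c f g; have [sf sg] := (repart_smooth f, repart_smooth g).
have [tf tg] := (impart_smooth f, impart_smooth g).
apply: testfun_eqP.
  rewrite (repart_lin c (testpartials s f) (testpartials s g)).
  rewrite (repart_partials s (c *: f + g)) (repart_lin c f g).
  rewrite (rpartials_lin s _ sf (rsmooth_lin _ tf sg)).
  by rewrite (rpartials_lin s _ tf sg).
rewrite (impart_lin c (testpartials s f) (testpartials s g)).
rewrite (impart_partials s (c *: f + g)) (impart_lin c f g).
rewrite (rpartials_lin s _ tf (rsmooth_lin _ sf tg)).
by rewrite (rpartials_lin s _ sf tg).
Qed.

HB.instance Definition _ s :=
  GRing.isLinear.Build R[i] (testfun X) (testfun X) _ (testpartials s)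
    (testpartials_lin s).

Lemma testpartials_cat s t f :
  testpartials s (testpartials t f) = testpartials (s ++ t) f.
Proof.
by apply: testfun_eqP; rewrite ?(repart_partials, impart_partials) rpartials_cat.
Qed.

Lemma testpartials_perm s t f : perm_eq s t -> testpartials s f = testpartials t f.
Proof.
move=> st; apply: testfun_eqP; rewrite ?(repart_partials, impart_partials).
  exact: rpartials_perm (repart_smooth f) st.
exact: rpartials_perm (impart_smooth f) st.
Qed.

Lemma testpartialsC s t f :
  testpartials s (testpartials t f) = testpartials t (testpartials s f).
Proof. by rewrite !testpartials_cat; apply: testpartials_perm; rewrite perm_catC. Qed.

Lemma testpartials_nil f : testpartials [::] f = f.
Proof. exact: testfun_eqP. Qed.

Lemma iter_testpartials k l f :
  iter k (testpartials [:: l]) f = testpartials (nseq k l) f.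
Proof.
elim: k => [|k IH]; first by rewrite testpartials_nil.
by rewrite iterS IH testpartials_cat.
Qed.

Lemma is_testfun_mulcoord l f : is_testfun X (fun z : 'rV[R]_d => (z 0 l)%:C * f z).
Proof.
have [_ cf fX] := testfunP f.
have sub : supp (fun z : 'rV[R]_d => (z 0 l)%:C * f z) `<=` supp f.
  by apply: closure_subset => z /=; apply: contra => /eqP ->; rewrite mulr0.
split.
- split.
    rewrite (_ : (fun _ => _) = fun z : 'rV[R]_d => z 0 l * repart f z).
      apply: smooth_alg_rsmooth; apply: smooth_alg_mul; first exact: smooth_alg_coord.
      exact/smooth_alg_base/repart_smooth.
    by apply/funext => z; rewrite /repart; case: (f z) => a b /=; ring.
  rewrite (_ : (fun _ => _) = fun z : 'rV[R]_d => z 0 l * impart f z).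
    apply: smooth_alg_rsmooth; apply: smooth_alg_mul; first exact: smooth_alg_coord.
    exact/smooth_alg_base/impart_smooth.
  by apply/funext => z; rewrite /impart; case: (f z) => a b /=; ring.
- by apply: subclosed_compact cf sub; exact: closed_closure.
- exact: subset_trans sub fX.
Qed.

Definition mulcoord l f : testfun X := TestFun (asboolT (is_testfun_mulcoord l f)).

Lemma repart_mulcoord l f : repart (mulcoord l f) = fun z : 'rV[R]_d => z 0 l * repart f z.
Proof.
by apply/funext => z; rewrite /repart /=; case: (testfun_fun f z) => a b /=; ring.
Qed.

Lemma impart_mulcoord l f : impart (mulcoord l f) = fun z : 'rV[R]_d => z 0 l * impart f z.
Proof.
by apply/funext => z; rewrite /impart /=; case: (testfun_fun f z) => a b /=; ring.
Qed.

Lemma mulcoordD l f g : mulcoord l (f + g) = mulcoord l f + mulcoord l g.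
Proof.
by apply: val_inj; apply/funext => z /=; rewrite mulrDr.
Qed.

Lemma testpartials_mulcoord i l f :
  testpartials [:: i] (mulcoord l f) =
  f *+ (l == i) + mulcoord l (testpartials [:: i] f).
Proof.
have key (u : 'rV[R]_d -> R) : rsmooth u ->
    rpartials [:: i] (fun z : 'rV[R]_d => z 0 l * u z) =
    fun z => (l == i)%:R * u z + z 0 l * rpartials [:: i] u z.
  move=> su; apply/funext => z /=.
  have sc : rsmooth (fun z : 'rV[R]_d => z 0 l).
    exact/smooth_alg_rsmooth/smooth_alg_coord.
  rewrite (deriveMx i z sc su).
  by case: (is_derive_coord l i z) => _ ->.
have E : f *+ (l == i) = (l == i)%:R%:C *: f.
  by case: (l == i); rewrite ?mulr1n ?scale1r // mulr0n scale0r.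
apply: testfun_eqP; rewrite E.
  rewrite repart_lin repart_partials !repart_mulcoord key //; last exact: repart_smooth.
  by apply/funext => z /=; rewrite oppr0 mul0r add0r.
rewrite impart_lin impart_partials !impart_mulcoord key //; last exact: impart_smooth.
by apply/funext => z /=; rewrite mul0r add0r.
Qed.

End TestFunctionOperators.

(** * The weighted scalar product on test functions *)

Section Form.
Context {R : realType} {d : nat} (x0 : 'rV[R]_d) (l : 'I_d).
Local Notation V := (testfun (setT : set 'rV[R]_d)).
Implicit Types (f g : V) (s t : seq 'I_d).

Definition weight (z : 'rV[R]_d) : R := expR (z 0 l * z 0 l).

Lemma weight_ge1 z : 1 <= weight z.
Proof. by rewrite -expR0 ler_expR -expr2 sqr_ge0. Qed.

Lemma weight_smooth : rsmooth weight.
Proof.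
apply: smooth_alg_rsmooth; apply: (@smooth_alg_comp _ _ (fun=> expR) 0).
  by move=> k t; exact: is_derive_expR.
by apply: smooth_alg_mul; exact: smooth_alg_coord.
Qed.

Lemma derive_weight i z :
  'D_(basisv i) weight z = 2 * (l == i)%:R * z 0 l * weight z.
Proof.
have d1 := is_deriveM (is_derive_coord l i z) (is_derive_coord l i z).
have : is_derive z (basisv i) weight (expR (z 0 l * z 0 l) *
    (z 0 l *: (l == i)%:R + z 0 l *: (l == i)%:R)).
  exact: (@is_derive_comp1 _ _ expR _ _ _ _ _ d1 (is_derive_expR _)).
by case=> _ ->; rewrite /weight /GRing.scale /=; ring.
Qed.

(** The real part of the weighted hermitian product; the abstract estimate works with a symmetric
    real bilinear form. *)
Definition density f g z : R :=
  weight z * (repart f z * repart g z + impart f z * impart g z).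

Lemma csuppM (F G : 'rV[R]_d -> R) : rsmooth G -> csupp x0 F ->
  csupp x0 (fun z => F z * G z).
Proof.
move=> sG [sF [L L0 FL]]; split; first exact: rsmoothM.
by exists L => // z /FL ->; rewrite mul0r.
Qed.

Lemma csuppD (F G : 'rV[R]_d -> R) : csupp x0 F -> csupp x0 G ->
  csupp x0 (fun z => F z + G z).
Proof.
move=> [sF [L L0 FL]] [sG [L' L'0 GL]]; split; first exact: rsmoothD.
exists (L + L'); first exact: addr_ge0.
by move=> z [j zj]; rewrite FL ?GL ?addr0 //; exists j; lra.
Qed.

Lemma supp_box (K : set 'rV[R]_d) : compact K -> exists2 L : R, 0 <= L &
  forall z : 'rV[R]_d, (exists j, L < `|z 0 j - x0 0 j|) -> ~ K z.
Proof.
move=> cK; have [M [_ MP]] := compact_bounded cK.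
exists (`|M| + 1 + `|x0|); first by rewrite !addr_ge0.
move=> z [j zj] Kz; have h1 : `|z| <= `|M| + 1.
  by apply: MP => //; rewrite (le_lt_trans (ler_norm M)) // ltrDl.
have := le_trans (coord_le_norm (z - x0) j) (ler_normB _ _).
by rewrite !mxE; lra.
Qed.

Lemma csupp_testfun f : csupp x0 (repart f) /\ csupp x0 (impart f).
Proof.
have [_ cf _] := testfunP f; have [L L0 LP] := supp_box cf.
have f0 (z : 'rV[R]_d) : (exists j, L < `|z 0 j - x0 0 j|) -> f z = 0.
  move=> /LP nf; apply/eqP; apply: contrapT => /negP fz; apply: nf.
  exact: subset_closure.
split; split; [exact: repart_smooth| |exact: impart_smooth|].
  by exists L => // z /f0 h; rewrite /repart h.
by exists L => // z /f0 h; rewrite /impart h.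
Qed.

Lemma csupp_density f g : csupp x0 (density f g).
Proof.
have [rf jf] := csupp_testfun f.
rewrite (_ : density f g = fun z =>
    (repart f z * repart g z + impart f z * impart g z) * weight z).
  apply: csuppM; first exact: weight_smooth.
  by apply: csuppD; apply: csuppM => //; [exact: repart_smooth|exact: impart_smooth].
by apply/funext => z; rewrite /density mulrC.
Qed.

Lemma bsupp_density f g : bsupp x0 (density f g).
Proof. exact/csupp_bsupp/csupp_density. Qed.

Lemma derive_density i f g z : 'D_(basisv i) (density f g) z =
  density (testpartials [:: i] f) g z +
  (density f (testpartials [:: i] g) z +
   (l == i)%:R * (2 * density f (mulcoord l g) z)).
Proof.
have [sf sg] := (repart_smooth f, repart_smooth g).
have [tf tg] := (impart_smooth f, impart_smooth g).
have s1 := rsmoothM sf sg; have s2 := rsmoothM tf tg.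
rewrite /density deriveMx; [|exact: weight_smooth|exact: rsmoothD].
rewrite deriveDx //.
rewrite !deriveMx // derive_weight repart_mulcoord impart_mulcoord.
rewrite !(repart_partials, impart_partials) /=; ring.
Qed.


End Form.

Lemma testpartialsZ (R : realType) (d : nat) (X : set 'rV[R]_d) (s : seq 'I_d)
  (c : R[i]) (f : testfun X) : testpartials s (c *: f) = c *: testpartials s f.
Proof.
have := testpartials_lin s c f 0; rewrite addr0 (raddf0 (testpartials s)).
by rewrite addr0.
Qed.

Lemma discriminant_le (R : rcfType) (a b c : R) : 0 <= a -> 0 <= c ->
  (forall t, 0 <= a + 2 * t * b + t ^+ 2 * c) -> b <= Num.sqrt a * Num.sqrt c.
Proof.
move=> a0 c0 quad; rewrite -sqrtrM //.
have [b0|b0] := leP b 0; first exact: le_trans b0 (sqrtr_ge0 _).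
rewrite -[leLHS](ger0_norm (ltW b0)) -sqrtr_sqr ler_wsqrtr //.
have [c_eq0|cn0] := eqVneq c 0.
  (* For [c = 0] the polynomial is affine, and its value at this point would be -1. *)
  have := quad (- (a + 1) / (2 * b)); rewrite c_eq0 mulr0 addr0.
  rewrite (_ : 2 * _ * b = - (a + 1)); first by lra.
  by field; rewrite gt_eqF.
have cp : 0 < c by rewrite lt_neqAle eq_sym cn0.
have := quad (- b / c); rewrite -(pmulr_rge0 _ cp).
rewrite (_ : c * _ = a * c - b ^+ 2) ?subr_ge0 //.
by field.
Qed.

Section SquareLeibniz.
Context {R : realType} {d : nat}.
Implicit Types (u : 'rV[R]_d -> R) (s : seq 'I_d).

(** The list [L] is the same for all [u]. Point values will be bounded through the mixed derivative
    of a square, whose Leibniz terms are controlled by [L^2] norms. *)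
Lemma rpartials_sqr s : exists L : seq (seq 'I_d * seq 'I_d),
  forall u, rsmooth u -> rpartials s (fun z => u z * u z) =
    fun z => \sum_(ab <- L) rpartials ab.1 u z * rpartials ab.2 u z.
Proof.
elim: s => [|i s [L IH]].
  by exists [:: ([::], [::])] => u su; apply/funext => z; rewrite big_seq1.
exists ([seq (i :: ab.1, ab.2) | ab <- L] ++ [seq (ab.1, i :: ab.2) | ab <- L]).
move=> u su; rewrite [LHS](_ : _ = 'D_(basisv i) (rpartials s (fun z => u z * u z))) //.
rewrite IH //; apply/funext => z; rewrite big_cat !big_map /= -big_split /=.
have sp ab : rsmooth (fun z => rpartials ab.1 u z * rpartials ab.2 u z).
  by apply: rsmoothM; exact: rsmooth_partials.
suff [] : rsmooth (fun z => \sum_(ab <- L) rpartials ab.1 u z * rpartials ab.2 u z) /\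
  'D_(basisv i) (fun z => \sum_(ab <- L) rpartials ab.1 u z * rpartials ab.2 u z) z =
  \sum_(ab <- L) (rpartials (i :: ab.1) u z * rpartials ab.2 u z +
    rpartials ab.1 u z * rpartials (i :: ab.2) u z) by [].
elim: L {IH} => [|ab L [sL IH]].
  rewrite (_ : (fun z => _) = fun=> 0); last by apply/funext => y; rewrite big_nil.
  by split; [exact: rsmooth_cst|rewrite big_nil derive_cst].
rewrite (_ : (fun z => _) = fun z => rpartials ab.1 u z * rpartials ab.2 u z +
    \sum_(ab <- L) rpartials ab.1 u z * rpartials ab.2 u z); last first.
  by apply/funext => y; rewrite big_cons.
split; first exact: (rsmoothD (sp ab) sL).
rewrite big_cons (deriveDx i z (sp ab) sL) IH; congr (_ + _).
exact: (deriveMx i z (rsmooth_partials ab.1 su) (rsmooth_partials ab.2 su)).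
Qed.

End SquareLeibniz.

(** * The a priori estimate for operators with constant coefficients *)

Section Estimate.
Context {R : realType} {d : nat} (x0 : 'rV[R]_d) (l : 'I_d).
Local Notation V := (testfun (setT : set 'rV[R]_d)).
Implicit Types (f g u v : V) (s t : seq 'I_d) (c : R[i]).

Context (I : ('rV[R]_d -> R) -> R).
Hypothesis I_lin : forall (a : R) F G, bsupp x0 F -> bsupp x0 G ->
  I (fun z => a * F z + G z) = a * I F + I G.
Hypothesis I_ge0 : forall F, bsupp x0 F -> (forall z, 0 <= F z) -> 0 <= I F.
Hypothesis I_derive : forall F i, csupp x0 F -> I ('D_(basisv i) F) = 0.
Hypothesis I_le : forall F (C L : R), 0 <= L -> (forall z, `|F z| <= C) ->
  (forall z : 'rV[R]_d, (exists j, L < `|z 0 j - x0 0 j|) -> F z = 0) ->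
  `|I F| <= C * (2 * L + 1) ^+ d.
Hypothesis I_point : forall F G, csupp x0 F -> bsupp x0 G ->
  (forall z, `|rpartials (enum 'I_d) F z| <= G z) -> `|F x0| <= I G.

Definition form f g : R := I (density l f g).

(* In the context, this closes the side conditions of [I_lin]. *)
Let form_bsupp f g : bsupp x0 (density l f g) := bsupp_density x0 l f g.

Lemma bsupp0 : bsupp x0 (fun=> 0 : R).
Proof. by exists 0, 0; split=> // z; rewrite normr0. Qed.

Lemma integral0 : I (fun=> 0) = 0.
Proof.
by have := I_lin (-1) bsupp0 bsupp0; rewrite mulr0 addr0 mulN1r addNr.
Qed.

Lemma formDl u v w : form (u + v) w = form u w + form v w.
Proof.
rewrite /form -[I (density l u w)]mul1r -I_lin //; congr I; apply/funext => z.
have := congr1 (@^~ z) (repart_lin 1 u v); have := congr1 (@^~ z) (impart_lin 1 u v).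
rewrite scale1r /density /= oppr0 !mul0r !add0r !mul1r => -> ->; ring.
Qed.

Lemma formC u v : form u v = form v u.
Proof.
by congr I; apply/funext => z; rewrite /density; ring.
Qed.

Lemma form_ge0 u : 0 <= form u u.
Proof.
apply: I_ge0 => // z; rewrite /density mulr_ge0 ?expR_ge0 // addr_ge0 //.
  by rewrite -expr2 sqr_ge0.
by rewrite -expr2 sqr_ge0.
Qed.

Lemma formZ c u v : form (c *: u) v = form u (c^*%C *: v).
Proof.
congr I; apply/funext => z; rewrite /density.
have [r1 i1] := (congr1 (@^~ z) (repart_lin c u 0), congr1 (@^~ z) (impart_lin c u 0)).
have [r2 i2] := (congr1 (@^~ z) (repart_lin c^*%C v 0), congr1 (@^~ z) (impart_lin c^*%C v 0)).
rewrite !addr0 in r1 i1 r2 i2; rewrite r1 i1 r2 i2 /repart /impart /=.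
by case: c {r1 i1 r2 i2} => a b /=; ring.
Qed.

Lemma formNr u v : form u (- v) = - form u v.
Proof.
have form0 : form u 0 = 0.
  have := formDl 0 0 u; rewrite addr0 formC => /eqP.
  by rewrite -subr_eq0 opprD addNKr oppr_eq0 => /eqP.
apply/eqP; rewrite -addr_eq0 formC [form u v]formC -formDl addNr formC.
by rewrite form0.
Qed.

Lemma formZZ c u : form (c *: u) (c *: u) = Normc.normc c ^+ 2 * form u u.
Proof.
rewrite /form -[RHS]addr0 -integral0 -I_lin //; last exact: bsupp0.
congr I; apply/funext => z; rewrite addr0 /density.
have [r1 i1] := (congr1 (@^~ z) (repart_lin c u 0), congr1 (@^~ z) (impart_lin c u 0)).
rewrite !addr0 in r1 i1; rewrite r1 i1 /repart /impart /=.
case: c {r1 i1} => a b; rewrite /Normc.normc sqr_sqrtr ?addr_ge0 ?sqr_ge0 //=.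
by rewrite !expr2; ring.
Qed.

Lemma form_partial i u v : form (testpartials [:: i] u) v =
  form u (- (testpartials [:: i] v + mulcoord l v *+ ((l == i) * 2))).
Proof.
have := I_derive i (csupp_density x0 l u v).
have -> : 'D_(basisv i) (density l u v) = fun z =>
  1 * density l (testpartials [:: i] u) v z +
    density l u (testpartials [:: i] v + mulcoord l v *+ ((l == i) * 2)) z.
  apply/funext => z; rewrite derive_density mul1r; congr (_ + _).
  have := congr1 (@^~ z) (repart_lin 1 (testpartials [:: i] v) (mulcoord l v *+ ((l == i) * 2))).
  have := congr1 (@^~ z) (impart_lin 1 (testpartials [:: i] v) (mulcoord l v *+ ((l == i) * 2))).
  rewrite scale1r /density /= oppr0 !mul0r !add0r !mul1r => -> ->.
  case: (l == i); rewrite ?mulr0n /=.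
    have := congr1 (@^~ z) (repart_lin 1 (mulcoord l v) (mulcoord l v)).
    have := congr1 (@^~ z) (impart_lin 1 (mulcoord l v) (mulcoord l v)).
    rewrite scale1r mul1n mulr2n /= oppr0 !mul0r !add0r !mul1r => -> ->; ring.
  by rewrite ?mul0n ?mulr0n /repart /impart /=; ring.
rewrite I_lin // mul1r => /eqP; rewrite addr_eq0 => /eqP E.
by rewrite formNr.
Qed.

Definition dl u : V := testpartials [:: l] u.
Definition dl' u : V := - (dl u + mulcoord l u *+ 2).

Lemma dlD u v : dl (u + v) = dl u + dl v. Proof. exact: raddfD. Qed.

Lemma dl'D u v : dl' (u + v) = dl' u + dl' v.
Proof. by rewrite /dl' dlD mulcoordD mulrnDl addrACA opprD. Qed.

Lemma adj_dl u v : form (dl u) v = form u (dl' v).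
Proof. by rewrite /dl form_partial eqxx. Qed.

(** The term [u *+ 2] arises when [dl] hits the coordinate in [mulcoord l u *+ 2]. *)
Lemma comm_dl u : dl' (dl u) = dl (dl' u) + u *+ 2.
Proof.
have dm : dl (mulcoord l u) = u + mulcoord l (dl u).
  by rewrite /dl testpartials_mulcoord eqxx.
have dlMn v k : dl (v *+ k) = dl v *+ k by exact: raddfMn.
have dlN v : dl (- v) = - dl v by exact: raddfN.
have opp3 (a b c : V) : - (a + b) = - (a + (b + c)) + c.
  by rewrite addrA [in RHS]opprD subrK.
by rewrite /dl' dlN dlD dlMn dm (addrC u) mulrnDl; exact: opp3.
Qed.

(** The weight depends on the coordinate [l] only, so in the other directions the adjoint is the
    plain transpose. *)
Lemma adj_partials s u v : l \notin s ->
  form (testpartials s u) v = form u ((-1) ^+ size s *: testpartials s v).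
Proof.
elim: s u v => [|i s IH] u v.
  by rewrite !testpartials_nil scale1r.
rewrite inE negb_or => /andP[li ls].
rewrite -[i :: s]cat1s -testpartials_cat form_partial (negPf li) mul0n mulr0n addr0.
rewrite IH // (raddfN (testpartials s)) /= (testpartialsC s).
by rewrite scalerN exprS mulN1r scaleNr.
Qed.

Lemma mulcoordZ c v : mulcoord l (c *: v) = c *: mulcoord l v.
Proof. by apply: val_inj; apply/funext => z /=; rewrite mulrCA. Qed.

Lemma mulcoord_partials s v : l \notin s ->
  testpartials s (mulcoord l v) = mulcoord l (testpartials s v).
Proof.
elim: s v => [|i s IH] v; first by rewrite !testpartials_nil.
rewrite inE negb_or => /andP[li ls].
rewrite -[i :: s]cat1s -testpartials_cat IH // testpartials_mulcoord.
by rewrite (negPf li) mulr0n add0r testpartials_cat.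
Qed.

Lemma partials_dl' s v : l \notin s -> testpartials s (dl' v) = dl' (testpartials s v).
Proof.
move=> ls; rewrite /dl' (raddfN (testpartials s)) (raddfD (testpartials s)).
rewrite (raddfMn (testpartials s)) /= mulcoord_partials // /dl.
by rewrite (testpartialsC s).
Qed.

Context (J : Type) (r : seq J) (cf : J -> R[i]) (sq : J -> seq 'I_d)
  (ex : J -> nat) (m : nat).
Hypothesis sq_l : forall j, l \notin sq j.

Definition Bk k v : V := \sum_(j <- r | ex j == k) cf j *: testpartials (sq j) v.
Definition Bk' k v : V := \sum_(j <- r | ex j == k)
  (cf j)^*%C *: ((-1) ^+ size (sq j) *: testpartials (sq j) v).

Let form_sumr K (rK : seq K) (P : pred K) (F : K -> V) u :
  form u (\sum_(i <- rK | P i) F i) = \sum_(i <- rK | P i) form u (F i).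
Proof.
apply: (big_morph (form u)) => [v w|]; first by rewrite formC formDl !(formC u).
by have := formNr u 0; rewrite oppr0 => /eqP; rewrite -addr_eq0 -mulr2n mulrn_eq0 => /eqP.
Qed.

Let form_suml K (rK : seq K) (P : pred K) (F : K -> V) u :
  form (\sum_(i <- rK | P i) F i) u = \sum_(i <- rK | P i) form (F i) u.
Proof. by rewrite formC form_sumr; apply: eq_bigr => i _; rewrite formC. Qed.

Lemma Bk'D k u v : Bk' k (u + v) = Bk' k u + Bk' k v.
Proof.
by rewrite /Bk' -big_split; apply: eq_bigr => j _ /=; rewrite raddfD !scalerDr.
Qed.

Lemma adj_Bk k u v : form (Bk k u) v = form u (Bk' k v).
Proof.
rewrite /Bk /Bk' form_suml form_sumr; apply: eq_bigr => j _.
by rewrite formZ adj_partials //; congr form; rewrite testpartialsZ !scalerA mulrC.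
Qed.

Lemma comm_Bk_dl k u : Bk k (dl u) = dl (Bk k u).
Proof.
rewrite /Bk /dl raddf_sum; apply: eq_bigr => j _ /=.
by rewrite testpartialsZ testpartialsC.
Qed.

Lemma comm_Bk_dl' k u : Bk k (dl' u) = dl' (Bk k u).
Proof.
have dl'Z c v : dl' (c *: v) = c *: dl' v.
  by rewrite /dl' /dl testpartialsZ mulcoordZ scalerMnr -scalerDr scalerN.
rewrite /Bk [RHS](big_morph dl' dl'D (_ : dl' 0 = 0)); last first.
  by have := dl'D 0 0; rewrite addr0 => /eqP; rewrite -subr_eq0 opprD addNKr oppr_eq0 => /eqP.
by apply: eq_bigr => j _; rewrite partials_dl' // dl'Z.
Qed.

Lemma comm_Bk_Bk' k k' u : Bk k (Bk' k' u) = Bk' k' (Bk k u).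
Proof.
rewrite /Bk /Bk'; under eq_bigr => j _ do rewrite raddf_sum scaler_sumr.
under [RHS]eq_bigr => j _ do rewrite raddf_sum !scaler_sumr.
rewrite exchange_big; apply: eq_bigr => j _; apply: eq_bigr => j' _ /=.
rewrite !testpartialsZ (testpartialsC (sq j')) !scalerA; congr (_ *: _).
by rewrite -!mulrA mulrC -!mulrA.
Qed.

Hypothesis ex_m : forall j, (ex j <= m)%N.
Hypothesis sq_m : forall j, ex j = m -> sq j = [::].

Definition PJ u : V :=
  \sum_(j <- r) cf j *: testpartials (sq j ++ nseq (ex j) l) u.

Lemma form_PJ_ge u :
  Normc.normc (\sum_(j <- r | ex j == m) cf j) ^+ 2 * form u u <= form (PJ u) (PJ u).
Proof.
have -> : PJ u = \sum_(k < m.+1) Bk k (iter k dl u).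
  rewrite /PJ (partition_big (fun j => inord (ex j) : 'I_m.+1) predT) //=.
  apply: eq_bigr => k _; apply: eq_big => [j|j /eqP jk].
    by rewrite -val_eqE /= inordK ?ltnS ?ex_m.
  have -> : iter k dl u = testpartials (nseq (ex j) l) u.
    by rewrite -iter_testpartials -jk inordK ?ltnS ?ex_m.
  by rewrite testpartials_cat.
apply: le_trans _ (form_operator_ge formDl formC form_ge0 dl'D adj_dl comm_dl
  Bk'D adj_Bk comm_Bk_dl comm_Bk_dl' comm_Bk_Bk' m u).
rewrite le_eqVlt; apply/orP; left; apply/eqP.
have -> : Bk' m u = (\sum_(j <- r | ex j == m) cf j)^*%C *: u.
  rewrite /Bk' rmorph_sum scaler_suml; apply: eq_bigr => j /eqP /sq_m ->.
  by rewrite testpartials_nil /= scale1r.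
rewrite formZZ; congr (_ ^+ 2 * _).
by case: (\sum_(j <- r | _) _) => a b; rewrite /Normc.normc /= sqrrN.
Qed.

Lemma formZR (t : R) u v : form (t%:C *: u) v = t * form u v.
Proof.
rewrite /form -[RHS]addr0 -integral0 -I_lin //; last exact: bsupp0.
congr I; apply/funext => z; rewrite addr0 /density.
have [r1 i1] := (congr1 (@^~ z) (repart_lin t%:C u 0), congr1 (@^~ z) (impart_lin t%:C u 0)).
by rewrite !addr0 in r1 i1; rewrite r1 i1 /repart /impart /=; ring.
Qed.

Definition form_norm u := Num.sqrt (form u u).

Lemma form_norm_ge0 u : 0 <= form_norm u. Proof. exact: sqrtr_ge0. Qed.

Lemma form_normD u v : form_norm (u + v) <= form_norm u + form_norm v.
Proof.
have fsq (w w' : V) : form (w + w') (w + w') = form w w + 2 * form w w' + form w' w'.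
  by rewrite formDl !(formC _ (w + w')) !formDl (formC w' w); ring.
have CS : form u v <= form_norm u * form_norm v.
  have quad (t : R) : 0 <= form u u + 2 * t * form u v + t ^+ 2 * form v v.
    have := form_ge0 (u + t%:C *: v); rewrite fsq (formC u (_ *: _)) !formZR (formC v (_ *: _)).
    by rewrite formZR (formC v u) expr2 !mulrA.
  exact: discriminant_le (form_ge0 u) (form_ge0 v) quad.
rewrite -(ler_sqr (x := form_norm (u + v))) ?nnegrE ?addr_ge0 ?sqrtr_ge0 //.
rewrite sqr_sqrtr ?form_ge0 // sqrrD !sqr_sqrtr ?form_ge0 // fsq.
by rewrite lerD2r lerD2l mulr_natl ler_pMn2r.
Qed.

Lemma form_normZ c u : form_norm (c *: u) = Normc.normc c * form_norm u.
Proof.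
rewrite /form_norm formZZ sqrtrM ?sqr_ge0 // sqrtr_sqr ger0_norm //.
exact: normc_ge0.
Qed.

Lemma form_norm_le (K : set 'rV[R]_d) : compact K -> exists2 C : R, 0 < C &
  forall u (b : R), 0 <= b -> supp u `<=` K -> (forall z, Normc.normc (u z) <= b) ->
    form_norm u <= C * b.
Proof.
move=> cK; have [L L0 LP] := supp_box x0 cK.
have [M [_ MP]] := compact_bounded cK.
pose W := expR ((`|M| + 1) * (`|M| + 1)).
have W0 : 0 < W by exact: expR_gt0.
(* A bound of the weight on [K] times the size of a box around [K], as measured by [I_le]. *)
pose B := W * (2 * L + 1) ^+ d.
have B0 : 0 < B by rewrite mulr_gt0 // exprn_gt0 // ltr_wpDl // mulr_ge0.
exists (Num.sqrt B) => [|u b b0 uK ub]; first by rewrite sqrtr_gt0.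
have u0 z : ~ K z -> u z = 0.
  move=> nK; apply/eqP; apply: contrapT => /negP uz; apply: nK; apply: uK.
  exact: subset_closure.
have usq z : repart u z * repart u z + impart u z * impart u z = Normc.normc (u z) ^+ 2.
  rewrite /repart /impart /Normc.normc; case: (u z) => p q.
  by rewrite sqr_sqrtr ?addr_ge0 ?sqr_ge0 //= !expr2.
rewrite -[b in leRHS](ger0_norm b0) -sqrtr_sqr -(sqrtrM _ (ltW B0)) ler_wsqrtr //.
apply: le_trans (ler_norm _) _.
have -> : B * b ^+ 2 = (W * b ^+ 2) * (2 * L + 1) ^+ d by rewrite /B; ring.
apply: I_le => // z.
  rewrite /density usq; have [Kz|/u0 ->] := pselect (K z); last first.
    rewrite Normc.normc0 expr0n mulr0 normr0.
    exact: (mulr_ge0 (ltW W0) (exprn_ge0 2 b0)).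
  rewrite ger0_norm ?mulr_ge0 ?expR_ge0 ?exprn_ge0 ?normc_ge0 //.
  apply: ler_pM; rewrite ?expR_ge0 ?exprn_ge0 ?normc_ge0 //.
    rewrite ler_expR; apply: le_trans (ler_norm _) _; rewrite normrM.
    have zM : `|z 0 l| <= `|M| + 1.
      apply: le_trans (coord_le_norm z l) _; apply: MP => //.
      by rewrite (le_lt_trans (ler_norm M)) // ltrDl.
    by apply: ler_pM.
  by rewrite lerXn2r // nnegrE ?normc_ge0.
by move=> /LP/u0 uz; rewrite /density usq uz Normc.normc0 expr0n mulr0.
Qed.

Lemma density_sum (L : seq (seq 'I_d)) u :
  bsupp x0 (fun z => \sum_(t <- L) density l (testpartials t u) (testpartials t u) z) /\
  I (fun z => \sum_(t <- L) density l (testpartials t u) (testpartials t u) z) =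
  \sum_(t <- L) form (testpartials t u) (testpartials t u).
Proof.
elim: L => [|t L [bL IL]].
  rewrite (_ : (fun z => _) = fun=> 0); last by apply/funext => z; rewrite big_nil.
  by rewrite big_nil integral0; split=> //; exact: bsupp0.
rewrite (_ : (fun z => _) = fun z =>
    1 * density l (testpartials t u) (testpartials t u) z +
    \sum_(t <- L) density l (testpartials t u) (testpartials t u) z); last first.
  by apply/funext => z; rewrite big_cons mul1r.
split; first exact: bsupp_lin.
by rewrite I_lin // IL big_cons mul1r.
Qed.

(** The Sobolev step: [I_point] is applied to the squares of the real and of the imaginary part, and
    each Leibniz product is at most the sum of two squares. The factor 2 accounts for the two
    parts. *)
Lemma point_estimate : exists L : seq (seq 'I_d), forall u,
  Normc.normc (u x0) ^+ 2 <= 2 * \sum_(t <- L) form (testpartials t u) (testpartials t u).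
Proof.
have [S SP] := rpartials_sqr (R := R) (enum 'I_d).
exists (flatten [seq [:: ab.1; ab.2] | ab <- S]) => u.
set L := flatten _; have [bL IL] := density_sum L u.
have key (v : 'rV[R]_d -> R) : csupp x0 v ->
    (forall t z, rpartials t v z ^+ 2 <=
       density l (testpartials t u) (testpartials t u) z) ->
    v x0 ^+ 2 <= \sum_(t <- L) form (testpartials t u) (testpartials t u).
  move=> cv vd; rewrite -IL.
  have sv : rsmooth v by case: cv.
  have -> : v x0 ^+ 2 = `|(fun z => v z * v z) x0|.
    by rewrite -expr2 ger0_norm // sqr_ge0.
  apply: (I_point (csuppM sv cv) bL) => z.
  rewrite SP // /L big_flatten big_map.
  apply: le_trans (ler_norm_sum _ _ _) _; apply: ler_sum => ab _.
  rewrite !big_cons big_nil /= addr0 normrM.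
  apply: le_trans _ (lerD (vd ab.1 z) (vd ab.2 z)).
  rewrite -(real_normK (num_real (rpartials ab.1 v z))) -(real_normK (num_real (rpartials ab.2 v z))).
  move: `|_| `|_| (normr_ge0 (rpartials ab.1 v z)) (normr_ge0 (rpartials ab.2 v z)) => p q p0 q0.
  nra.
have D t z : density l (testpartials t u) (testpartials t u) z =
    weight l z * (rpartials t (repart u) z ^+ 2 + rpartials t (impart u) z ^+ 2).
  by rewrite /density repart_partials impart_partials !expr2.
have [cr ci] := csupp_testfun x0 u.
have W z (a b : R) : 0 <= a -> 0 <= b -> a <= weight l z * (a + b).
  move=> a0 b0; apply: le_trans (_ : 1 * (a + b) <= _); first by rewrite mul1r lerDl.
  by rewrite ler_wpM2r ?addr_ge0 // weight_ge1.
have kr := key (repart u) cr; have ki := key (impart u) ci.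
have -> : Normc.normc (u x0) ^+ 2 = repart u x0 ^+ 2 + impart u x0 ^+ 2.
  rewrite /repart /impart /Normc.normc; case: (u x0) => p q.
  by rewrite sqr_sqrtr ?addr_ge0 ?sqr_ge0.
rewrite mulr_natl mulr2n lerD //; [apply: kr|apply: ki] => t z; rewrite D.
  by apply: W; rewrite sqr_ge0.
by rewrite addrC; apply: W; rewrite sqr_ge0.
Qed.

Lemma PJ_lin : linear PJ.
Proof.
move=> c u v; rewrite /PJ scaler_sumr -big_split; apply: eq_bigr => j _ /=.
by rewrite testpartials_lin scalerDr !scalerA mulrC.
Qed.

Lemma PJ_partials t u : testpartials t (PJ u) = PJ (testpartials t u).
Proof.
rewrite /PJ raddf_sum; apply: eq_bigr => j _ /=.
by rewrite testpartialsZ testpartialsC.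
Qed.

Lemma seminorm_estimate : \sum_(j <- r | ex j == m) cf j != 0 ->
  exists p : V -> R, lf_seminorm p /\ forall u, Normc.normc (u x0) <= p (PJ u).
Proof.
set q := \sum_(j <- r | _) _ => q0.
have nq : 0 < Normc.normc q.
  by rewrite lt_neqAle eq_sym normc_ge0 andbT; apply: contra q0 => /eqP/Normc.eq0_normc ->.
have [L LP] := point_estimate.
(* [form_PJ_ge] is applied to each derivative [testpartials t u], which commutes with [PJ]; the [2]
   is that of [point_estimate]. *)
pose k := Num.sqrt 2 / Normc.normc q.
have k0 : 0 < k by rewrite divr_gt0 // sqrtr_gt0.
exists (fun u => k * \sum_(t <- L) form_norm (testpartials t u)); split; last first.
  move=> u; rewrite -(ler_sqr (x := Normc.normc _)) ?nnegrE ?normc_ge0 //; last first.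
    apply: (mulr_ge0 (ltW k0)); apply: sumr_ge0 => t _; exact: form_norm_ge0.
  apply: le_trans (LP u) _.
  rewrite exprMn expr_div_n sqr_sqrtr // -mulrA ler_wpM2l //.
  rewrite -(ler_pM2l (exprn_gt0 2 nq)) mulrA mulfV ?mul1r; last by rewrite expf_neq0 // gt_eqF.
  apply: le_trans (_ : \sum_(t <- L) form_norm (testpartials t (PJ u)) ^+ 2 <= _).
    rewrite mulr_sumr; apply: ler_sum => t _; rewrite sqr_sqrtr ?form_ge0 //.
    by rewrite PJ_partials; exact: form_PJ_ge.
  elim: L {LP} => [|t L IH]; first by rewrite !big_nil.
  rewrite !big_cons sqrrD; apply: le_trans (lerD (lexx _) IH) _.
  rewrite lerD2r lerDl mulrn_wge0 // mulr_ge0 ?form_norm_ge0 // sumr_ge0 // => t' _.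
  exact: form_norm_ge0.
split.
- move=> u v; rewrite -mulrDr (ler_wpM2l (ltW k0)) // -big_split; apply: ler_sum => t _.
  by rewrite (raddfD (testpartials t)); exact: form_normD.
- move=> c u; rewrite mulrCA; congr (_ * _); rewrite mulr_sumr; apply: eq_bigr => t _.
  by rewrite testpartialsZ form_normZ.
- move=> K cK _; have [C C0 CP] := form_norm_le cK.
  pose M := (\max_(t <- L) size t)%N.
  have S0 : 0 <= \sum_(t <- L) C by apply: sumr_ge0 => t _; exact: ltW.
  (* The [+ 1] keeps the constant positive, so that its product with an infinite [Cnorm] is
     infinite. *)
  exists (k * (\sum_(t <- L) C) + 1), M; split.
    by apply: addr_ge0 => //; exact: (mulr_ge0 (ltW k0) S0).
  move=> u uK; have := Cnorm_ge0 M u; case E : (Cnorm M u) => [b| |] // b0; last first.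
    rewrite mulry gtr0_sg ?mul1e ?leey //.
    by apply: ltr_wpDl => //; exact: (mulr_ge0 (ltW k0) S0).
  rewrite lee_fin in b0; rewrite -EFinM lee_fin mulrDl mul1r ler_wpDr //.
  rewrite -[leRHS]mulrA (ler_wpM2l (ltW k0)) // mulr_suml big_seq [leRHS]big_seq.
  apply: ler_sum => t tL; apply: CP => //.
    by apply: subset_trans uK; exact: supp_partials.
  move=> z; rewrite -lee_fin -E; apply: ereal_sup_ubound; exists t, z; split=> //.
  by rewrite /M; exact: leq_bigmax_seq.
Qed.

End Estimate.

(* Malgrange-Ehrenpreis, for an operator with a noncharacteristic direction
   [l]: the form [u] is a fundamental solution with pole [x0]. *)
Lemma fundamental_solution (R : realType) (d : nat) (x0 : 'rV[R]_d) (l : 'I_d)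
    (J : Type) (r : seq J) (cf : J -> R[i]) (sq : J -> seq 'I_d)
    (ex : J -> nat) (m : nat) :
  (forall j, l \notin sq j) -> (forall j, (ex j <= m)%N) ->
  (forall j, ex j = m -> sq j = [::]) ->
  \sum_(j <- r | ex j == m) cf j != 0 ->
  exists u : testfun (setT : set 'rV[R]_d) -> R[i],
    [/\ linear (u : _ -> R[i]^o), continuous (u : _ -> R[i]^o) &
      forall f, u (PJ l r cf sq ex f) = f x0].
Proof.
move=> sq_l ex_m sq_m q0.
have [I [I_lin I_ge0 I_derive I_le I_point]] := integral_exists x0.
have [p [sp pP]] := seminorm_estimate I_lin I_ge0 I_derive I_le I_point sq_l ex_m sq_m q0.
have [pD pZ _] := sp.
have [|u [lu up uP]] := hahn_banach pD pZ (PJ_lin l r cf sq ex) _ pP.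
  by move=> c f g; rewrite testfunD testfunZ.
exists u; split=> // f.
move=> U nU; have [e /= e0 eU] := (nbhs_ballP _ _).1 nU.
(* A positive element of [R[i]] is real. *)
have eR : e = (complex.Re e)%:C.
  by move: e0; case: (e) => a b; rewrite ltcE /= => /andP[/eqP -> _].
have e0R : 0 < complex.Re e.
  by move: e0; case: (e) => a b; rewrite ltcE /= => /andP[].
exists p, (complex.Re e); split=> // g /= gf; apply: eU.
rewrite -ball_normE /ball_ /=.
have -> : u f - u g = - u (g - f).
  have := lu (-1) f g; rewrite !scaleN1r (addrC (- f)) => ->.
  by rewrite opprD opprK.
rewrite normrN eR; apply: le_lt_trans (_ : (Normc.normc (u (g - f)))%:C < _).
  by rewrite normc_def; case: (u _).
by rewrite ltcR (le_lt_trans (up _)).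
Qed.

(** * Coefficients of the operator *)

Section Multinomials.
Context {d : nat}.
Implicit Types (a : multinom d) (i : 'I_d).

Lemma count_mem_mseq a i : count_mem i (mseq a) = a i.
Proof.
rewrite /mseq count_flatten -map_comp sumnE big_map big_enum /=.
rewrite (bigD1 i) //= count_nseq /= eqxx mul1n big1 ?addn0 // => j ji.
by rewrite count_nseq /= (negPf ji).
Qed.

Lemma mem_mseq a i : (i \in mseq a) = (0 < a i)%N.
Proof. by rewrite -has_pred1 has_count count_mem_mseq. Qed.

Lemma size_mseq a : size (mseq a) = mdeg a.
Proof.
rewrite mdegE /mseq size_flatten /shape -map_comp sumnE big_map big_enum /=.
by apply: eq_bigr => i _; rewrite size_nseq.
Qed.

Lemma mdeg_all2 i0 i1 a : i0 != i1 -> all (mem [:: i0; i1]) (mseq a) ->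
  mdeg a = (a i0 + a i1)%N.
Proof.
rewrite eq_sym => i10 /allP aP; rewrite mdegE (bigD1 i0) //= (bigD1 i1) //=.
rewrite big1 ?addn0 // => j /andP[j0 j1].
apply/eqP; rewrite -leqn0 leqNgt -mem_mseq; apply/negP => /aP.
by rewrite !inE (negPf j0) (negPf j1).
Qed.

Lemma mdeg_le i a : (a i <= mdeg a)%N.
Proof. by rewrite mdegE (bigD1 i) //= leq_addr. Qed.

Lemma mseq_filter_nil i a : (mdeg a <= a i)%N ->
  [seq j <- mseq a | j != i] = [::].
Proof.
move=> ai; apply/eqP; rewrite -size_eq0 size_filter -leqn0.
rewrite -(leq_add2l (count_mem i (mseq a))).
by rewrite (count_predC (pred1 i)) size_mseq count_mem_mseq addn0.
Qed.

Lemma perm_mseq i a :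
  perm_eq (mseq a) ([seq j <- mseq a | j != i] ++ nseq (a i) i).
Proof.
have -> : nseq (a i) i = [seq j <- mseq a | predC (predC1 i) j].
  have -> : [seq j <- mseq a | predC (predC1 i) j] = [seq j <- mseq a | pred1 i j].
    by apply: eq_filter => j /=; rewrite negbK.
  rewrite -[in LHS](count_mem_mseq a i) -size_filter; apply/esym/all_pred1P.
  by apply/allP => j; rewrite mem_filter => /andP[].
by rewrite perm_sym perm_filterC.
Qed.

Lemma prod_exp_plane (F : comNzRingType) i0 i1 (s t : F) a : i0 != i1 ->
  \prod_i (if i == i0 then s else if i == i1 then t else 0) ^+ a i =
  (all (mem [:: i0; i1]) (mseq a))%:R * s ^+ a i0 * t ^+ a i1.
Proof.
move=> i01; case: allP => [aP|/allP aN].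
  have i10 : i1 != i0 by rewrite eq_sym.
  rewrite (bigD1 i0) //= eqxx (bigD1 i1) //= eqxx (negPf i10) mul1r.
  rewrite big1 ?mulr1 // => j /andP[j0 j1]; rewrite (negPf j0) (negPf j1).
  have /negP : j \notin mseq a.
    by apply/negP => /aP; rewrite !inE (negPf j0) (negPf j1).
  by rewrite mem_mseq; case: (a j).
rewrite !mul0r; have [j ja] := allPn aN.
rewrite !inE negb_or => /andP[j0 j1].
rewrite (bigD1 j) //= (negPf j0) (negPf j1) expr0n.
by move: ja; rewrite mem_mseq; case: (a j) => //= k _; rewrite mul0r.
Qed.

Lemma prod_exp_line (F : comNzRingType) i0 (s : F) a :
  \prod_i (if i == i0 then s else 0) ^+ a i =
  (all (pred1 i0) (mseq a))%:R * s ^+ a i0.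
Proof.
case: allP => [aP|/allP aN].
  rewrite (bigD1 i0) //= eqxx mul1r.
  rewrite big1 ?mulr1 // => j j0; rewrite (negPf j0).
  have /negP : j \notin mseq a by apply/negP => /aP; rewrite /= (negPf j0).
  by rewrite mem_mseq; case: (a j).
rewrite !mul0r; have [j ja j0] := allPn aN.
rewrite (bigD1 j) //= (negPf (j0 : j != i0)) expr0n.
by move: ja; rewrite mem_mseq; case: (a j) => //= k _; rewrite mul0r.
Qed.

End Multinomials.

Lemma poly_eq_on_nat (F : numDomainType) (p q : {poly F}) :
  (forall k : nat, p.[k%:R] = q.[k%:R]) -> p = q.
Proof.
move=> pq; apply/eqP; rewrite -subr_eq0; apply/eqP.
pose rs := [seq k%:R : F | k <- iota 0 (size (p - q))].
apply: (@roots_geq_poly_eq0 _ _ rs).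
- by apply/allP => _ /mapP[k _ ->]; rewrite /root !hornerE pq subrr.
- by rewrite map_inj_uniq ?iota_uniq // => j k /eqP; rewrite eqr_nat => /eqP.
- by rewrite size_map size_iota.
Qed.

Lemma real_eval_plane (R : realType) (d : nat) (P : mpoly d R[i]) (i0 i1 : 'I_d)
    (s t : R) : i0 != i1 ->
  real_eval P (\row_i (if i == i0 then s else if i == i1 then t else 0)) =
  \sum_(a <- msupp P | all (mem [:: i0; i1]) (mseq a))
    mcoeff a P * s%:C ^+ a i0 * t%:C ^+ a i1.
Proof.
move=> i01; rewrite /real_eval mevalE big_mkcond [RHS]big_mkcond /=.
apply: eq_bigr => a _.
have -> : \prod_i ((\row_j (if j == i0 then s else if j == i1 then t else 0))
      0 i)%:C ^+ a i =
    \prod_i (if i == i0 then s%:C else if i == i1 then t%:C else 0) ^+ a i.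
  apply: eq_bigr => i _; rewrite mxE; congr (_ ^+ _).
  by case: eqP => // _; case: eqP.
rewrite prod_exp_plane //; case: all; first by rewrite mul1r mulrA.
by rewrite !mul0r mulr0.
Qed.

Lemma real_eval_line (R : realType) (d : nat) (P : mpoly d R[i]) (i0 : 'I_d)
    (s : R) :
  real_eval P (\row_i (if i == i0 then s else 0)) =
  \sum_(a <- msupp P | all (pred1 i0) (mseq a)) mcoeff a P * s%:C ^+ a i0.
Proof.
rewrite /real_eval mevalE big_mkcond [RHS]big_mkcond /=.
apply: eq_bigr => a _.
have -> : \prod_i ((\row_j (if j == i0 then s else 0)) 0 i)%:C ^+ a i =
    \prod_i (if i == i0 then s%:C else 0) ^+ a i.
  by apply: eq_bigr => i _; rewrite mxE; congr (_ ^+ _); case: eqP.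
rewrite prod_exp_line; case: all; first by rewrite mul1r.
by rewrite !mul0r mulr0.
Qed.

Lemma sum_coef_Xn (F : nzRingType) (I : Type) (r : seq I) (p : pred I)
    (c : I -> F) (k : I -> nat) b :
  (\sum_(i <- r | p i) c i *: 'X^(k i))`_b = \sum_(i <- r | p i && (k i == b)) c i.
Proof.
rewrite coef_sum big_mkcondr /=; apply: eq_bigr => i _.
by rewrite coefZ coefXn eq_sym; case: eqP => _; rewrite ?mulr1 ?mulr0.
Qed.

(** The hypothesis concerns values at real points. On the plane of the first and last coordinates it
    becomes an identity at natural arguments, which determines the coefficients first in the last
    variable and then in the first. *)
Lemma bivariate_coef (R : realType) (n m : nat) (P : mpoly n.+2 R[i])
    (Q : nat -> mpoly n.+1 R[i]) :
  (forall x : 'rV[R]_n.+2, real_eval P x =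
    \sum_(k < m.+1) real_eval (Q k) (\row_(i < n.+1) x 0 (widen_ord (leqnSn n.+1) i))
      * (x 0 ord_max)%:C ^+ k) ->
  forall a b, (b <= m)%N ->
  \sum_(c <- msupp P | [&& all (mem [:: ord0; ord_max]) (mseq c), c ord_max == b
                         & c ord0 == a]) mcoeff c P =
  \sum_(c <- msupp (Q b) | all (pred1 ord0) (mseq c) && (c ord0 == a))
     mcoeff c (Q b).
Proof.
move=> PQ a b bm.
have i01 : ord0 != ord_max :> 'I_n.+2 by [].
have row1 (s t : R) : (\row_(i < n.+1) (\row_(j < n.+2)
      (if j == ord0 then s else if j == ord_max then t else 0))
      0 (widen_ord (leqnSn n.+1) i)) =
    \row_(i < n.+1) (if i == ord0 then s else 0).
  apply/rowP => i; rewrite !mxE; case: i => -[|i] //= ii.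
  by rewrite -val_eqE /= (ltn_eqF ii).
have step1 (s : nat) :
    \sum_(c <- msupp P | all (mem [:: ord0; ord_max]) (mseq c))
      (mcoeff c P * s%:R ^+ c ord0) *: 'X^(c ord_max) =
    \sum_(k < m.+1) (\sum_(c <- msupp (Q k) | all (pred1 ord0) (mseq c))
      mcoeff c (Q k) * s%:R ^+ c ord0) *: 'X^k.
  apply: poly_eq_on_nat => t.
  have := PQ (\row_(j < n.+2)
      (if j == ord0 then s%:R else if j == ord_max then t%:R else 0)).
  rewrite real_eval_plane // !rmorph_nat !horner_sum => E.
  under eq_bigr do rewrite hornerZ hornerXn.
  rewrite E; apply: eq_bigr => k _.
  by rewrite row1 real_eval_line mxE hornerZ hornerXn /= eqxx !rmorph_nat.
have step2 : \sum_(c <- msupp P | all (mem [:: ord0; ord_max]) (mseq c) &&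
        (c ord_max == b)) mcoeff c P *: 'X^(c ord0) =
    \sum_(c <- msupp (Q b) | all (pred1 ord0) (mseq c))
      mcoeff c (Q b) *: 'X^(c ord0).
  apply: poly_eq_on_nat => s; rewrite !horner_sum.
  have := congr1 (fun p : {poly R[i]} => p`_b) (step1 s).
  rewrite !sum_coef_Xn => E.
  under eq_bigr do rewrite hornerZ hornerXn.
  under [RHS]eq_bigr do rewrite hornerZ hornerXn.
  by rewrite E (big_pred1 (Ordinal (bm : (b < m.+1)%N))).
have := congr1 (fun p : {poly R[i]} => p`_a) step2.
rewrite !sum_coef_Xn => <-; apply: eq_bigl => c; rewrite andbA //.
Qed.

Lemma all_pred1_mseq (d : nat) (c : multinom d) i :
  all (pred1 i) (mseq c) = (c i == mdeg c).
Proof. by rewrite all_count count_mem_mseq size_mseq. Qed.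

Lemma real_eval_principal_part (R : realType) (d m : nat) (P : mpoly d R[i]) i :
  msize P = m.+1 ->
  real_eval (principal_part P) (basisv i) =
  \sum_(c <- msupp P | c i == m) mcoeff c P.
Proof.
move=> Pm; rewrite /principal_part Pm /= /real_eval pihomogE raddf_sum /=.
rewrite big_seq_cond [RHS]big_seq_cond big_mkcond [RHS]big_mkcond /=.
apply: eq_bigr => c _; case: (boolP (c \in msupp P)) => //= cP.
rewrite mevalZ mevalX.
have -> : \prod_j (basisv i 0 j)%:C ^+ c j =
    \prod_j (if j == i then 1 else 0 : R[i]) ^+ c j.
  by apply: eq_bigr => j _; rewrite mxE eqxx /=; congr (_ ^+ _); case: eqP.
rewrite prod_exp_line all_pred1_mseq expr1n mulr1.
have cm : (mdeg c <= m)%N by rewrite -ltnS -Pm; exact: msize_mdeg_lt.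
have := mdeg_le i c; case: (eqVneq (mdeg c) m) => [->|cm' ci].
  by case: eqP; rewrite ?mulr1 ?mulr0.
case: eqP => // cim; case/negP: cm'; rewrite eqn_leq cm -cim; exact: ci.
Qed.

Lemma basisv_neq0 (R : realType) (d : nat) (i : 'I_d) : basisv i != 0 :> 'rV[R]_d.
Proof.
apply/eqP => /rowP /(_ i); rewrite !mxE !eqxx /= => /eqP.
by rewrite oner_eq0.
Qed.

Section PrincipalPart.
Context {R : realType} {n m : nat} (P : mpoly n.+2 R[i]).
Hypothesis Pm : msize P = m.+1.
Hypothesis Pmax : ~ characteristic P (basisv ord_max).

(** The power of [0 -i* 1] comes from [P(D)], that of [-1] from the transposition. *)
Definition adjoint_coef (c : multinom n.+2) : R[i] :=
  mcoeff c P * (0 -i* 1) ^+ mdeg c * (-1) ^+ mdeg c.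

Let i01 : ord0 != ord_max :> 'I_n.+2. Proof. by []. Qed.

Lemma mdeg_msupp_le c : c \in msupp P -> (mdeg c <= m)%N.
Proof. by move=> cP; rewrite -ltnS -Pm; exact: msize_mdeg_lt. Qed.

Lemma noncharacteristic_coef :
  \sum_(c <- msupp P | c ord_max == m) adjoint_coef c != 0.
Proof.
have -> : \sum_(c <- msupp P | c ord_max == m) adjoint_coef c =
    (\sum_(c <- msupp P | c ord_max == m) mcoeff c P) *
      ((0 -i* 1) ^+ m * (-1) ^+ m).
  rewrite mulr_suml big_seq_cond [RHS]big_seq_cond.
  apply: eq_bigr => c /andP[/mdeg_msupp_le cm /eqP cl].
  have := mdeg_le ord_max c; rewrite cl => mc.
  by rewrite /adjoint_coef (_ : mdeg c = m) ?mulrA //; apply/eqP; rewrite eqn_leq cm.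
rewrite -(real_eval_principal_part _ Pm) mulf_neq0 //.
  by apply/eqP => P0; apply: Pmax; split=> //; exact: basisv_neq0.
by rewrite mulf_neq0 // expf_neq0 // ?oppr_eq0 ?oner_eq0 // eq_complex /= oppr_eq0 oner_eq0 andbF.
Qed.

(** For [m = 0] the principal part is a constant, and the two basis vectors are both characteristic
    or both not. *)
Lemma degree_gt0 : characteristic P (basisv ord0) -> (0 < m)%N.
Proof.
move=> [_ P0]; rewrite lt0n; apply/eqP => m0; apply: Pmax.
split; first exact: basisv_neq0.
rewrite -P0 !(real_eval_principal_part _ Pm) m0.
rewrite big_seq_cond [RHS]big_seq_cond; apply: eq_bigl => c.
case: (boolP (c \in _)) => //= /mdeg_msupp_le; rewrite m0 leqn0 => /eqP c0.
by have := mdeg_le ord0 c; have := mdeg_le ord_max c; rewrite c0 !leqn0 => -> ->.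
Qed.

Definition plane_coef (a b : nat) : R[i] :=
  \sum_(c <- msupp P | [&& all (mem [:: ord0; ord_max]) (mseq c), c ord_max == b
                         & c ord0 == a]) adjoint_coef c.

Lemma plane_coef_top : plane_coef 0 m != 0.
Proof.
have -> : plane_coef 0 m = \sum_(c <- msupp P | c ord_max == m) adjoint_coef c.
  rewrite /plane_coef big_seq_cond [RHS]big_seq_cond; apply: eq_bigl => c.
  case: (boolP (c \in _)) => //= /mdeg_msupp_le cm.
  case: eqP => [cl|]; last by rewrite andbF.
  have := mdeg_le ord_max c; rewrite cl => mc.
  have {cm mc} cm : c ord_max = mdeg c by apply/eqP; rewrite cl eqn_leq mc.
  have : all (pred1 ord_max) (mseq c) by rewrite all_pred1_mseq cm.
  move=> /allP call; apply/andP; split.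
    by apply/allP => j /call /eqP ->; rewrite !inE eqxx orbT.
  rewrite -leqn0 leqNgt -mem_mseq; apply/negP => /call /=.
  by rewrite (negPf i01).
exact: noncharacteristic_coef.
Qed.

Variable Q : nat -> mpoly n.+1 R[i].
Hypothesis PQ : forall x : 'rV[R]_n.+2, real_eval P x =
    \sum_(k < m.+1) real_eval (Q k) (\row_(i < n.+1) x 0 (widen_ord (leqnSn n.+1) i))
      * (x 0 ord_max)%:C ^+ k.
Hypothesis Qdeg : forall k : nat, (k < m)%N ->
  (degree_in ord0 (Q k) < (Posz (m - k))%:E)%E.

Lemma degree_in_ge (d : nat) (p : mpoly d R[i]) i c : c \in msupp p ->
  ((Posz (c i))%:E <= degree_in i p)%E.
Proof.
rewrite /degree_in; elim: (msupp p : seq _) => // c' s IH.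
rewrite inE big_cons => /orP[/eqP <-|/IH cs].
  by rewrite le_max lexx.
by rewrite le_max cs orbT.
Qed.

(** Above total degree [m] there are no monomials, and [b = m] leaves only [(0, m)]. If [a + b = m]
    with [b < m], the powers in [adjoint_coef] are constant and factor out; what remains is a
    coefficient of [Q b] of degree [m - b] in the first variable, which the degree bound
    excludes. *)
Lemma plane_coef_top_eq0 a b : (m <= a + b)%N -> (a, b) != (0%N, m) ->
  plane_coef a b = 0.
Proof.
move=> mab ab; have [bm|bm] := ltnP b m; last first.
  rewrite /plane_coef big_seq_cond big_pred0 // => c.
  apply/negP => /and4P[/mdeg_msupp_le cm call /eqP cb /eqP ca].
  move: cm ab; rewrite (mdeg_all2 i01 call) ca cb xpair_eqE => abm.
  have a0 : a = 0%N by lia.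
  have bm' : b = m by lia.
  by rewrite a0 bm' !eqxx.
have [/eqP abm|abm] := boolP (a + b == m)%N; last first.
  rewrite /plane_coef big_seq_cond big_pred0 // => c.
  apply/negP => /and4P[/mdeg_msupp_le cm call /eqP cb /eqP ca].
  by move: cm; rewrite (mdeg_all2 i01 call) ca cb; lia.
have -> : plane_coef a b = (\sum_(c <- msupp P |
    [&& all (mem [:: ord0; ord_max]) (mseq c), c ord_max == b
      & c ord0 == a]) mcoeff c P) * ((0 -i* 1) ^+ m * (-1) ^+ m).
  rewrite mulr_suml; apply: eq_bigr => c /and3P[call /eqP cb /eqP ca].
  by rewrite /adjoint_coef (mdeg_all2 i01 call) ca cb abm mulrA.
rewrite (bivariate_coef PQ) 1?ltnW // big_seq_cond big_pred0 ?mul0r // => c.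
apply/negP => /and3P[cQ _ /eqP ca].
have := le_lt_trans (degree_in_ge ord0 cQ) (Qdeg bm).
by rewrite ca lte_fin ltz_nat; lia.
Qed.

End PrincipalPart.

(** * The obstruction to density *)

Section Adjoint.
Context {R : realType} {n : nat} (P : mpoly n.+2 R[i]).
Implicit Types (X : set 'rV[R]_n.+2).

Definition adjoint_fun (f : 'rV[R]_n.+2 -> R[i]) (z : 'rV[R]_n.+2) : R[i] :=
  \sum_(c <- msupp P) adjoint_coef P c * partials (mseq c) f z.

Definition adjoint X (f : testfun X) : testfun X :=
  \sum_(c <- msupp P) adjoint_coef P c *: testpartials (mseq c) f.

Lemma adjointE X (f : testfun X) z : adjoint f z = adjoint_fun f z.
Proof.
rewrite /adjoint /adjoint_fun.
by elim/big_rec2: _ => // c _ y _ <-; rewrite testfunD testfunZ.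
Qed.

Lemma linear_sumZ (V W : lmodType R[i]) (u : V -> W) (I : Type) (r : seq I)
    (a : I -> R[i]) (F : I -> V) : linear u ->
  u (\sum_(i <- r) a i *: F i) = \sum_(i <- r) a i *: u (F i).
Proof.
move=> lu; elim: r => [|i r IH]; last by rewrite !big_cons lu IH.
by rewrite !big_nil; have := lu (-1) 0 0; rewrite !scaleN1r !addNr => ->.
Qed.

Lemma dist_PD_adjoint X (u : testfun X -> R[i]) f :
  linear (u : testfun X -> R[i]^o) -> dist_PD P u f = u (adjoint f).
Proof.
move=> lu; rewrite [RHS](linear_sumZ _ _ _ lu).
by apply: eq_bigr => c _; rewrite /dist_partial /adjoint_coef mulrA.
Qed.

Lemma adjoint_incl X Y (XY : X `<=` Y) (f : testfun X) :
  testfun_incl XY (adjoint f) = adjoint (testfun_incl XY f).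
Proof.
by apply: val_inj; apply/funext => z; rewrite [RHS]adjointE /= adjointE.
Qed.

Lemma partials_near s (f g : 'rV[R]_n.+2 -> R[i]) (z : 'rV[R]_n.+2) :
  smooth f -> smooth g -> (\forall y \near z, f y = g y) ->
  partials s f z = partials s g z.
Proof.
have loc (h k : 'rV[R]_n.+2 -> R) : rsmooth h -> rsmooth k ->
    (\forall y \near z, h y = k y) -> rpartials s h z = rpartials s k z.
  move=> sh sk hk.
  have : \forall y \near z, -1 * h y + k y = 0.
    by apply: filterS hk => y ->; rewrite mulN1r addNr.
  move=> /(rpartials_near0 s) /nbhs_singleton.
  by rewrite rpartials_lin // mulN1r addrC => /eqP; rewrite subr_eq0 => /eqP.
move=> [rf mf] [rg mg] fg; rewrite /partials.
by rewrite (loc _ _ rf rg) 1?(loc _ _ mf mg) //;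
  apply: filterS fg => y ->.
Qed.

Lemma adjoint_fundamental m (x : 'rV[R]_n.+2) : msize P = m.+1 ->
  ~ characteristic P (basisv ord_max) ->
  exists u : testfun (setT : set 'rV[R]_n.+2) -> R[i],
    [/\ linear (u : _ -> R[i]^o), continuous (u : _ -> R[i]^o) &
      forall f, u (adjoint f) = f x].
Proof.
move=> Pm Pmax.
(* [fundamental_solution] asks for its conditions at every index; indexing by positions in the
   support restricts them to monomials of [P]. *)
pose sq (j : 'I_(size (msupp P))) :=
  [seq i <- mseq (tnth (in_tuple (msupp P)) j) | i != ord_max].
pose ex (j : 'I_(size (msupp P))) := tnth (in_tuple (msupp P)) j ord_max.
pose cf (j : 'I_(size (msupp P))) := adjoint_coef P (tnth (in_tuple (msupp P)) j).
have tP j : (mdeg (tnth (in_tuple (msupp P)) j) <= m)%N.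
  by apply: (mdeg_msupp_le Pm); exact: mem_tnth.
have [||||u [lu cu uP]] := @fundamental_solution R n.+2 x ord_max _
    (index_enum 'I_(size (msupp P))) cf sq ex m.
- by move=> j; rewrite mem_filter eqxx.
- by move=> j; apply: leq_trans (tP j); exact: mdeg_le.
- by move=> j exj; apply: mseq_filter_nil; rewrite -/(ex j) exj.
- have := noncharacteristic_coef Pm Pmax; rewrite big_tnth; exact.
exists u; split=> // f; rewrite -uP; congr u.
rewrite /adjoint big_tnth /PJ; apply: eq_bigr => j _; congr (_ *: _).
by apply: testpartials_perm; exact: perm_mseq.
Qed.

End Adjoint.

(** * Evaluation at a test function in the strong dual topology *)

Section StrongDual.
Context {R : realType} {d : nat} {X : set 'rV[R]_d}.

(** Singletons being bounded, uniform convergence on bounded sets implies convergence at each test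
    function. *)
Lemma vN_bounded_set1 (f : testfun X) : vN_bounded [set f].
Proof.
move=> U [p [e [sp e0 pU]]]; have [_ pZ _] := sp.
have pf : 0 <= p f by exact: lf_seminorm_ge0.
exists (p f / e + 1)%:C; first by rewrite ltcR ltr_wpDl // divr_ge0 // ltW.
move=> a ra _ ->.
have {}ra : p f / e + 1 <= Normc.normc a.
  by rewrite -lecR; apply: le_trans ra _; case: (a).
have a0 : 0 < Normc.normc a.
  apply: lt_le_trans ra.
  by rewrite ltr_wpDl // divr_ge0 // ltW.
have aN0 : a != 0 by apply: contraTneq a0 => ->; rewrite Normc.normc0 ltxx.
exists (a^-1 *: f); last by rewrite scalerA divff // scale1r.
apply: pU => /=; rewrite subr0 pZ Normc.normcV.
rewrite mulrC ltr_pdivrMr //.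
have : p f / e < Normc.normc a by apply: lt_le_trans ra; rewrite ltrDl.
by rewrite ltr_pdivrMr // mulrC.
Qed.

Lemma eval_continuous (f : testfun X) :
  continuous (fun v : strong_dual_space X => (v f : R[i]^o)).
Proof.
move=> v; have fv := nbhs_filter v.
have := (@fam_cvgP (testfun X) R[i]^o (@vN_bounded R[i] (testfun X)) (nbhs v) v
  fv).1 (fun A => id) [set f] (@vN_bounded_set1 f).
by move=> H; exact: (eq_ind _ id H _ (@uniform_set1 (testfun X) R[i]^o (nbhs v) v f fv)).
Qed.

Lemma open_eval_neq0 (P : mpoly d R[i]) (f : testfun X) :
  open [set v : dist_ker P X | set_val v f != 0 :> R[i]].
Proof.
have cv : continuous (fun v : dist_ker P X => (set_val v f : R[i]^o)).
  move=> v; apply: (@continuous_comp _ _ _ set_val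
    (fun v : strong_dual_space X => (v f : R[i]^o)) v).
    exact: initial_continuous.
  exact: eval_continuous.
have o0 : open (~` [set (0 : R[i]^o)]).
  by apply: closed_openC; apply: accessible_closed_set1;
    apply: hausdorff_accessible; exact: norm_hausdorff.
have -> : [set v : dist_ker P X | set_val v f != 0 :> R[i]] =
    (fun v : dist_ker P X => (set_val v f : R[i]^o)) @^-1` (~` [set 0]).
  by apply/seteqP; split=> v /= /eqP.
exact: ((continuousP _).1 cv _ o0).
Qed.

End StrongDual.

Lemma smooth_mulR (R : realType) (d : nat) (chi : 'rV[R]_d -> R)
    (w : 'rV[R]_d -> R[i]) :
  rsmooth chi -> smooth w -> smooth (fun z => (chi z)%:C * w z).
Proof.
move=> schi [rw mw]; split.
  have -> : (fun z => complex.Re ((chi z)%:C * w z)) =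
    fun z => chi z * complex.Re (w z).
    by apply/funext => z; case: (w z) => a b /=; rewrite mul0r subr0.
  exact: rsmoothM.
have -> : (fun z => complex.Im ((chi z)%:C * w z)) =
  fun z => chi z * complex.Im (w z).
  by apply/funext => z; case: (w z) => a b /=; rewrite mul0r addr0.
exact: rsmoothM.
Qed.

Section Obstruction.
Context {R : realType} {n : nat} (P : mpoly n.+2 R[i]).

(** Not vanishing on [phi] is an open condition; the restricted fundamental solution meets it and no
    restriction from [X2] does. [psi] lives on a set [K] of its own because it is used both on the
    whole space and on [X2]. *)
Lemma restrict_not_dense m (X1 X2 K : set 'rV[R]_n.+2) (X12 : X1 `<=` X2)
    (x : 'rV[R]_n.+2) (psi : testfun K) (phi : testfun X1) :
  msize P = m.+1 -> ~ characteristic P (basisv ord_max) ->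
  ~ X1 x -> K `<=` X2 -> psi x != 0 -> (forall z, phi z = adjoint P psi z) ->
  ~ dense (range (@dist_restrict R n.+2 X1 X2 P X12)).
Proof.
move=> Pm Pmax X1x KX2 psix phiE dns.
have [u [lu cu uP]] := adjoint_fundamental x Pm Pmax.
pose u1 : strong_dual_space X1 := fun f => u (testfun_incl (@subsetT _ X1) f).
have lu1 : linear (u1 : testfun X1 -> R[i]^o).
  by move=> a f g; rewrite /u1 testfun_incl_lin lu.
have u1P : u1 \in dist_ker P X1.
  apply/mem_set; split; first split=> //.
    move=> f; apply: continuous_comp; last exact: cu.
    exact: testfun_incl_continuous.
  (* Test functions on [X1] do not see the pole: the value is [f x], and [x] is outside [X1]. *)
  move=> f; rewrite (@dist_PD_adjoint _ _ _ _ u1 f lu1) /u1 adjoint_incl uP /=.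
  apply: contrapT => /eqP fx; apply: X1x; have [_ _] := testfunP f; apply.
  exact: subset_closure.
have u1psi : u1 phi = psi x.
  rewrite -[RHS](uP (testfun_incl (@subsetT _ K) psi)) /u1; congr u.
  by rewrite -adjoint_incl; apply: val_inj; apply/funext => z; exact: phiE.
have [||v []] := dns [set v : dist_ker P X1 | set_val v phi != 0 :> R[i]].
- by exists (exist _ u1 u1P); rewrite -u1psi in psix.
- exact: open_eval_neq0.
move=> [/eqP + [u2 _ u2v]]; rewrite -u2v; apply.
have [[lu2 _] u2P] := set_mem (valP u2).
transitivity (set_val u2 (testfun_incl X12 phi)); first by [].
rewrite -(u2P (testfun_incl KX2 psi)) (@dist_PD_adjoint _ _ _ _ (set_val u2) _ lu2).
congr (set_val u2 _); rewrite -adjoint_incl.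
by apply: val_inj; apply/funext => z; exact: phiE.
Qed.

Lemma adjoint_fun_plane m (w : 'rV[R]_n.+2 -> R[i])
    (W : nat -> nat -> 'rV[R]_n.+2 -> R[i]) (z : 'rV[R]_n.+2) :
  msize P = m.+1 ->
  (forall s, partials s w z = (all (mem [:: ord0; ord_max]) s)%:R *
    W (count_mem ord0 s) (count_mem ord_max s) z) ->
  adjoint_fun P w z =
    \sum_(b < m.+1) \sum_(a < m.+1) plane_coef P a b * W a b z.
Proof.
move=> Pm wW; rewrite /adjoint_fun.
transitivity (\sum_(c <- msupp P) \sum_(b < m.+1) \sum_(a < m.+1)
    if [&& all (mem [:: ord0; ord_max]) (mseq c), c ord_max == b & c ord0 == a]
    then adjoint_coef P c * W a b z else 0).
  apply: eq_big_seq => c cP; have cm := mdeg_msupp_le Pm cP.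
  rewrite wW !count_mem_mseq; case: (boolP (all _ _)) => call; last first.
    by rewrite mul0r mulr0 big1 // => b _; rewrite big1.
  have bm : (c ord_max < m.+1)%N by rewrite ltnS (leq_trans (mdeg_le _ _) cm).
  have am : (c ord0 < m.+1)%N by rewrite ltnS (leq_trans (mdeg_le _ _) cm).
  rewrite (bigD1 (Ordinal bm)) //= (bigD1 (Ordinal am)) //= !eqxx mul1r.
  rewrite !big1 ?addr0 // => [b bN|a aN].
    rewrite big1 // => a _; case: eqP => // cb.
    by case/eqP: bN; apply: val_inj; exact: esym.
  case: eqP => // ca.
  by case/eqP: aN; apply: val_inj; exact: esym.
rewrite exchange_big; apply: eq_bigr => b _ /=.
rewrite exchange_big; apply: eq_bigr => a _ /=.
by rewrite /plane_coef mulr_suml [RHS]big_mkcond.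
Qed.

End Obstruction.

Theorem theorem2 (R : realType) (n m : nat) (P : mpoly n.+2 R[i])
    (Q : nat -> mpoly n.+1 R[i]) (X1 X2 : set 'rV[R]_n.+2)
    (X12 : X1 `<=` X2) :
  msize P = m.+1 ->
  characteristic P (basisv ord0) ->
  ~ characteristic P (basisv ord_max) ->
  (forall x : 'rV[R]_n.+2, real_eval P x =
    \sum_(k < m.+1) real_eval (Q k) (\row_(i < n.+1) x 0 (widen_ord (leqnSn n.+1) i))
      * (x 0 ord_max)%:C ^+ k) ->
  (forall k : nat, (k < m)%N -> (degree_in ord0 (Q k) < (Posz (m - k))%:E)%E) ->
  open X1 -> open X2 ->
  dense (range (@dist_restrict R n.+2 X1 X2 P X12)) ->
  ~ exists c : R, exists x : 'rV[R]_n.+2,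
      let A := ~` X1 `&` [set y : 'rV[R]_n.+2 | y 0 ord0 = c] in
      [/\ A x, compact (connected_component A x)
        & connected_component A x `<=` X2].
Proof.
move=> Pm P0 Pmax PQ Qdeg oX1 oX2 dns [c [x [Ax cC CX2]]].
have [X1x xc] := Ax; rewrite /= in xc.
have [chi [S [e [schi chix cS e0 [chiS SX]]]]] :=
  component_cutoff oX1 oX2 Ax cC CX2.
have [w [sw wx wN [W [wW W0]]]] 
  := @null_solution R n.+2 ord0 ord_max isT m (plane_coef P) x e
    (degree_gt0 Pm Pmax P0) e0
  (plane_coef_top Pm Pmax) (plane_coef_top_eq0 Pm PQ Qdeg).
rewrite xc in wN.
have w0 z : adjoint_fun P w z = 0.
  by rewrite (adjoint_fun_plane Pm (fun s => wW s z)) W0.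
(* [S] bounds the support of [chi] and the slab that of [w]. Taking [K] itself as the domain of
   [psi] records this bound in the type, for [psi] and for its image under [adjoint P]. *)
pose K := S `&` [set z : 'rV[R]_n.+2 | `|z 0 ord0 - c| <= e].
have cK : compact K.
  apply: (compact_closedI cS).
  have -> : [set z : 'rV[R]_n.+2 | `|z 0 ord0 - c| <= e] =
      (fun z : 'rV[R]_n.+2 => z 0 ord0) @^-1` closed_ball_ (fun t : R => `|t|) c e.
    by apply/seteqP; split=> z /=; rewrite distrC.
  apply: closed_comp; last exact: closed_closed_ball_.
  by move=> z _; exact: coord_continuous.
have clK : closed K by apply: compact_closed cK; exact: norm_hausdorff.
have KX2 : K `<=` X2 by move=> z [Sz /SX] /(_ Sz) [].
have suppK : supp (fun z => (chi z)%:C * w z) `<=` K.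
  rewrite /supp; have -> : K = closure K by apply/closure_id.
  apply: closure_subset => z /= cwz; split.
    by apply: chiS; apply: contraNneq cwz => ->; rewrite mul0r.
  rewrite /= leNgt; apply/negP => ez; move: cwz.
  by rewrite wN ?mulr0 ?eqxx // ltW.
have psiK : is_testfun K (fun z => (chi z)%:C * w z).
  split; [exact: smooth_mulR| |exact: suppK].
  by apply: (subclosed_compact _ cK suppK); exact: closed_closure.
pose psi : testfun K := TestFun (asboolT psiK).
(* At a point of the support outside [X1], [psi] would agree with [w] nearby, and the transpose
   annihilates [w]. *)
have suppX1 : supp (adjoint P psi) `<=` X1.
  move=> z sz; have [sphi _ phiK] := testfunP (adjoint P psi).
  have [Sz ez] := phiK _ sz; have [_ [//|chi1]] := SX z ez Sz.
  exfalso; move: sz; apply/suppNP; have {}chi1 := near_join chi1.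
  apply: filterS chi1 => y chi1.
  rewrite adjointE -(w0 y); apply: eq_bigr => a _; congr (_ * _).
  apply: (@partials_near _ _ _ psi w y (smooth_mulR schi sw) sw).
  by apply: filterS chi1 => t /= ->; rewrite mul1r.
have phiX1 : is_testfun X1 (adjoint P psi).
  by have [sphi cphi _] := testfunP (adjoint P psi).
apply: (@restrict_not_dense _ _ P m X1 X2 K X12 x psi
  (TestFun (asboolT phiX1))) dns => //.
by rewrite /= chix mul1r.
Qed.
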